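(* Consider the kinetically constrained model (KCM) with the mixed threshold Fredrickson-Andersen constraint on $\mathbb{Z}^2$ in the random environment $\omega\sim\nu$ with parameter $\pi\in(0,1)$. 1. There exists a constant $c>0$ (that does not depend on $\pi$ and $q$) such that, $\nu$-almost surely, for all sufficiently small $q$ the relaxation time of the dynamics is at least $e^{c/q}$. 2. $\nu$-almost surely there exist $\underline{\alpha}$ and $\overline{\alpha}$ (real numbers not depending on $q$, which may depend on $\omega$) such that $$\mathbb{P}_{\mu}\left[\tau_{0}\ge q^{-\overline{\alpha}}\right]\xrightarrow{q\rightarrow0}0,\qquad \mathbb{P}_{\mu}\left[\tau_{0}\le q^{-\underline{\alpha}}\right]\xrightarrow{q\rightarrow0}0.$$ Moreover, $\mathbb{E}_{\mu}\left[\tau_{0}\right]\ge q^{-\underline{\alpha}}$ for $q$ small enough.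
   Context: Environment: $\omega=(\omega_x)_{x\in\mathbb{Z}^2}\in\{1,2\}^{\mathbb{Z}^2}$ is random with law $\nu$, under which the $\omega_x$ are independent, $\omega_x=1$ with probability $\pi$ and $\omega_x=2$ with probability $1-\pi$. The environment is fixed (quenched). Configurations: $\Omega=\{0,1\}^{\mathbb{Z}^2}$; a site $x$ is empty if $\eta_x=0$ and occupied if $\eta_x=1$. The constraint is $c_x(\eta)=1$ if $\sum_{y\sim x}(1-\eta_y)\ge\omega_x$ (sum over nearest neighbors of $x$), and $c_x(\eta)=0$ otherwise. For $q\in(0,1)$, $\mu=\bigotimes_{x\in\mathbb{Z}^2}\mu_x$ with each $\mu_x$ Bernoulli of parameter $1-q$ (each site is empty with probability $q$). The KCM is the continuous time Markov process on $\Omega$, reversible with respect to $\mu$, with generator $\mathcal{L}f=\sum_x c_x(\mu_x f-f)$ for local functions $f$, where $\mu_x f$ denotes the average of $f$ over $\eta_x\sim\mu_x$ with the other coordinates fixed. Its Dirichlet form is $\mathcal{D}f=\mu\left(\sum_x c_x\mathrm{Var}_x f\right)$, where $\mathrm{Var}_x$ is the variance with respect to $\mu_x$. The spectral gap is $\inf \mathcal{D}f/\mathrm{Var}_\mu f$ over non-constant $f$ in the domain of $\mathcal L$, and the relaxation time is the inverse of the spectral gap (it is $\infty$ if the gap is $0$). $\mathbb{P}_\mu,\mathbb{E}_\mu$ denote probability and expectation for the process started from the equilibrium measure $\mu$ (the environment $\omega$ being fixed). $\tau_0=\inf\{t:\eta_0(t)=0\}$ is the first time at which the origin is empty. *)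

(* Defs.v *)
From HB Require Import structures.
From mathcomp Require Import all_boot all_order all_algebra.
From mathcomp Require Import all_classical all_reals all_analysis.
Import Order.TTheory GRing.Theory Num.Theory.
Import numFieldNormedType.Exports.

Set Implicit Arguments.
Unset Strict Implicit.
Unset Printing Implicit Defensive.

Local Open Scope classical_set_scope.
Local Open Scope ring_scope.

Definition site : Type := (int * int)%type.

Definition origin : site := (0, 0).

Definition neighbors (x : site) : seq site :=
  [:: (x.1 + 1, x.2); (x.1 - 1, x.2); (x.1, x.2 + 1); (x.1, x.2 - 1)].

(* Elements of {0,1}^(Z^2), with the product sigma-algebra.  The same space
   carries the particle configurations (true = occupied, false = empty) and
   the environments (true = threshold 1, false = threshold 2). *)
Definition coordinate_events : set (set (site -> bool)) :=
  [set B | exists x : site, B = [set eta | eta x = true]].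

Definition config := g_sigma_algebraType coordinate_events.

(* The joint law of i.i.d. coordinates equal to true with probability p; it
   determines the measure, since cylinders form a generating pi-system. *)
Definition bernoulli_product (R : realType) (p : R)
    (mu : probability config R) : Prop :=
  forall (s : seq site) (sigma : config), uniq s ->
    mu [set eta | forall x, x \in s -> eta x = sigma x] =
    (\prod_(x <- s) (if sigma x then p else 1 - p))%:E.

Definition threshold (omega : config) (x : site) : nat :=
  if omega x then 1%N else 2%N.

Definition constraint (omega : config) (x : site) (eta : config) : bool :=
  (threshold omega x <= \sum_(y <- neighbors x) (1 - eta y))%N.

Definition update (eta : config) (x : site) (b : bool) : config :=
  fun y => if y == x then b else eta y.

Section Dynamics.
Variable R : realType.
Implicit Types (q : R) (f g : config -> R) (omega eta : config).

Definition site_mean q (x : site) f : config -> R :=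
  fun eta => q * f (update eta x false) + (1 - q) * f (update eta x true).

Definition site_var q (x : site) f : config -> R :=
  site_mean q x (fun eta => (f eta - site_mean q x f eta) ^+ 2).

Definition local_fun f : Prop :=
  exists2 A : set site, finite_set A &
    forall eta xi : config, (forall x, A x -> eta x = xi x) -> f eta = f xi.

(* For local f only finitely many terms are nonzero; the finitely supported
   sum is a junk value otherwise. *)
Definition generator omega q f : config -> R :=
  fun eta => \sum_(x \in [set: site])
    (constraint omega x eta)%:R * (site_mean q x f eta - f eta).

Definition dirichlet omega q (mu : probability config R) f : \bar R :=
  (\int[mu]_eta \esum_(x in [set: site])
     ((constraint omega x eta)%:R * site_var q x f eta)%:E)%E.

(* Domain in L^2(mu) of the closure of the generator on local functions. *)
Definition generator_domain omega q (mu : probability config R) f : Prop :=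
  f \in Lfun mu 2%:E /\
  exists (g : config -> R) (u : nat -> config -> R),
    [/\ g \in Lfun mu 2%:E,
        forall n, local_fun (u n),
        ('N[mu]_2%:E[EFin \o (u n \- f)%R])%E @[n --> \oo] --> 0%E &
        ('N[mu]_2%:E[EFin \o (generator omega q (u n) \- g)%R])%E
          @[n --> \oo] --> 0%E].

Definition spectral_gap omega q (mu : probability config R) : \bar R :=
  ereal_inf [set (dirichlet omega q mu f / 'V_mu[f])%E | f in
    [set f | generator_domain omega q mu f /\
             ~ exists c : R, f = cst c %[ae mu]]].

(* On \bar R, 0^-1 = +oo. *)
Definition relaxation_time omega q (mu : probability config R) : \bar R :=
  (spectral_gap omega q mu)^-1%E.

Definition continuous_config f : Prop :=
  continuous (f : {ptws site -> bool} -> R).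

(* Feller semigroup on C({0,1}^(Z^2)); the values S t f for t < 0 or f
   discontinuous are irrelevant. *)
Record feller_semigroup (S : R -> (config -> R) -> (config -> R)) : Prop := {
  feller_cont : forall t f, 0 <= t ->
    continuous_config f -> continuous_config (S t f);
  feller_linear : forall t (a : R) f g, 0 <= t ->
    continuous_config f -> continuous_config g ->
    S t (fun eta => a * f eta + g eta) = (fun eta => a * S t f eta + S t g eta);
  feller_one : forall t, 0 <= t -> S t (cst 1) = cst 1;
  feller_pos : forall t f, 0 <= t -> continuous_config f ->
    (forall eta, 0 <= f eta) -> forall eta, 0 <= S t f eta;
  feller_0 : forall f, continuous_config f -> S 0 f = f;
  feller_add : forall s t f, 0 <= s -> 0 <= t -> continuous_config f ->
    S (s + t) f = S s (S t f);
  feller_strong : forall f, continuous_config f ->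
    {uniform, S t f @[t --> 0^'+] --> f} }.

(* The rates being bounded and of finite range, the closure of the generator on
   local functions is a Markov generator (Liggett), so at most one Feller
   semigroup has an infinitesimal generator extending it. *)
Definition generated_by omega q (S : R -> (config -> R) -> (config -> R)) :=
  forall f, local_fun f ->
    {uniform, (fun eta => (S t f eta - f eta) / t) @[t --> 0^'+]
       --> generator omega q f}.

Section Process.
Context d (T : measurableType d) (P : probability T R) (X : R -> T -> config).

Definition history (s : R) : set (set T) :=
  <<s [set B | exists (u : R) (A : set config),
         [/\ 0 <= u, u <= s, measurable A & B = X u @^-1` A]] >>.

(* The last field is the Markov property
   E[f(X_(s+t)) | X_u, u <= s] = (S_t f)(X_s). *)
Record kcm_process omega q (mu : probability config R) : Prop := {
  kcm_measurable : forall t, 0 <= t -> measurable_fun [set: T] (X t);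
  kcm_initial : forall A : set config, measurable A -> P (X 0 @^-1` A) = mu A;
  kcm_right_cont : forall w x (t : R), 0 <= t ->
    X s w x @[s --> t^'+] --> X t w x;
  kcm_left_lim : forall w x (t : R), 0 < t -> cvg (X s w x @[s --> t^'-]);
  kcm_markov : exists S : R -> (config -> R) -> (config -> R),
    [/\ feller_semigroup S, generated_by omega q S &
        forall (s t : R) f (B : set T), 0 <= s -> 0 <= t ->
          continuous_config f -> history s B ->
          (\int[P]_(w in B) (f (X (s + t) w))%:E =
           \int[P]_(w in B) (S t f (X s w))%:E)%E] }.

(* +oo if the origin is never empty. *)
Definition tau0 (w : T) : \bar R :=
  ereal_inf [set t%:E | t in [set t : R | 0 <= t /\ X t w origin = false]].

End Process.
End Dynamics.

(* Main.v *)
From HB Require Import structures.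
Require Import Defs.
From mathcomp Require Import all_boot all_order all_algebra.
From mathcomp Require Import all_classical all_reals all_analysis.
From mathcomp Require Import measurable_realfun.
From mathcomp Require Import ring lra zify.
Import Order.TTheory GRing.Theory Num.Theory.
Import numFieldNormedType.Exports.

Set Implicit Arguments.
Unset Strict Implicit.
Unset Printing Implicit Defensive.

Local Open Scope classical_set_scope.
Local Open Scope ring_scope.

(* Relaxation time. Almost surely there are boxes of every size in which all thresholds are 2.
   In such a box of side of order 1/q centred at z, test with the indicator f that z lies in a
   set of occupied sites each of which has at most one neighbour of the box outside the set.
   No legal flip in the interior changes f, and a flip at a boundary site changes f only if each
   of the order 1/q disjoint double strips separating it from z contains an empty site, which
   has probability exp (- C / q).

   Hitting time, lower bound. The origin is emptied at rate at most q.

   Hitting time, upper bound. A Lipschitz percolation argument gives, for bricks of a large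
   fixed size, an infinite path of good bricks from the origin along which an empty brick can
   be moved by legal flips. For the chain in a finite box killed when the origin is empty,
   reversibility yields a time j <= N at which the survival probability f has small Dirichlet
   form. Moving an empty brick to the origin, where f vanishes, bounds f by a polynomial in 1/q
   times its energy unless the first q^(- b - 1) bricks are all non-empty. The chain approximates
   the process because influence propagates at finite speed. *)

(** * Averages of cylinder functions *)

Section Mean.
Context {R : realType}.
Implicit Types (q : R) (f g : config -> R) (eta xi : config) (x y : site).
Implicit Types (s t : seq site).

(** Only functions of finitely many sites are averaged, by finite iterated sums; [integral_cylinder]
    turns these sums into integrals. The process is given through a Feller semigroup [S], so
    survival of the origin is read on a time grid, where S_h g_j <= g_(j+1) + h e for the survival
    functions g_j of the killed chain is all that the Markov property asks for. The g_j depend on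
    the step h themselves, which forces the short-time expansion of [S] to be uniform over all
    bounded functions on a box. Energy is small at some time because self-adjointness gives
    E[f_i f_j] = E[f_(i+j)], so the energies telescope. The exponent 8b+7 is a budget: an energy
    q^(8b+7) makes a legal flip cost about q^(4b+3); forcing the current blocks empty costs q^(-2b),
    and walking between about q^(-b-1) blocks from each of them costs q^(-2b-2), which leaves a
    factor q. The percolation estimate is a Peierls sum: a path that prevents a surface descends
    through a bad brick in at least a third of its steps, and bad bricks are rare when bricks are
    large. *)

Definition depends_on (V : Type) s (f : config -> V) : Prop :=
  forall eta xi, (forall x, x \in s -> eta x = xi x) -> f eta = f xi.

(** Sites of [s] are averaged out one by one and the others keep their value in the argument: this
    is the conditional expectation given the sites outside [s]. A repeated site changes nothing, as
    [site_mean] is idempotent and commutes. *)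
Definition mean q s f : config -> R := foldr (site_mean q) f s.

Lemma update_id eta x : update eta x (eta x) = eta.
Proof. by apply/funext => y; rewrite /update; case: eqP => [->|]. Qed.

Lemma update_update eta x a b : update (update eta x a) x b = update eta x b.
Proof. by apply/funext => y; rewrite /update; case: eqP. Qed.

Lemma updateC eta x y a b : x != y ->
  update (update eta x a) y b = update (update eta y b) x a.
Proof.
move=> xy; apply/funext => z; rewrite /update.
by case: (eqVneq z y) => [->|//]; rewrite eq_sym (negbTE xy).
Qed.

Lemma depends_on_sub (V : Type) s t (f : config -> V) :
  {subset s <= t} -> depends_on s f -> depends_on t f.
Proof. by move=> st sf eta xi e; apply: sf => x /st/e. Qed.

Lemma depends_on_update (V : Type) s (f : config -> V) x b eta :
  depends_on s f -> x \notin s -> f (update eta x b) = f eta.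
Proof.
by move=> sf xs; apply: sf => y ys; rewrite /update; case: eqP xs => // <-; rewrite ys.
Qed.

Lemma site_mean_indep q x f :
  (forall eta b, f (update eta x b) = f eta) -> site_mean q x f = f.
Proof. by move=> fx; apply/funext => eta; rewrite /site_mean !fx; ring. Qed.

Lemma site_mean_update q x f eta b :
  site_mean q x f (update eta x b) = site_mean q x f eta.
Proof. by rewrite /site_mean !update_update. Qed.

Lemma site_mean_id q x f : site_mean q x (site_mean q x f) = site_mean q x f.
Proof. by apply: site_mean_indep => eta b; rewrite site_mean_update. Qed.

Lemma site_meanC q x y f :
  site_mean q x (site_mean q y f) = site_mean q y (site_mean q x f).
Proof.
have [->//|xy] := eqVneq x y.
by apply/funext => eta; rewrite /site_mean !(updateC _ _ _ xy); ring.
Qed.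

Lemma site_meanD q x f g : site_mean q x (fun eta => f eta + g eta) =
  (fun eta => site_mean q x f eta + site_mean q x g eta).
Proof. by apply/funext => eta; rewrite /site_mean; ring. Qed.

Lemma site_meanM_indep q x f g : (forall eta b, g (update eta x b) = g eta) ->
  site_mean q x (fun eta => f eta * g eta) = (fun eta => site_mean q x f eta * g eta).
Proof. by move=> gx; apply/funext => eta; rewrite /site_mean !gx; ring. Qed.

Lemma site_mean_le q x f g : 0 <= q <= 1 -> (forall eta, f eta <= g eta) ->
  forall eta, site_mean q x f eta <= site_mean q x g eta.
Proof.
move=> /andP[q0 q1] fg eta; apply: lerD; apply: ler_wpM2l => //.
by rewrite subr_ge0.
Qed.

Lemma site_meanE q x f eta : site_mean q x f eta - f eta =
  (if eta x then - q else 1 - q) * (f (update eta x true) - f (update eta x false)).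
Proof.
rewrite /site_mean; case ex: (eta x); rewrite -[f eta](congr1 f (update_id eta x)) ex; ring.
Qed.

Lemma site_varE q x f eta : site_var q x f eta =
  q * (1 - q) * (f (update eta x true) - f (update eta x false)) ^+ 2.
Proof.
rewrite /site_var {1}/site_mean !site_mean_update /site_mean; ring.
Qed.

Lemma depends_on_site_mean q x s f : depends_on s f ->
  depends_on [seq y <- s | y != x] (site_mean q x f).
Proof.
move=> sf eta xi e; rewrite /site_mean.
by congr (_ * _ + _ * _); apply: sf => y ys; rewrite /update; case: eqVneq => // yx;
   apply: e; rewrite mem_filter yx.
Qed.

Lemma mean_cons q x s f : mean q (x :: s) f = site_mean q x (mean q s f).
Proof. by []. Qed.

Lemma mean_cat q s t f : mean q (s ++ t) f = mean q s (mean q t f).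
Proof. by rewrite /mean foldr_cat. Qed.

Lemma mean_site_mean q x s f :
  mean q s (site_mean q x f) = site_mean q x (mean q s f).
Proof. by elim: s => //= y s ->; rewrite site_meanC. Qed.

Lemma mean_update q s f x b eta : x \notin s ->
  mean q s f (update eta x b) = mean q s (fun xi => f (update xi x b)) eta.
Proof.
elim: s eta => // y s IH eta; rewrite inE negb_or => /andP[xy xs].
by rewrite !mean_cons /site_mean !(updateC _ _ _ xy) !IH.
Qed.

Lemma mean_absorb q x s f : x \in s -> mean q s (site_mean q x f) = mean q s f.
Proof.
elim: s => // y s IH; rewrite inE /= => /orP[/eqP <-|xs].
  by rewrite mean_site_mean site_mean_id.
by rewrite IH.
Qed.

Lemma mean_absorbs q s t f : {subset s <= t} -> mean q t (mean q s f) = mean q t f.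
Proof.
elim: s => // x s IH sub; rewrite mean_cons mean_absorb; last by apply: sub; rewrite mem_head.
by apply: IH => y ys; apply: sub; rewrite inE ys orbT.
Qed.

Lemma depends_on_mean q s t f : depends_on t f ->
  depends_on [seq y <- t | y \notin s] (mean q s f).
Proof.
move=> tf; elim: s => [|x s IH]; first by rewrite filter_predT.
rewrite mean_cons; have h := @depends_on_site_mean q x _ _ IH; apply: (depends_on_sub _ h) => y.
by rewrite !mem_filter inE negb_or andbA.
Qed.

Lemma mean_const q s f  : depends_on s f -> forall eta xi, mean q s f eta = mean q s f xi.
Proof.
move=> sf eta xi; apply: (@depends_on_mean q s _ _ sf) => x.
by rewrite mem_filter; case: (x \in s).
Qed.

Lemma mean_cst q s (c : R) : mean q s (fun=> c) = (fun=> c).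
Proof. by elim: s => //= x s ->; rewrite site_mean_indep. Qed.

Lemma mean_super q s t f : depends_on s f -> {subset s <= t} -> mean q t f = mean q s f.
Proof.
move=> sf st; rewrite -(mean_absorbs q f st); apply/funext => eta.
rewrite (_ : mean q s f = fun=> mean q s f eta) ?mean_cst//.
by apply/funext => xi; apply: mean_const.
Qed.

Lemma meanD q s f g : mean q s (fun eta => f eta + g eta) =
  (fun eta => mean q s f eta + mean q s g eta).
Proof. by elim: s => //= x s ->; rewrite site_meanD. Qed.

Lemma meanM_indep q s t f g : depends_on t g -> (forall x, x \in s -> x \notin t) ->
  mean q s (fun eta => f eta * g eta) = (fun eta => mean q s f eta * g eta).
Proof.
move=> tg; elim: s => //= x s IH st; rewrite IH; last first.
  by move=> y ys; apply: st; rewrite inE ys orbT.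
apply: site_meanM_indep => eta b; apply: (depends_on_update _ _ tg).
by apply: st; rewrite mem_head.
Qed.

Lemma meanZ q s (c : R) f : mean q s (fun eta => c * f eta) = (fun eta => c * mean q s f eta).
Proof.
rewrite (_ : (fun eta => c * f eta) = (fun eta => f eta * c)).
  rewrite (@meanM_indep _ _ [::]) //; by apply/funext => eta; rewrite mulrC.
by apply/funext => eta; rewrite mulrC.
Qed.

Lemma meanB q s f g : mean q s (fun eta => f eta - g eta) =
  (fun eta => mean q s f eta - mean q s g eta).
Proof.
rewrite (_ : (fun eta => f eta - g eta) = (fun eta => f eta + -1 * g eta)).
  by rewrite meanD meanZ; apply/funext => eta; rewrite mulN1r.
by apply/funext => eta; rewrite mulN1r.
Qed.

Lemma mean_sum (I : Type) (r : seq I) (P : pred I) q s (F : I -> config -> R) :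
  mean q s (fun eta => \sum_(i <- r | P i) F i eta) =
  (fun eta => \sum_(i <- r | P i) mean q s (F i) eta).
Proof.
elim: r => [|i r IH].
  rewrite (_ : (fun eta => _) = (fun=> 0)); first rewrite mean_cst.
    by apply/funext => eta; rewrite big_nil.
  by apply/funext => eta; rewrite big_nil.
transitivity (mean q s (fun eta => (if P i then F i eta else 0) +
    \sum_(j <- r | P j) F j eta)).
  by congr mean; apply/funext => eta; rewrite big_cons; case: ifP; rewrite ?add0r.
rewrite meanD IH; apply/funext => eta; rewrite big_cons.
by case: (P i); rewrite ?mean_cst ?add0r.
Qed.

Lemma mean_le q s f g : 0 <= q <= 1 -> (forall eta, f eta <= g eta) ->
  forall eta, mean q s f eta <= mean q s g eta.
Proof. by move=> q01 fg; elim: s => //= x s IH; apply: site_mean_le. Qed.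

Lemma mean_ge0 q s f : 0 <= q <= 1 -> (forall eta, 0 <= f eta) ->
  forall eta, 0 <= mean q s f eta.
Proof.
by move=> q01 f0 eta; rewrite -[0](congr1 (@^~ eta) (mean_cst q s 0)); exact: mean_le.
Qed.

Lemma mean_prod q s t f g : depends_on s f -> depends_on t g ->
  (forall x, x \in s -> x \notin t) ->
  mean q (s ++ t) (fun eta => f eta * g eta) =
  (fun eta => mean q s f eta * mean q t g eta).
Proof.
move=> sf tg st; apply/funext => eta; rewrite mean_cat.
rewrite (_ : (fun eta => f eta * g eta) = (fun eta => g eta * f eta)); last first.
  by apply/funext => xi; rewrite mulrC.
rewrite (meanM_indep _ _ sf); last by move=> x xt; apply/negP => /st; rewrite xt.
rewrite (_ : (fun xi => _) = (fun xi => mean q t g eta * f xi)).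
  by rewrite meanZ mulrC.
by apply/funext => xi; rewrite (mean_const q tg xi eta).
Qed.

(** The average over [x] contains the empty value with weight [q], so forcing [x] to be empty costs
    a factor at most 1/q. *)
Lemma mean_update_false_le q s x f : 0 < q <= 1 -> (forall eta, 0 <= f eta) -> x \in s ->
  forall eta, mean q s (fun xi => f (update xi x false)) eta <= q^-1 * mean q s f eta.
Proof.
move=> /andP[q0 q1] f0 xs eta; rewrite -(mean_absorb q f xs).
rewrite -[leRHS](congr1 (@^~ eta) (meanZ _ _ _ _)).
apply: mean_le; first by rewrite ltW.
move=> xi; rewrite /site_mean mulrDr mulKf ?gt_eqF// lerDl.
by rewrite !mulr_ge0// ?invr_ge0 ?subr_ge0// ltW.
Qed.

Definition empty_on s eta : config := fun x => if x \in s then false else eta x.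

Lemma empty_on_cons x s eta : empty_on (x :: s) eta = update (empty_on s eta) x false.
Proof. by apply/funext => y; rewrite /empty_on /update inE; case: eqP. Qed.

Lemma mean_empty_on_le q s t f : 0 < q <= 1 -> (forall eta, 0 <= f eta) ->
  {subset t <= s} ->
  forall eta, mean q s (fun xi => f (empty_on t xi)) eta <= q^-1 ^+ size t * mean q s f eta.
Proof.
move=> q01; elim: t f => [|x t IH] f f0 ts eta; first by rewrite expr0 mul1r.
rewrite (_ : (fun xi => _) = (fun xi => f (update (empty_on t xi) x false))); last first.
  by apply/funext => xi; rewrite empty_on_cons.
apply: (le_trans (IH (fun xi => f (update xi x false)) _ _ eta)) => //.
  by move=> y yt; apply: ts; rewrite inE yt orbT.
rewrite /= exprSr -mulrA ler_wpM2l//.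
  by rewrite exprn_ge0// invr_ge0; case/andP: q01 => /ltW.
by apply: mean_update_false_le => //; apply: ts; rewrite mem_head.
Qed.

End Mean.

(** * Integrals of cylinder functions against the product measure *)

Section Cylinder.
Context {R : realType}.
Implicit Types (q : R) (f : config -> R) (eta xi sigma : config) (x : site).
Implicit Types (s t : seq site) (mu : probability config R).

Definition cylinder t sigma : set config :=
  [set eta | forall x, x \in t -> eta x = sigma x].

Lemma measurable_coordinate x b : measurable ([set eta | eta x = b] : set config).
Proof.
have mt : measurable ([set eta | eta x = true] : set config).
  by apply: sub_sigma_algebra; exists x.
case: b => //.
rewrite (_ : [set _ | _] = ~` [set eta | eta x = true]); first exact: measurableC.
by apply/seteqP; split => eta /=; case: (eta x).
Qed.

Lemma depends_on_slice (V : Type) x s (f : config -> V) b : depends_on (x :: s) f ->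
  depends_on s (fun eta => f (update eta x b)).
Proof.
move=> sf eta xi e; apply: sf => y; rewrite inE /update.
by case: eqP => //= _; apply: e.
Qed.

Lemma measurable_depends_on s (A : set config) : depends_on s A -> measurable A.
Proof.
elim: s A => [|x s IH] A sA.
  have [[eta Aeta]|nA] := pselect (exists eta, A eta).
    rewrite (_ : A = setT) //; apply/seteqP; split => // xi _.
    by rewrite (sA xi eta).
  rewrite (_ : A = set0) //; apply/seteqP; split => // xi Axi.
  by apply: nA; exists xi.
have -> : A = ([set eta | eta x = true] `&` [set eta | A (update eta x true)]) `|`
              ([set eta | eta x = false] `&` [set eta | A (update eta x false)]).
  apply/seteqP; split => eta /=.
    by move=> Ae; case ex: (eta x); [left|right]; rewrite -ex update_id.
  by case=> -[<-]; rewrite update_id.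
by apply: measurableU; apply: measurableI; try exact: measurable_coordinate;
   apply: IH; apply: (depends_on_slice _ sA).
Qed.

Lemma measurable_cylinder t sigma : measurable (cylinder t sigma).
Proof.
apply: (@measurable_depends_on t) => eta xi e; apply/propext.
by split=> h x xt; [rewrite -e //|rewrite e //]; apply: h.
Qed.

Lemma measurable_fun_depends_on d (V : measurableType d) s (f : config -> V) :
  depends_on s f -> measurable_fun setT f.
Proof.
move=> sf _ Y mY; rewrite setTI; apply: (@measurable_depends_on s) => eta xi e.
by rewrite /preimage /= (sf _ _ e).
Qed.

Lemma depends_on_bounded s f : depends_on s f -> exists M, forall eta, `|f eta| <= M.
Proof.
elim: s f => [|x s IH] f sf.
  by exists `|f (fun=> true)| => eta; rewrite (sf eta (fun=> true)).
have [M1 h1] := IH _ (depends_on_slice true sf).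
have [M2 h2] := IH _ (depends_on_slice false sf).
exists (Num.max M1 M2) => eta; rewrite le_max -(update_id eta x).
by case: (eta x); rewrite ?h1 ?h2 ?orbT.
Qed.

Lemma integrable_depends_on mu s f (D : set config) : measurable D -> depends_on s f ->
  mu.-integrable D (EFin \o f).
Proof.
move=> mD sf; apply: measurable_bounded_integrable => //.
- exact: le_lt_trans (probability_le1 _ mD) (ltry _).
- by apply: measurable_funTS; exact: measurable_fun_depends_on sf.
- have [M hM] := depends_on_bounded sf.
  by exists M; split; [exact: num_real|move=> y My eta _; exact: le_trans (hM eta) (ltW My)].
Qed.

(** Induction on [s]: each step moves a site from the averaged list [s] to the list [t] of
    prescribed values. Once [s] is exhausted [f] is constant, and the cylinder formula of
    [bernoulli_product] concludes. *)
Lemma integral_cylinder q mu (t s : seq site) f sigma :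
  bernoulli_product (1 - q) mu -> depends_on s f -> uniq (t ++ s) ->
  (\int[mu]_(eta in cylinder t sigma) (f eta)%:E =
   (mean q s f sigma * \prod_(x <- t) (if sigma x then 1 - q else q))%:E)%E.
Proof.
move=> hmu; elim: s t f sigma => [|x s IH] t f sigma sf.
  rewrite cats0 => ut.
  rewrite (_ : (fun eta => (f eta)%:E) = cst (f sigma)%:E); last first.
    by apply/funext => eta /=; rewrite (sf eta sigma).
  rewrite integral_cst; last exact: measurable_cylinder.
  rewrite [X in (_ * X)%E = _](hmu t sigma ut) -EFinM; congr (_ * _)%:E.
  by apply: eq_bigr => x _; case: (sigma x) => //; ring.
move=> uts.
have [xt xs] : x \notin t /\ x \notin s.
  move: uts; rewrite cat_uniq /= negb_or => /and3P[_ /andP[? _] /andP[? _]].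
  by split.
have ub : uniq ((x :: t) ++ s).
  by move: uts; rewrite /= !cat_uniq /= negb_or mem_cat negb_or xt xs => /and3P[-> /andP[_ ->] /= ->].
pose C b := cylinder (x :: t) (update sigma x b).
have Csig : cylinder t sigma = C true `|` C false.
  apply/seteqP; split => eta /=.
    move=> h; case ex: (eta x); [left|right] => y; rewrite inE /update;
    by case: eqP => [->|_] //= yt; apply: h.
  move=> H y yt; have yx : (y == x) = false by apply: contraNF xt => /eqP <-.
  by case: H => /(_ y); rewrite inE yt orbT /update yx; apply.
have CE b : (\int[mu]_(eta in C b) (f eta)%:E =
    (mean q s (fun eta => f (update eta x b)) sigma *
     ((if b then 1 - q else q) * \prod_(y <- t) (if sigma y then 1 - q else q)))%:E)%E.
  transitivity (\int[mu]_(eta in C b) (f (update eta x b))%:E)%E.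
    apply: eq_integral => eta; rewrite inE => /(_ x (mem_head _ _)).
    by rewrite /update eqxx => ex; rewrite -{1}(update_id eta x) ex.
  rewrite (IH _ _ _ (depends_on_slice b sf) ub).
  congr (_ * _)%:E.
    exact: (mean_const q (depends_on_slice b sf)).
  rewrite big_cons /update eqxx; congr (_ * _); apply: eq_big_seq => y yt.
  by case: eqP xt => // <-; rewrite yt.
rewrite Csig integral_setU_EFin //; [|exact: measurable_cylinder..| |].
- rewrite [LHS](congr2 (fun a b => a + b)%E (CE true) (CE false)) -EFinD; congr EFin.
  rewrite mean_cons /site_mean.
  rewrite !(mean_update _ _ _ _ xs) !mulrA; ring.
- have mf : measurable_fun setT f by exact: measurable_fun_depends_on sf.
  by apply: measurable_funTS; have := (measurable_EFinP setT f).2 mf.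
- apply/disj_setPS => eta [] /(_ x (mem_head _ _)) + /(_ x (mem_head _ _)).
  by rewrite /update eqxx => ->.
Qed.

Lemma integral_depends_on q mu s f eta : bernoulli_product (1 - q) mu -> depends_on s f ->
  uniq s -> (\int[mu]_xi (f xi)%:E = (mean q s f eta)%:E)%E.
Proof.
move=> hmu sf us; have := integral_cylinder (t := [::]) eta hmu sf us.
rewrite big_nil mulr1 => <-; congr (integral _ _ _).
by apply/seteqP.
Qed.

Lemma prob_depends_on q mu s (A : config -> bool) eta : bernoulli_product (1 - q) mu ->
  depends_on s A -> uniq s -> mu [set xi | A xi] = (mean q s (fun xi => (A xi)%:R) eta)%:E.
Proof.
move=> hmu sA us; rewrite -(integral_depends_on eta hmu _ us); last first.
  by move=> xi xi' e; rewrite (sA _ _ e).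
have mA : measurable ([set xi | A xi] : set config).
  by apply: (@measurable_depends_on s) => xi xi' e; rewrite /= (sA _ _ e).
rewrite -[LHS]mul1e -[LHS]integral_cst // integral_mkcond.
apply: eq_integral => xi _; rewrite patchE.
by case: (boolP (A xi)) => Ax; [rewrite mem_set|rewrite memNset //; apply/negP].
Qed.

End Cylinder.

(** * Expectations over finite sets of sites, and discrete gradients *)

Definition expect (R : realType) (q : R) (s : seq site) (f : config -> R) : R :=
  mean q s f (fun=> true).

Definition grad (R : realType) (x : site) (f : config -> R) (eta : config) : R :=
  f (update eta x true) - f (update eta x false).

Section Expect.
Context {R : realType}.
Implicit Types (q : R) (f g : config -> R) (s : seq site).

Lemma expectD q s f g :
  expect q s (fun eta => f eta + g eta) = expect q s f + expect q s g.
Proof. by rewrite /expect meanD. Qed.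

Lemma expectB q s f g :
  expect q s (fun eta => f eta - g eta) = expect q s f - expect q s g.
Proof. by rewrite /expect meanB. Qed.

Lemma expectZ q s (c : R) f : expect q s (fun eta => c * f eta) = c * expect q s f.
Proof. by rewrite /expect meanZ. Qed.

Lemma expect_cst q s (c : R) : expect q s (fun=> c) = c.
Proof. by rewrite /expect mean_cst. Qed.

Lemma expect_sum (I : Type) (r : seq I) (P : pred I) q s (F : I -> config -> R) :
  expect q s (fun eta => \sum_(i <- r | P i) F i eta) =
  \sum_(i <- r | P i) expect q s (F i).
Proof. by rewrite /expect mean_sum. Qed.

Lemma expect_le q s f g : 0 <= q <= 1 -> (forall eta, f eta <= g eta) ->
  expect q s f <= expect q s g.
Proof. by move=> q01 fg; apply: mean_le. Qed.

Lemma expect_ge0 q s f : 0 <= q <= 1 -> (forall eta, 0 <= f eta) -> 0 <= expect q s f.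
Proof. by move=> q01 f0; apply: mean_ge0. Qed.

Lemma expect_site_mean q s x f : x \in s -> expect q s (site_mean q x f) = expect q s f.
Proof. by move=> xs; rewrite /expect mean_absorb. Qed.

End Expect.

(** * A finite reversible chain killed when the origin is empty *)

Section KilledChain.
Context {R : realType}.
(** Updates take place in [I], while averages run over [Lam], which contains the sites seen by the
    constraints in [I]. The bound [dI] makes identity plus [d] times the generator a Markov
    kernel. *)
Variables (q : R) (Lam I : seq site) (c : site -> config -> bool) (d : R).
Hypothesis q01 : 0 <= q <= 1.
Hypothesis I_Lam : {subset I <= Lam}.
Hypothesis o_Lam : origin \in Lam.
Hypothesis c_Lam : forall x, x \in I -> depends_on Lam (c x).
Hypothesis c_self : forall x eta b, c x (update eta x b) = c x eta.
Hypothesis d0 : 0 <= d.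
Hypothesis dI : d * (size I)%:R <= 1.

Implicit Types (f g : config -> R) (eta : config).

Definition finite_generator f eta : R :=
  \sum_(x <- I) (c x eta)%:R * (site_mean q x f eta - f eta).

Definition finite_dirichlet f : R :=
  \sum_(x <- I) expect q Lam (fun eta => (c x eta)%:R * site_var q x f eta).

Definition killed_step f eta : R :=
  if eta origin then f eta + d * finite_generator f eta else 0.

(* Probability that the chain with time step [d] keeps the origin occupied for j steps. *)
Definition survival j : config -> R :=
  iter j killed_step (fun eta => (eta origin)%:R).

(** Average over [x] first: the constraint at [x] does not see the value at [x]. The right-hand side
    is symmetric in [f] and [g], which is reversibility. *)
Lemma expect_generator_site x f g : x \in I ->
  expect q Lam (fun eta => f eta * ((c x eta)%:R * (site_mean q x g eta - g eta))) =
  - (q * (1 - q)) * expect q Lam (fun eta => (c x eta)%:R * (grad x f eta * grad x g eta)).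
Proof.
move=> xI; rewrite -(expect_site_mean _ _ (I_Lam xI)) -expectZ; congr expect.
apply/funext => eta; rewrite /site_mean !c_self !update_update /grad; ring.
Qed.

Lemma expect_generator f g :
  expect q Lam (fun eta => f eta * finite_generator g eta) =
  - (q * (1 - q)) * \sum_(x <- I)
     expect q Lam (fun eta => (c x eta)%:R * (grad x f eta * grad x g eta)).
Proof.
rewrite mulr_sumr -(eq_big_seq _ (fun x xI => expect_generator_site f g xI)) -expect_sum.
by congr expect; apply/funext => eta; rewrite mulr_sumr.
Qed.

Lemma expect_generatorC f g :
  expect q Lam (fun eta => f eta * finite_generator g eta) =
  expect q Lam (fun eta => g eta * finite_generator f eta).
Proof.
rewrite !expect_generator; congr (_ * _); apply: eq_bigr => x _; congr expect.
by apply/funext => eta; rewrite [grad x f eta * _]mulrC.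
Qed.

Lemma expect_generator_self f :
  expect q Lam (fun eta => f eta * finite_generator f eta) = - finite_dirichlet f.
Proof.
rewrite expect_generator mulNr mulr_sumr; congr (- _); apply: eq_bigr => x _.
rewrite -expectZ; congr expect; apply/funext => eta.
rewrite site_varE /grad; ring.
Qed.

(** By [rate_bound] this is a combination of values of [f] with nonnegative coefficients, hence the
    killed step is monotone. *)
Lemma killed_stepE f eta : killed_step f eta = (eta origin)%:R *
  ((1 - d * \sum_(x <- I) (c x eta)%:R) * f eta
   + d * \sum_(x <- I) (c x eta)%:R * site_mean q x f eta).
Proof.
rewrite /killed_step /finite_generator; case: (eta origin); last by rewrite mul0r.
under eq_bigr do rewrite mulrBr.
rewrite sumrB -mulr_suml. rewrite mul1r; ring.
Qed.

Lemma rate_bound eta : 0 <= 1 - d * \sum_(x <- I) (c x eta)%:R.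
Proof.
rewrite subr_ge0; apply: le_trans dI; rewrite ler_wpM2l//.
rewrite -sum1_size natr_sum; apply: ler_sum => x _.
by case: (c x eta).
Qed.

Lemma killed_step_le f g : (forall eta, f eta <= g eta) ->
  forall eta, killed_step f eta <= killed_step g eta.
Proof.
move=> fg eta; rewrite !killed_stepE ler_wpM2l// lerD//.
  by rewrite ler_wpM2l// rate_bound.
rewrite ler_wpM2l//; apply: ler_sum => x _; rewrite ler_wpM2l//.
exact: site_mean_le.
Qed.

Lemma survival0E j eta : eta origin = false -> survival j eta = 0.
Proof. by case: j => [|j] /= e; rewrite /killed_step e. Qed.

Lemma survival_ge0 j eta : 0 <= survival j eta.
Proof.
elim: j eta => [|j IH] eta; first by rewrite ler0n.
apply: le_trans (killed_step_le IH eta); rewrite killed_stepE mulr0 add0r.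
rewrite big1 ?mulr0// => x _; rewrite site_mean_indep ?mulr0//.
Qed.

Lemma survivalS_le j eta : survival j.+1 eta <= survival j eta.
Proof.
elim: j eta => [|j IH] eta; last exact: killed_step_le.
rewrite /= /killed_step; case e: (eta origin); last by rewrite ler0n.
rewrite gerDl mulr_ge0_le0//; apply: sumr_le0 => x _.
rewrite mulr_ge0_le0// subr_le0 e.
rewrite -[leRHS](congr1 (@^~ eta) (mean_cst q [:: x] 1)).
by apply: site_mean_le => // xi; case: (xi origin).
Qed.

Lemma survival_le i j eta : (i <= j)%N -> survival j eta <= survival i eta.
Proof.
move=> /subnK <-; elim: (j - i)%N => // k; rewrite addSn; exact: le_trans (survivalS_le _ _).
Qed.

Lemma survival_le1 j eta : survival j eta <= 1.
Proof. by apply: le_trans (survival_le _ (leq0n j)) _; rewrite /=; case: (eta _). Qed.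

Lemma depends_on_survival j : depends_on Lam (survival j).
Proof.
elim: j => [|j IH] eta xi e; first by rewrite /= e.
rewrite /= /killed_step e//; case: ifP => // _; congr (_ + _ * _); first exact: IH.
apply: eq_big_seq => x xI; rewrite (c_Lam xI e); congr (_ * (_ - _)); last exact: IH.
by apply: (depends_on_site_mean q (x := x) IH) => y; rewrite mem_filter => /andP[_]; exact: e.
Qed.

(** The killed step is self-adjoint on functions vanishing when the origin is empty, so steps can be
    moved from one factor to the other. At the end the factor [survival 0] is 1 wherever the other
    factor is nonzero. *)
Lemma expect_survivalM i j :
  expect q Lam (fun eta => survival i eta * survival j eta) = expect q Lam (survival (i + j)).
Proof.
have killM k f : (fun eta => survival k eta * killed_step f eta) =
    (fun eta => survival k eta * f eta + d * (survival k eta * finite_generator f eta)).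
  apply/funext => eta; rewrite /killed_step; case: ifP => [_|e]; first ring.
  by rewrite (survival0E _ e) !mul0r mulr0 addr0.
elim: i j => [|i IH] j.
  congr expect; apply/funext => eta; rewrite /=.
  case e: (eta origin); first by rewrite mul1r.
  by rewrite mul0r survival0E.
rewrite addSnnS -IH.
transitivity (expect q Lam (fun eta => survival j eta * killed_step (survival i) eta)).
  by congr expect; apply/funext => eta; rewrite mulrC.
rewrite [in RHS]/= !killM !expectD !expectZ expect_generatorC.
by congr (_ + _); congr expect; apply/funext => eta; rewrite mulrC.
Qed.

Lemma survival_dirichlet j : d * finite_dirichlet (survival j) =
  expect q Lam (survival (j + j)) - expect q Lam (survival (j + j).+1).
Proof.
rewrite -addnS -!expect_survivalM.
rewrite -expectB -[finite_dirichlet _]opprK -expect_generator_self mulrN -mulNr -expectZ.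
congr expect; apply/funext => eta; rewrite /= /killed_step.
case: ifP => [_|e]; first ring.
by rewrite (survival0E _ e) !mul0r mulr0 subr0.
Qed.

(** By [survival_dirichlet] the energies are the decrements of E[survival] at even times;
    monotonicity covers the odd ones. Hence the N+1 energies, multiplied by [d], sum to at most 1
    and the smallest one is at most the average. *)
Lemma survival_low_energy N :
  exists2 j, (j <= N)%N & d * N.+1%:R * finite_dirichlet (survival j) <= 1.
Proof.
apply: contrapT => h.
have {}h j : (j <= N)%N -> 1 < d * N.+1%:R * finite_dirichlet (survival j).
  by move=> jN; rewrite ltNge; apply/negP => hj; apply: h; exists j.
have tele : \sum_(j < N.+1) d * finite_dirichlet (survival j) <= 1.
  have : \sum_(j < N.+1) d * finite_dirichlet (survival j) <=
      1 - expect q Lam (survival (N.+1 + N.+1)).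
    elim: N.+1 => [|n IH].
      by rewrite big_ord0 subr_ge0 -[leRHS](expect_cst q Lam 1) expect_le//; exact: survival_le1.
    rewrite big_ord_recr /= (survival_dirichlet n); move: IH.
    have : expect q Lam (survival (n.+1 + n.+1)) <= expect q Lam (survival (n + n).+1).
      by rewrite expect_le// => eta; apply: survival_le; rewrite addSn addnS ltnS leqnSn.
    lra.
  move/le_trans; apply; rewrite gerBl; apply: expect_ge0 => //; exact: survival_ge0.
have : \sum_(j < N.+1) (N.+1%:R : R)^-1 < \sum_(j < N.+1) d * finite_dirichlet (survival j).
  apply: ltr_sum; first by apply/hasP; exists ord0 => //; rewrite mem_index_enum.
  move=> j _; have := h j (ltn_ord j).
  rewrite mulrAC -ltr_pdivrMr ?ltr0n// div1r //.
by rewrite sumr_const card_ord -(mulr_natr (N.+1%:R^-1)) mulVf ?pnatr_eq0// ltNge tele.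
Qed.

Section Propagation.
Variable w : site -> R.
Hypothesis I_uniq : uniq I.
Hypothesis w_origin : 1 <= w origin.
Hypothesis w0 : forall x, 0 <= w x.
Hypothesis w_neighbor : forall x y, x \in neighbors y -> w x <= 2 * w y.
Hypothesis c_range : forall x y eta b,
  y != x -> x \notin neighbors y -> c x (update eta y b) = c x eta.

(** Finite speed of propagation: measured against [w], the influence of a site grows by a factor at
    most 1 + 8d per step. Resampling only averages the influence; new influence comes through the
    constraints of the four neighbours of [y], each of weight at most 2 [w y], whence 8. *)
Lemma grad_killed_step C f y : 0 <= C -> y != origin ->
  (forall x eta, `|grad x f eta| <= C * w x) ->
  forall eta, `|grad y (killed_step f) eta| <= C * (1 + 8 * d) * w y.
Proof.
move=> C0 yo fC eta.
pose eta1 := update eta y true; pose eta0 := update eta y false.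
(* [h x] is the influence of [y] that remains after resampling [x], zero for x = y; [e x] is the
   effect of [y] through the constraint at [x], zero unless [x] is a neighbour of [y]. *)
pose h x := if x == y then 0 else site_mean q x (grad y f) eta.
pose e x := ((c x eta1)%:R - (c x eta0)%:R) * (site_mean q x f eta0 - f eta0).
have TE x : (c x eta1)%:R * (site_mean q x f eta1 - f eta1) -
    (c x eta0)%:R * (site_mean q x f eta0 - f eta0) =
    (c x eta1)%:R * (h x - grad y f eta) + e x.
  rewrite /e /h /grad /eta1 /eta0; case: eqVneq => [->|xy].
    rewrite !c_self /site_mean !update_update; ring.
  rewrite /site_mean !(updateC _ _ _ xy); ring.
have hB x : `|h x| <= C * w y.
  rewrite /h; case: eqP => _; first by rewrite normr0 mulr_ge0.
  have [q0 q1] : 0 <= q /\ 0 <= 1 - q by case/andP: q01; rewrite subr_ge0.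
  rewrite /site_mean; apply: le_trans (ler_normD _ _) _.
  rewrite !normrM (ger0_norm q0) (ger0_norm q1).
  rewrite (_ : C * w y = q * (C * w y) + (1 - q) * (C * w y)); last ring.
  by rewrite lerD// ler_wpM2l.
have eB x : `|e x| <= (x \in neighbors y)%:R * (2 * C * w y).
  have [->|xy'] := eqVneq x y.
    by rewrite /e /eta1 /eta0 !c_self subrr mul0r normr0 !mulr_ge0.
  have [xy|xy] := boolP (x \in neighbors y); last first.
    by rewrite /e /eta1 /eta0 !c_range 1?eq_sym// subrr mul0r normr0 mul0r.
  rewrite mul1r /e normrM; apply: le_trans (_ : 1 * (C * w x) <= _); last first.
    by rewrite mul1r (mulrC 2) -mulrA ler_wpM2l// w_neighbor.
  apply: ler_pM => //; first by case: (c x eta1); case: (c x eta0); rewrite ?subrr ?subr0 ?sub0r ?normrN ?normr0 ?normr1.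
  rewrite site_meanE normrM; apply: le_trans (fC x eta0); rewrite -[leRHS]mul1r ler_wpM2r//.
  by case/andP: q01 => *; case: ifP => _; rewrite ?normrN ger0_norm ?subr_ge0// gerBl.
have -> : grad y (killed_step f) eta = (eta origin)%:R *
   ((1 - d * \sum_(x <- I) (c x eta1)%:R) * grad y f eta
     + d * \sum_(x <- I) (c x eta1)%:R * h x + d * \sum_(x <- I) e x).
  rewrite /grad /killed_step /finite_generator -/eta1 -/eta0.
  have e1 : eta1 origin = eta origin by rewrite /eta1 /update eq_sym (negbTE yo).
  have e0 : eta0 origin = eta origin by rewrite /eta0 /update eq_sym (negbTE yo).
  rewrite e1 e0; case: (eta origin); last by rewrite mul0r subrr.
  rewrite mul1r; transitivity (grad y f eta + d * \sum_(x <- I)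
      ((c x eta1)%:R * (h x - grad y f eta) + e x)).
    rewrite -(eq_bigr _ (fun x _ => TE x)) sumrB /grad -/eta1 -/eta0; ring.
  rewrite big_split /=; under eq_bigr do rewrite mulrBr.
  rewrite sumrB -mulr_suml; rewrite /grad -/eta1 -/eta0; ring.
rewrite normrM; apply: le_trans (_ : 1 * _ <= _).
  by apply: ler_wpM2r => //; case: (eta origin); rewrite ?normr0 ?normr1.
rewrite mul1r.
set S := \sum_(x <- I) (c x eta1)%:R.
have S1 : `|(1 - d * S) * grad y f eta| <= (1 - d * S) * (C * w y).
  by rewrite normrM (ger0_norm (rate_bound _)) ler_wpM2l// rate_bound.
have S2 : `|d * \sum_(x <- I) (c x eta1)%:R * h x| <= d * (S * (C * w y)).
  rewrite normrM (ger0_norm d0) ler_wpM2l//; apply: le_trans (ler_norm_sum _ _ _) _.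
  rewrite mulr_suml; apply: ler_sum => x _.
  by rewrite normrM normr_nat ler_wpM2l.
have S3 : `|d * \sum_(x <- I) e x| <= d * (4 * (2 * C * w y)).
  rewrite normrM (ger0_norm d0) ler_wpM2l//; apply: le_trans (ler_norm_sum _ _ _) _.
  apply: le_trans (ler_sum _ (fun x _ => eB x)) _.
  rewrite -mulr_suml ler_wpM2r ?mulr_ge0//.
  rewrite -natr_sum ler_nat -big_mkcond sum1_count -size_filter.
  rewrite (_ : 4%N = size (neighbors y))//; apply: uniq_leq_size; first exact: filter_uniq.
  by move=> x; rewrite mem_filter => /andP[].
apply: le_trans (ler_normD _ _) _; apply: le_trans (lerD (ler_normD _ _) S3) _.
apply: le_trans (lerD (lerD S1 S2) (lexx _)) _; lra.
Qed.

(** At the origin the gradient is at most 1 because survival takes values in [0, 1] and vanishes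
    once the origin is empty; [w origin] being at least 1 absorbs this, and elsewhere the one-step
    bound is iterated. *)
Lemma grad_survival j x eta : `|grad x (survival j) eta| <= (1 + 8 * d) ^+ j * w x.
Proof.
have d8 k : 1 <= (1 + 8 * d) ^+ k by apply: exprn_ege1; rewrite lerDl mulr_ge0.
have [->|] := eqVneq x origin.
  rewrite /grad [X in _ - X]survival0E ?subr0 ?ger0_norm ?survival_ge0//.
  by apply: le_trans (survival_le1 _ _) _; rewrite mulr_ege1.
elim: j x eta => [|j IH] x eta xo.
  rewrite /grad /= /update eq_sym (negbTE xo) subrr normr0 mul1r //.
rewrite exprSr; apply: grad_killed_step => //; first exact: le_trans (d8 j).
move=> y xi; have [->|] := eqVneq y origin; last exact: IH.
rewrite /grad [X in _ - X]survival0E ?subr0 ?ger0_norm ?survival_ge0//.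
by apply: le_trans (survival_le1 _ _) _; rewrite mulr_ege1.
Qed.

End Propagation.
End KilledChain.

(** * Moving an empty block to the origin *)

Section Blocks.
Implicit Types (omega eta : config) (B C s : seq site).

(** A legal order of emptying in the sense of bootstrap percolation: each emptied site helps the
    following ones. *)
Fixpoint fills omega B s : bool :=
  if s is x :: s' then
    (threshold omega x <= count (mem B) (neighbors x))%N && fills omega (x :: B) s'
  else true.

(** The list [s] may repeat sites; bounding its length by that of [C] controls both the number of
    flips and the power of 1/q paid below. *)
Definition links omega B C : Prop :=
  exists s, [/\ fills omega B s, (size s <= size C)%N, {subset s <= C} & {subset C <= s ++ B}].

Lemma constraint_empty omega B x eta :
  (threshold omega x <= count (mem B) (neighbors x))%N ->
  (forall y, y \in B -> eta y = false) -> constraint omega x eta.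
Proof.
move=> h hB; apply: leq_trans h _; rewrite -sum1_count big_mkcond; apply: leq_sum => y _.
by case: ifP => //= /hB ->.
Qed.

Lemma empty_on_eqi s t eta : s =i t -> empty_on s eta = empty_on t eta.
Proof. by move=> st; apply/funext => x; rewrite /empty_on st. Qed.

Context {R : realType}.
Implicit Types (q M : R) (f : config -> R).

(** Every emptying in the list is a legal flip, so it costs a constrained gradient, taken at a
    configuration where at most [n] sites have been forced empty. Forcing them costs at most
    q^(-n). *)
Lemma expect_fills_le omega q Lam f B s n M : 0 < q <= 1 -> fills omega B s ->
  {subset B <= Lam} -> {subset s <= Lam} -> (size s + size B <= n)%N -> 0 <= M ->
  (forall x, x \in s ->
     expect q Lam (fun eta => (constraint omega x eta)%:R * `|grad x f eta|) <= M) ->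
  expect q Lam (fun eta => `|f (empty_on (s ++ B) eta) - f (empty_on B eta)|) <=
  (size s)%:R * (q^-1 ^+ n * M).
Proof.
move=> q01; have q01' : 0 <= q <= 1 by case/andP: q01 => /ltW ->.
have qV1 : 1 <= q^-1 by rewrite invf_ge1; case/andP: q01.
elim: s B => [|x s IH] B /=.
  move=> _ _ _ _ _ _; rewrite mul0r (_ : (fun=> _) = (fun=> 0)) ?expect_cst//.
  by apply/funext => eta; rewrite subrr normr0.
move=> /andP[hx hs] BL sL hn M0 hM.
have xL : x \in Lam by apply: sL; rewrite mem_head.
apply: (@le_trans _ _ (expect q Lam (fun eta =>
   `|f (empty_on (s ++ x :: B) eta) - f (empty_on (x :: B) eta)| +
   (constraint omega x (empty_on B eta))%:R * `|grad x f (empty_on B eta)|))).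
  apply: expect_le => // eta.
  rewrite (empty_on_eqi (t := s ++ x :: B)); last first.
    by move=> y; rewrite !(inE, mem_cat) orbCA.
  apply: le_trans (ler_distD (f (empty_on (x :: B) eta)) _ _) _; rewrite lerD2l.
  rewrite (constraint_empty hx) ?mul1r; last by move=> y yB; rewrite /empty_on yB.
  rewrite empty_on_cons; set z := empty_on B eta.
  rewrite -[X in `|_ - f X|](update_id z x); case: (z x); last by rewrite subrr normr0.
  by rewrite distrC.
rewrite expectD -natr1 mulrDl lerD//.
  apply: IH => //; last by move=> y ys; apply: hM; rewrite inE ys orbT.
  - by move=> y; rewrite inE => /predU1P[->|/BL].
  - by move=> y ys; apply: sL; rewrite inE ys orbT.
  - by rewrite /= addnS.
rewrite mul1r.
pose F eta : R := (constraint omega x eta)%:R * `|grad x f eta|.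
apply: le_trans (@mean_empty_on_le _ q Lam B F q01 _ BL (fun=> true)) _.
  by move=> eta; rewrite mulr_ge0.
have qV0 : 0 <= q^-1 by exact: le_trans qV1.
apply: ler_pM.
- exact: exprn_ge0.
- by apply: expect_ge0 => // eta; rewrite mulr_ge0.
- by rewrite ler_weXn2l// (leq_trans _ hn)// leq_addl.
- by apply: hM; rewrite mem_head.
Qed.

(** Both filling orders end in the same configuration, empty on [B] and on [C]; the triangle
    inequality passes through it. *)
Lemma expect_links_le omega q Lam f B C b M : 0 < q <= 1 ->
  links omega B C -> links omega C B ->
  {subset B <= Lam} -> {subset C <= Lam} -> (size B <= b)%N -> (size C <= b)%N -> 0 <= M ->
  (forall x, x \in B ++ C ->
     expect q Lam (fun eta => (constraint omega x eta)%:R * `|grad x f eta|) <= M) ->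
  expect q Lam (fun eta => `|f (empty_on C eta) - f (empty_on B eta)|) <=
  (2 * b)%:R * (q^-1 ^+ (2 * b) * M).
Proof.
move=> q01 [s [s1 s2 s3 s4]] [t [t1 t2 t3 t4]] BL CL Bb Cb M0 hM.
have q01' : 0 <= q <= 1 by case/andP: q01 => /ltW ->.
have K0 : 0 <= q^-1 ^+ (2 * b) * M.
  by rewrite mulr_ge0// exprn_ge0// invr_ge0; case/andP: q01' .
apply: (@le_trans _ _ (expect q Lam (fun eta =>
   `|f (empty_on (s ++ B) eta) - f (empty_on B eta)| +
   `|f (empty_on (t ++ C) eta) - f (empty_on C eta)|))).
  apply: expect_le => // eta; rewrite [leRHS]addrC.
  rewrite (empty_on_eqi (s := s ++ B) (t := t ++ C)).
    by rewrite [X in _ <= X + _]distrC; exact: ler_distD.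
  move=> y; rewrite !mem_cat; apply/idP/idP.
    by case/orP => [/s3 ->|/t4]; rewrite ?orbT// mem_cat.
  by case/orP => [/t3 ->|/s4]; rewrite ?orbT// mem_cat.
rewrite expectD mul2n -addnn natrD mulrDl; apply: lerD.
  apply: le_trans (expect_fills_le q01 s1 BL _ _ M0 _) _.
  - by move=> y /s3/CL.
  - by apply: leq_add Bb; exact: leq_trans s2 Cb.
  - by move=> x /s3 xC; apply: hM; rewrite mem_cat xC orbT.
  by rewrite addnn -mul2n ler_wpM2r// ler_nat (leq_trans s2).
apply: le_trans (expect_fills_le q01 t1 CL _ _ M0 _) _.
- by move=> y /t3/BL.
- by apply: leq_add Cb; exact: leq_trans t2 Bb.
- by move=> x /t3 xB; apply: hM; rewrite mem_cat xB.
by rewrite addnn -mul2n ler_wpM2r// ler_nat (leq_trans t2).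
Qed.

Lemma expect_all_eq q s (b : bool) : uniq s ->
  expect q s (fun eta => (all (fun x => eta x == b) s)%:R) =
  (if b then 1 - q else q) ^+ size s.
Proof.
elim: s => [_|x s IH /= /andP[xs us]]; first by rewrite expect_cst.
rewrite exprS -IH//.
have h : depends_on s (fun eta => (all (fun x => eta x == b) s)%:R : R).
  by move=> eta xi e; congr ((_ : bool)%:R); apply: eq_in_all => y /e ->.
have h1 : depends_on [:: x] (fun eta => (eta x == b)%:R : R).
  by move=> eta xi e; rewrite e// mem_head.
have := @mean_prod _ q [:: x] s _ _ h1 h; rewrite /expect => /(_ _) e.
transitivity (mean q ([:: x] ++ s) (fun eta => (eta x == b)%:R *
   (all (fun x => eta x == b) s)%:R) (fun=> true)).
  by congr mean; apply/funext => eta; case: eqP; rewrite ?mul1r ?mul0r.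
rewrite e; last by move=> y; rewrite inE => /eqP ->.
congr (_ * _); rewrite /= /site_mean /update eqxx.
by case: b {h h1 e IH} => /=; rewrite ?mulr0 ?mulr1 ?add0r ?addr0.
Qed.

(** Independence over disjoint lists. The value [false] serves for empty blocks and for boxes of
    hard sites, the value [true] for occupied strips. *)
Lemma expect_no_block q (b : bool) (bs : seq (seq site)) : uniq (flatten bs) ->
  expect q (flatten bs) (fun eta => \prod_(B <- bs) (1 - (all (fun x => eta x == b) B)%:R)) =
  \prod_(B <- bs) (1 - (if b then 1 - q else q) ^+ size B).
Proof.
have h B : depends_on B (fun eta => 1 - (all (fun x => eta x == b) B)%:R : R).
  by move=> eta xi e; congr (1 - (_ : bool)%:R); apply: eq_in_all => y /e ->.
elim: bs => [_|B bs IH].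
  rewrite (_ : (fun=> _) = (fun=> 1)) ?expect_cst ?big_nil//.
  by apply/funext => eta; rewrite big_nil.
rewrite [flatten _]/= cat_uniq => /and3P[uB /hasPn dis ubs].
rewrite big_cons -IH// -(expect_all_eq q b uB) -[X in X - _](expect_cst q B 1) -expectB.
have hs : depends_on (flatten bs)
    (fun eta => \prod_(B <- bs) (1 - (all (fun x => eta x == b) B)%:R) : R).
  move=> eta xi e; apply: eq_big_seq => C Cbs; apply: h => x xC; apply: e.
  by apply/flattenP; exists C.
have dis' x : x \in B -> x \notin flatten bs.
  by move=> xB; apply/negP => /dis/negP; apply.
rewrite /expect.
have := congr1 (@^~ (fun=> true)) (@mean_prod _ q _ _ _ _ (h B) hs dis') => /= <-.
by congr mean; apply/funext => eta; rewrite big_cons.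
Qed.

(** If block [k] is already empty, emptying it changes nothing; so [f] is at most the indicator that
    no block is empty plus the sum over [k] of [f] after emptying block [k]. Each such term is
    estimated by walking back to block 0, which contains the origin and makes [f] vanish. *)
Lemma expect_block_chain omega q Lam f (B : nat -> seq site) n b M : 0 < q <= 1 ->
  (forall eta, 0 <= f eta <= 1) -> (forall eta, eta origin = false -> f eta = 0) ->
  origin \in B 0 -> (forall k, k < n -> {subset B k <= Lam})%N ->
  (forall k, size (B k) <= b)%N -> uniq (flatten [seq B k | k <- iota 0 n]) ->
  (forall k, links omega (B k) (B k.+1)) -> (forall k, links omega (B k.+1) (B k)) ->
  0 <= M -> (forall k x, (k < n)%N -> x \in B k ->
     expect q Lam (fun eta => (constraint omega x eta)%:R * `|grad x f eta|) <= M) ->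
  expect q Lam f <= (1 - q ^+ b) ^+ n + n%:R * (n%:R * ((2 * b)%:R * (q^-1 ^+ (2 * b) * M))).
Proof.
move=> q01 f01 f0 oB BL Bb uB l1 l2 M0 hM.
have q01' : 0 <= q <= 1 by case/andP: q01 => /ltW ->.
set T := _%:R * (_ ^+ _ * M).
have T0 : 0 <= T by rewrite !mulr_ge0// exprn_ge0// invr_ge0; case/andP: q01'.
have fB k : (k < n)%N -> expect q Lam (fun eta => f (empty_on (B k) eta)) <= k%:R * T.
  elim: k => [|k IH] kn.
    rewrite mul0r (_ : (fun=> _) = (fun=> 0)) ?expect_cst//.
    by apply/funext => eta; rewrite f0// /empty_on oB.
  have kn' := ltnW kn.
  apply: (@le_trans _ _ (expect q Lam (fun eta => f (empty_on (B k) eta) +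
     `|f (empty_on (B k.+1) eta) - f (empty_on (B k) eta)|))).
    by apply: expect_le => // eta; rewrite -lerBlDl ler_norm.
  rewrite expectD -natr1 mulrDl mul1r lerD ?IH//.
  apply: (@expect_links_le omega) => //; [exact: BL|exact: BL|].
  by move=> x; rewrite mem_cat => /orP[] xB; [apply: (hM k)|apply: (hM k.+1)].
pose bs := [seq B k | k <- iota 0 n].
pose no eta : R := \prod_(C <- bs) (1 - (all (fun x => eta x == false) C)%:R).
apply: (@le_trans _ _ (expect q Lam (fun eta => no eta + \sum_(k < n) f (empty_on (B k) eta)))).
  apply: expect_le => // eta.
  have S0 : 0 <= \sum_(k < n) f (empty_on (B k) eta).
    by apply: sumr_ge0 => k _; case/andP: (f01 (empty_on (B k) eta)).
  have [/hasP[C /mapP[k]]|/hasPn hno] := boolP (has (all (fun x => eta x == false)) bs).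
    rewrite mem_iota add0n => /andP[_ kn] -> /allP hC.
    have -> : f eta = f (empty_on (B k) eta).
      congr f; apply/funext => x; rewrite /empty_on; case: ifP => // /hC /eqP //.
    rewrite (bigD1 (Ordinal kn)) //= addrCA lerDl addr_ge0//.
      apply: prodr_ge0 => D _; rewrite subr_ge0; by case: (all _ _).
    by apply: sumr_ge0 => j _; case/andP: (f01 (empty_on (B j) eta)).
  rewrite /no big1_seq => [|C /andP[_ /hno /negbTE ->]]; last by rewrite subr0.
  by apply: le_trans (_ : 1 <= _); [case/andP: (f01 eta)|rewrite lerDl].
rewrite expectD expect_sum lerD//.
  have dn : depends_on (flatten bs) no.
    move=> eta xi e; apply: eq_big_seq => C Cbs.
    congr (1 - (_ : bool)%:R); apply: eq_in_all => x xC; rewrite e//.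
    by apply/flattenP; exists C.
  have -> : expect q Lam no = expect q (flatten bs) no.
    rewrite /expect (mean_super q dn)// => x /flattenP[C /mapP[k]].
    by rewrite mem_iota add0n => /andP[_ kn] -> /(BL _ kn).
  rewrite expect_no_block// big_map.
  rewrite (_ : (1 - q ^+ b) ^+ n = \prod_(k <- iota 0 n) (1 - q ^+ b)); last first.
    by rewrite big_const_seq count_predT size_iota -Monoid.iteropE.
  apply: ler_prod => k _; rewrite subr_ge0 lerD2l lerN2 ler_wiXn2l ?Bb//.
  - by rewrite exprn_ile1//; case/andP: q01'.
  - by case/andP: q01'.
  - by case/andP: q01'.
apply: le_trans (_ : \sum_(k < n) n%:R * T <= _).
  apply: ler_sum => k _; apply: le_trans (fB _ (ltn_ord k)) _.
  by rewrite ler_wpM2r// ler_nat ltnW.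
by rewrite sumr_const card_ord -(mulr_natl (n%:R * T)).
Qed.

(* By AM-GM in the form [|g| <= lam + g^2 / lam]. *)
Lemma expect_grad_le q Lam I (c : site -> config -> bool) f x lam : 0 < q < 1 -> 0 < lam ->
  x \in I ->
  expect q Lam (fun eta => (c x eta)%:R * `|grad x f eta|) <=
  lam + (q * (1 - q))^-1 * lam^-1 * finite_dirichlet q Lam I c f.
Proof.
move=> /andP[q0 q1] lam0 xI.
have q01 : 0 <= q <= 1 by rewrite !ltW.
have qq : 0 < q * (1 - q) by rewrite mulr_gt0// subr_gt0.
have D1 : expect q Lam (fun eta => (c x eta)%:R * site_var q x f eta) <=
    finite_dirichlet q Lam I c f.
  have D0 y : 0 <= expect q Lam (fun eta => (c y eta)%:R * site_var q y f eta).
    apply: expect_ge0 => // eta; rewrite mulr_ge0// site_varE mulr_ge0 ?sqr_ge0//.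
    exact: ltW.
  rewrite /finite_dirichlet (big_rem x)//= lerDl; apply: sumr_ge0 => y _; exact: D0.
apply: (@le_trans _ _ (lam + (q * (1 - q))^-1 * lam^-1 *
   expect q Lam (fun eta => (c x eta)%:R * site_var q x f eta))); last first.
  by rewrite lerD2l ler_wpM2l// mulr_ge0// invr_ge0 ltW.
rewrite -[X in X + _](expect_cst q Lam lam) -expectZ -expectD.
apply: expect_le => // eta; rewrite site_varE -/(grad x f eta).
case: (c x eta); last by rewrite !mul0r mulr0 addr0 ltW.
rewrite !mul1r -(real_normK (num_real (grad x f eta))).
set g := `|_|; have -> : (q * (1 - q))^-1 * lam^-1 * (q * (1 - q) * g ^+ 2) = lam^-1 * g ^+ 2.
  by field; rewrite !gt_eqF// subr_gt0.
rewrite -(ler_pM2l lam0) mulrDr mulVKf ?gt_eqF//.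
have : 0 <= g by rewrite /g.
nra.
Qed.

End Blocks.

(** * Local functions: continuity, generator, short-time expansion *)

Section Continuity.
Context {R : realType}.
Implicit Types (q : R) (f : config -> R) (s : seq site).

Lemma continuous_depends_on s f : depends_on s f -> continuous_config f.
Proof.
move=> sf eta; pose F := nbhs (eta : {ptws site -> bool}).
have hF (x : site) : \forall xi \near F, xi x = eta x.
  exact: (@proj_continuous site (fun=> bool) x eta _ (discrete_set1 (eta x))).
have hs : \forall xi \near F, forall x, x \in s -> xi x = eta x.
  elim: (s) => [|y t IH]; first exact: nearW.
  near=> xi => x; rewrite inE => /predU1P[->|].
    by near: xi; exact: hF.
  by move: x; near: xi.
apply/cvgrPdist_lt => e e0; near=> xi.
by rewrite (sf eta xi) ?subrr ?normr0// => x xs; apply/esym; move: x xs; near: xi.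
Unshelve. all: by end_near. Qed.

Lemma cvg_ptws (F : set_system {ptws site -> bool}) (eta : config) : Filter F ->
  (forall x, xi x @[xi --> F] --> eta x) -> {ptws, F --> (eta : site -> bool)}.
Proof.
move=> FF h; apply/cvg_sup => x; apply/cvg_image.
  by apply/seteqP; split => // b _; exists (fun=> b).
move=> A /= hA; exists [set xi | A (xi x)]; first exact: h.
apply/seteqP; split => [_ [xi Axi <-]//|b Ab].
by exists (fun=> b).
Qed.

Lemma local_depends_on s f : depends_on s f -> local_fun f.
Proof. by move=> sf; exists [set` s] => //; exact: finite_seq. Qed.

Lemma generatorE omega q s f eta : uniq s -> depends_on s f ->
  generator omega q f eta =
  \sum_(x <- s) (constraint omega x eta)%:R * (site_mean q x f eta - f eta).
Proof.
move=> us sf; rewrite /generator (fsbigE s)//; last first.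
  move=> x _ xs; rewrite site_mean_indep ?subrr ?mulr0// => xi b.
  exact: depends_on_update xs.
by apply: eq_bigl => x; rewrite in_setT.
Qed.

Let trunc (n : nat) (eta : config) : config :=
  fun x => if (pickle x < n)%N then eta x else true.

(** A continuous function is the pointwise limit of the local functions obtained by setting to
    occupied every site beyond the first [n] of an enumeration. *)
Lemma measurable_continuous_config f : continuous_config f -> measurable_fun setT f.
Proof.
move=> cf; apply: (@measurable_fun_cvg _ _ _ _ (fun n eta => f (trunc n eta))).
  move=> n; apply: (@measurable_fun_depends_on _ _ (pmap unpickle (iota 0 n))) => eta xi e.
  congr f; apply/funext => x; rewrite /trunc; case: ifP => // xn; apply: e.
  by rewrite mem_pmap; apply/mapP; exists (pickle x); rewrite ?pickleK// mem_iota.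
move=> eta _; apply: (@cvg_comp _ _ _ (trunc ^~ eta) f _ _ _ _ (cf eta)).
apply: cvg_ptws => x; apply: cvg_near_cst.
by exists (pickle x).+1 => // n /= xn; rewrite /trunc xn.
Qed.

Lemma generated_by_expand omega q (S : R -> (config -> R) -> (config -> R)) f e :
  generated_by omega q S -> local_fun f -> 0 < e ->
  \forall h \near 0^'+, forall eta,
    `|S h f eta - (f eta + h * generator omega q f eta)| <= h * e.
Proof.
move=> gen lf e0.
have /(gen f lf) hE : nbhs (generator omega q f : {uniform config -> R})
   [set g | forall eta, `|generator omega q f eta - g eta| < e].
  apply/uniform_nbhs; exists [set xy | `|xy.1 - xy.2| < e]; split; last first.
    by move=> g /= hg eta; apply: hg.
  by rewrite -entourage_ballE; exists e.
near=> h => eta.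
have h0 : 0 < h by near: h; exact: nbhs_right_gt.
have : `|generator omega q f eta - (S h f eta - f eta) / h| < e.
  by move: eta; near: h; exact: hE.
rewrite -(ltr_pM2l h0) -{1}(gtr0_norm h0) -normrM => /ltW; apply: le_trans.
rewrite -normrN [X in _ <= `|X|](_ : _ = - (S h f eta - (f eta + h * generator omega q f eta))) //.
by field; rewrite gt_eqF.
Unshelve. all: by end_near. Qed.

End Continuity.

Section Integrals.
Context {R : realType} d (T : measurableType d) (P : probability T R).
Implicit Types (phi : config -> R) (X : T -> config) (B : set T).

Lemma integrable_bounded_comp X phi B M : measurable_fun setT X -> measurable_fun setT phi ->
  (forall eta, `|phi eta| <= M) -> measurable B -> P.-integrable B (EFin \o (phi \o X)).
Proof.
move=> mX mphi hM mB; apply: measurable_bounded_integrable => //.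
- exact: le_lt_trans (probability_le1 _ mB) (ltry _).
- by apply: measurable_funTS; exact: measurableT_comp mX.
- by exists M; split; [exact: num_real|move=> y My w _; exact: le_trans (hM _) (ltW My)].
Qed.

Lemma Rintegral_cst_le B (c : R) : measurable B -> 0 <= c -> \int[P]_(w in B) c <= c.
Proof.
move=> mB c0; rewrite Rintegral_cst// -[leRHS]mulr1 ler_wpM2l//.
rewrite -lee_fin fineK ?fin_num_measure//; exact: probability_le1.
Qed.

End Integrals.

(** * From the chain to the process *)

Section Process.
Context {R : realType} d (T : measurableType d) (P : probability T R) (X : R -> T -> config).
Variables (omega : config) (q : R) (mu : probability config R).
Hypothesis hX : kcm_process P X omega q mu.
Hypothesis hmu : bernoulli_product (1 - q) mu.
Hypothesis q01 : 0 < q < 1.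

Implicit Types (f : config -> R) (eta : config) (B : set T) (t h e : R).

(** There are [n] grid times, the last one being (n - 1) h; hence the event with index n+1 belongs
    to the history up to time n h. *)
Definition occupied_grid h n : set T :=
  [set w | forall i, (i < n)%N -> X (i%:R * h) w origin = true].

Lemma history_measurable t B : history X t B -> measurable B.
Proof.
apply: smallest_sub; first exact: sigma_algebra_measurable.
move=> _ [u [A [u0 _ mA ->]]]; rewrite -[X in measurable X]setTI.
exact: (kcm_measurable hX).
Qed.

Lemma history_occupied_grid h n : 0 <= h -> history X (n%:R * h) (occupied_grid h n.+1).
Proof.
move=> h0; rewrite (_ : occupied_grid h n.+1 =
   \bigcap_(i < n.+1) (X (i%:R * h) @^-1` [set eta | eta origin = true])); last first.
  by apply/seteqP; split.
rewrite /history; set G := [set B | _].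
apply: (@bigcap_measurable _ (g_sigma_algebraType (G : set (set T)))) => [|i /= i_n].
  by exists 0.
apply: sub_sigma_algebra; exists (i%:R * h), [set eta | eta origin = true]; split => //.
- exact: mulr_ge0.
- by rewrite ler_wpM2r// ler_nat -ltnS.
- exact: measurable_coordinate.
Qed.

Lemma measurable_occupied_grid h n : 0 <= h -> measurable (occupied_grid h n).
Proof.
case: n => [|n] h0; last exact: history_measurable (@history_occupied_grid h n h0).
by rewrite (_ : occupied_grid h 0 = setT)//; apply/seteqP; split.
Qed.

Lemma expect_initial s f : uniq s -> depends_on s f ->
  \int[P]_w f (X 0 w) = expect q s f.
Proof.
move=> us sf; rewrite /Rintegral (_ : (\int[P]_w _)%E = (\int[mu]_eta (f eta)%:E)%E).
  by rewrite (integral_depends_on (fun=> true) hmu sf us).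
have mX0 := kcm_measurable hX (lexx 0).
have mf : measurable_fun setT (EFin \o f).
  by apply/measurable_EFinP; exact: measurable_fun_depends_on sf.
rewrite [RHS](@eq_measure_integral _ _ _ _ (pushforward P (X 0))); last first.
  by move=> A mA _; exact: (esym (kcm_initial hX mA)).
rewrite integral_pushforward//= preimage_setT.
have [M hM] := depends_on_bounded sf.
by apply: (integrable_bounded_comp P mX0 _ hM) => //; exact: measurable_fun_depends_on sf.
Qed.

Section Semigroup.
Variable S : R -> (config -> R) -> (config -> R).
Hypothesis hS : feller_semigroup S.
Hypothesis hPX : forall (s t : R) f B, 0 <= s -> 0 <= t ->
  continuous_config f -> history X s B ->
  (\int[P]_(w in B) (f (X (s + t) w))%:E = \int[P]_(w in B) (S t f (X s w))%:E)%E.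

Lemma semigroup_bounds t f : 0 <= t -> continuous_config f ->
  (forall eta, 0 <= f eta <= 1) -> forall eta, 0 <= S t f eta <= 1.
Proof.
move=> t0 cf f01 eta; have f0 xi : 0 <= f xi by case/andP: (f01 xi).
have c1 : continuous_config (cst 1 : config -> R) by move=> xi; exact: cvg_cst.
rewrite (feller_pos hS)//=.
have := congr1 (@^~ eta) (feller_linear hS (-1) t0 cf c1).
rewrite (feller_one hS)//= mulN1r addrC => e; rewrite -subr_ge0 -e.
apply: (feller_pos hS) => //; last by move=> xi; rewrite mulN1r addrC subr_ge0; case/andP: (f01 xi).
move=> xi; apply: cvgD; last exact: cvg_cst.
by apply: cvgM; [exact: cvg_cst|exact: cf].
Qed.

Lemma measurable_process t : 0 <= t -> measurable_fun setT (X t).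
Proof. exact: (kcm_measurable hX). Qed.

Lemma integrable_semigroup t s f u B : 0 <= t -> 0 <= u -> depends_on s f ->
  (forall eta, 0 <= f eta <= 1) -> measurable B -> P.-integrable B (EFin \o (S u f \o X t)).
Proof.
move=> t0 u0 sf f01 mB; have cf := continuous_depends_on sf.
apply: (integrable_bounded_comp (M := 1) P (measurable_process t0)) => //.
  by apply: measurable_continuous_config; exact: (feller_cont hS).
by move=> eta; have /andP[? ?] := semigroup_bounds u0 cf f01 eta; rewrite ger0_norm.
Qed.

Lemma integrable_process t s f B : 0 <= t -> depends_on s f ->
  (forall eta, 0 <= f eta <= 1) -> measurable B -> P.-integrable B (EFin \o (f \o X t)).
Proof.
move=> t0 sf f01 mB.
apply: (integrable_bounded_comp (M := 1) P (measurable_process t0)) => //.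
  exact: measurable_fun_depends_on sf.
by move=> eta; have /andP[? ?] := f01 eta; rewrite ger0_norm.
Qed.

Lemma Rintegral_subset_le t s f (B C : set T) : 0 <= t -> depends_on s f ->
  (forall eta, 0 <= f eta <= 1) -> measurable B -> measurable C -> B `<=` C ->
  \int[P]_(w in B) f (X t w) <= \int[P]_(w in C) f (X t w).
Proof.
move=> t0 sf f01 mB mC BC.
have iC D : measurable D -> (\int[P]_(w in D) (f (X t w))%:E)%E \is a fin_num.
  by move=> mD; exact: integrable_fin_num (integrable_process t0 sf f01 mD).
rewrite fine_le ?iC// ge0_subset_integral//.
- apply/measurable_EFinP; apply: measurable_funTS.
  by apply: measurableT_comp (measurable_process t0); exact: measurable_fun_depends_on sf.
- by move=> w _; rewrite lee_fin; case/andP: (f01 (X t w)).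
Qed.

Lemma markov_Rintegral h n f : 0 <= h -> continuous_config f ->
  \int[P]_(w in occupied_grid h n.+1) f (X (n.+1%:R * h) w) =
  \int[P]_(w in occupied_grid h n.+1) S h f (X (n%:R * h) w).
Proof.
move=> h0 cf; rewrite -natr1 mulrDl mul1r /Rintegral hPX ?mulr_ge0//.
exact: history_occupied_grid.
Qed.

(** [g j] plays the role of an upper bound for the probability to stay occupied during [j] more
    steps. With [N - i] steps left at time i h, each use of the Markov property costs one error
    [h * e]. *)
Lemma grid_supersolution (g : nat -> config -> R) s h e N : 0 <= h -> 0 <= e ->
  (forall j, depends_on s (g j)) -> (forall j eta, 0 <= g j eta <= 1) ->
  (forall j, (j < N)%N -> forall eta, eta origin -> S h (g j) eta <= g j.+1 eta + h * e) ->
  forall i, (i <= N)%N ->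
  \int[P]_(w in occupied_grid h i.+1) g (N - i)%N (X (i%:R * h) w) <=
  \int[P]_w g N (X 0 w) + i%:R * (h * e).
Proof.
move=> h0 e0 gs g01 gS; elim=> [_|i IH iN].
  rewrite subn0 !mul0r addr0; apply: (Rintegral_subset_le (lexx 0) (gs N) (g01 N)) => //.
  exact: measurable_occupied_grid.
have ih : 0 <= i%:R * h by exact: mulr_ge0.
have ih1 : 0 <= i.+1%:R * h by exact: mulr_ge0.
have mG := measurable_occupied_grid _ h0.
(* The condition at the last grid time is dropped, so that the event lies in the history up to time
   i h and the Markov property applies. *)
apply: (@le_trans _ _ (\int[P]_(w in occupied_grid h i.+1) g (N - i.+1)%N (X (i.+1%:R * h) w))).
  apply: (Rintegral_subset_le ih1 (gs _) (g01 _)) => // w wG j ji.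
  by apply: wG; rewrite ltnS ltnW.
rewrite markov_Rintegral//; last exact: continuous_depends_on (gs _).
apply: (@le_trans _ _ (\int[P]_(w in occupied_grid h i.+1)
    (g (N - i)%N (X (i%:R * h) w) + h * e))).
  apply: le_Rintegral; first exact: mG.
  - exact: (integrable_semigroup ih h0 (gs _) (g01 _)).
  - rewrite (_ : EFin \o _ = (EFin \o (g (N - i)%N \o X (i%:R * h))) \+ cst (h * e)%:E)%E //.
    apply: integrableD => //; first exact: (integrable_process ih (gs _) (g01 _)).
    apply: measurable_bounded_integrable => //.
      exact: le_lt_trans (probability_le1 _ (mG _)) (ltry _).
    exists (h * e); split; [exact: num_real|move=> y /ltW My w _].
    by rewrite /= ger0_norm ?mulr_ge0.
  - move=> w wG; rewrite (_ : N - i = (N - i.+1).+1)%N; last by rewrite subnSK.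
    apply: gS; last by apply: wG.
    by rewrite subnS prednK ?subn_gt0// leq_subr.
rewrite RintegralD//; first last.
- apply: measurable_bounded_integrable => //.
    exact: le_lt_trans (probability_le1 _ (mG _)) (ltry _).
  exists (h * e); split; [exact: num_real|move=> y /ltW My w _].
  by rewrite /= ger0_norm ?mulr_ge0.
- exact: (integrable_process ih (gs _) (g01 _)).
rewrite -[in leRHS]natr1 mulrDl mul1r addrA lerD ?IH ?(ltnW iN)//.
by apply: Rintegral_cst_le => //; exact: mulr_ge0.
Qed.

Lemma prob_grid_le (g : nat -> config -> R) s h e N : 0 <= h -> 0 <= e -> uniq s ->
  (forall j, depends_on s (g j)) -> (forall j eta, 0 <= g j eta <= 1) ->
  (forall eta, eta origin -> g 0 eta = 1) ->
  (forall j, (j < N)%N -> forall eta, eta origin -> S h (g j) eta <= g j.+1 eta + h * e) ->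
  (P (occupied_grid h N.+1) <= (expect q s (g N) + N%:R * (h * e))%:E)%E.
Proof.
move=> h0 e0 us gs g01 g0 gS; have := grid_supersolution h0 e0 gs g01 gS (leqnn N).
rewrite subnn (expect_initial us (gs N)).
have mG := measurable_occupied_grid N.+1 h0.
rewrite (_ : \int[P]_(w in _) _ = fine (P (occupied_grid h N.+1))).
  by rewrite -lee_fin fineK// fin_num_measure.
rewrite -[RHS]mul1r -Rintegral_cst//; apply: eq_Rintegral => w; rewrite inE => wG.
by apply: g0; apply: wG.
Qed.

(** The origin is occupied at time 0 with probability 1 - q, and each step loses at most h (q + e)
    of the probability that it is still occupied. *)
Lemma prob_grid_ge h e n : 0 <= h -> 0 <= e ->
  (forall eta, eta origin -> 1 - h * (q + e) <= S h (fun xi => (xi origin)%:R) eta) ->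
  1 - q - n%:R * (h * (q + e)) <= fine (P (occupied_grid h n.+1)).
Proof.
move=> h0 e0 hb; pose b (xi : config) : R := (xi origin)%:R.
have sb : depends_on [:: origin] b by move=> eta xi e'; rewrite /b e'// mem_head.
have b01 eta : 0 <= b eta <= 1 by rewrite /b; case: (eta origin); rewrite ?lexx ler01.
have mG k := measurable_occupied_grid k h0.
have GE k : fine (P (occupied_grid h k.+1)) =
    \int[P]_(w in occupied_grid h k) b (X (k%:R * h) w).
  have kh : 0 <= k%:R * h by exact: mulr_ge0.
  pose A : set T := X (k%:R * h) @^-1` [set eta | eta origin = true].
  have mA : measurable A.
    rewrite -[A]setTI; apply: (measurable_process kh) => //; exact: measurable_coordinate.
  rewrite (_ : occupied_grid h k.+1 = A `&` occupied_grid h k); last first.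
    apply/seteqP; split => w; rewrite /occupied_grid /A /=.
      by move=> wG; split => [|i ik]; apply: wG => //; rewrite ltnS ltnW.
    by move=> [wk wG] i; rewrite ltnS leq_eqVlt => /predU1P[->//|]; exact: wG.
  rewrite -integral_indic//; congr fine; apply: eq_integral => w _.
  rewrite indicE /b; congr (_%:R%:E); case e': (X _ w origin); first by rewrite mem_set.
  by rewrite memNset // /A /= e'.
elim: n => [|n IH].
  rewrite GE !mul0r subr0 (_ : occupied_grid h 0 = setT); last by apply/seteqP; split.
  rewrite (_ : \int[P]_(w in _) _ = \int[P]_w b (X 0 w)); last first.
    by congr (Rintegral _ _ _); apply/funext => w; rewrite mul0r.
  by rewrite (@expect_initial [:: origin])// /expect /= /site_mean /b /update eqxx mulr0 add0r mulr1.
have nh : 0 <= n%:R * h by exact: mulr_ge0.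
rewrite GE markov_Rintegral//; last exact: continuous_depends_on sb.
apply: (@le_trans _ _ (\int[P]_(w in occupied_grid h n.+1) (1 - h * (q + e)))); last first.
  apply: le_Rintegral; first exact: mG.
  - apply: measurable_bounded_integrable => //.
      exact: le_lt_trans (probability_le1 _ (mG _)) (ltry _).
    exists `|1 - h * (q + e)|; split; [exact: num_real|by move=> y /ltW My w _].
  - exact: (integrable_semigroup nh h0 sb b01).
  - by move=> w wG; apply: hb; apply: wG.
rewrite Rintegral_cst// mulrBl mul1r -natr1 mulrDl mul1r.
have : h * (q + e) * fine (P (occupied_grid h n.+1)) <= h * (q + e).
  rewrite -[leRHS]mulr1 ler_wpM2l//.
    by rewrite mulr_ge0// addr_ge0// ltW//; case/andP: q01.
  by rewrite -lee_fin fineK ?fin_num_measure//; exact: probability_le1.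
move: IH; lra.
Qed.

End Semigroup.
End Process.

(** * Measurability of the hitting time and bound on early hitting *)

Section HittingTime.
Context {R : realType} d (T : measurableType d) (P : probability T R) (X : R -> T -> config).
Variables (omega : config) (q : R) (mu : probability config R).
Hypothesis hX : kcm_process P X omega q mu.
Hypothesis hmu : bernoulli_product (1 - q) mu.
Hypothesis q01 : 0 < q < 1.

Implicit Types (w : T) (a t h : R).

Lemma tau0_ltP w a : reflect (exists t, [/\ 0 <= t, t < a & X t w origin = false])
  (tau0 X w < a%:E)%E.
Proof.
apply: (iffP idP) => [/ereal_inf_lt[_ [t [t0 Xt] <-]]|[t [t0 ta Xt]]].
  by rewrite lte_fin => ta; exists t.
apply: le_lt_trans (_ : t%:E < a%:E)%E; last by rewrite lte_fin.
by apply: ereal_inf_lbound; exists t.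
Qed.

Lemma tau0_ge0 w : (0 <= tau0 X w)%E.
Proof. by apply: le_ereal_inf_tmp => _ [t [t0 _] <-]; rewrite lee_fin. Qed.

Lemma tau0_ge_sub_grid h n : 0 < h ->
  [set w | ((n%:R * h)%:E <= tau0 X w)%E] `<=` occupied_grid X h n.
Proof.
move=> h0 w /= tw i i_n; case e: (X _ w origin) => //; move: tw; rewrite leNgt.
move/negP; case; apply/tau0_ltP; exists (i%:R * h); split => //.
  by rewrite mulr_ge0// ltW.
by rewrite ltr_pM2r ?ltr_nat.
Qed.

(** By right continuity an empty origin stays empty for some time, so a fine enough dyadic grid
    detects it. This reduces the hitting time to countably many observation times. *)
Lemma tau0_lt_grid a : 0 < a -> [set w | (tau0 X w < a%:E)%E] =
  \bigcup_m ~` occupied_grid X (a / (2 ^ m)%:R) (2 ^ m).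
Proof.
move=> a0; have pow0 m : 0 < (2 ^ m)%:R :> R by rewrite ltr0n expn_gt0.
apply/seteqP; split => [w /= /tau0_ltP[t [t0 ta Xt]]|w [m _ /= hm]]; last first.
  move: hm => /existsNP[i /not_implyP[im hm]].
  apply/tau0_ltP; exists (i%:R * (a / (2 ^ m)%:R)); split.
  - by rewrite mulr_ge0// divr_ge0// ltW.
  - by rewrite mulrCA gtr_pMr// ltr_pdivrMr// mul1r ltr_nat.
  - exact/negbTE/negP.
have hb : \forall s \near t^'+, X s w origin = false.
  have : X s w origin @[s --> t^'+] --> X t w origin by exact: (kcm_right_cont hX).
  by rewrite Xt => /(_ _ (discrete_set1 false)).
have [e e0 he] : exists2 e, 0 < e & forall s, t < s -> s < t + e -> X s w origin = false.
  move: hb; rewrite near_withinE => /nbhs_ballP[e /= e0 he]; exists e => // s ts se.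
  by apply: he => //; rewrite /ball /= ltr_distlC; apply/andP; split; lra.
(* A mesh below [e'] puts a grid point after [t], before [a], and within the time during which the
   origin stays empty. *)
pose e' := Num.min e (a - t).
have e'0 : 0 < e' by rewrite lt_min e0 subr_gt0.
pose m := (Num.truncn (a / e')).+1.
have hm : a / (2 ^ m)%:R < e'.
  rewrite ltr_pdivrMr// mulrC -ltr_pdivrMr//.
  have /andP[_ h] := truncn_itv (divr_ge0 (ltW a0) (ltW e'0)).
  by apply: lt_trans h _; rewrite ltr_nat; exact: ltn_expl.
set h := a / _ in hm; have h0 : 0 < h by rewrite divr_gt0.
have /andP[i1 i2] := truncn_itv (divr_ge0 t0 (ltW h0)).
set i := Num.truncn (t / h) in i1 i2.
have ti : t < i.+1%:R * h by rewrite -ltr_pdivrMr.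
have it : i.+1%:R * h < t + e'.
  rewrite -natr1 mulrDl mul1r; apply: ler_ltD => //; by rewrite -ler_pdivlMr.
exists m => //= /(_ i.+1) H.
have: X (i.+1%:R * h) w origin = false.
  by apply: he => //; apply: lt_le_trans it _; rewrite lerD2l ge_min lexx.
rewrite H// -(ltr_nat R) -(ltr_pM2r h0).
rewrite [ltRHS](_ : _ = a); last by rewrite /h mulrCA divff ?gt_eqF// mulr1.
by apply: lt_le_trans it _; rewrite -lerBrDl ge_min lexx orbT.
Qed.

Lemma measurable_tau0_lt a : measurable [set w | (tau0 X w < a%:E)%E].
Proof.
have [a0|a0] := ltP 0 a.
  rewrite (tau0_lt_grid a0); apply: bigcup_measurable => m _; apply: measurableC.
  by apply: (measurable_occupied_grid hX); rewrite divr_ge0// ltW.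
rewrite (_ : [set w | _] = set0)//; apply/seteqP; split => // w /=.
by rewrite ltNge (le_trans _ (tau0_ge0 w))// lee_fin.
Qed.

Lemma measurable_tau0 : measurable_fun setT (tau0 X).
Proof.
apply: (measurability _ (ErealGenInftyO.measurableE R)) => // _ [_ [a ->] <-].
by rewrite setTI preimage_itvNyo; exact: measurable_tau0_lt.
Qed.

Lemma measurable_tau0_ge a : measurable [set w | (a%:E <= tau0 X w)%E].
Proof.
rewrite (_ : [set w | _] = ~` [set w | (tau0 X w < a%:E)%E]).
  exact/measurableC/measurable_tau0_lt.
by apply/seteqP; split => w /=; rewrite leNgt => /negP.
Qed.

Lemma measurable_tau0_le a : measurable [set w | (tau0 X w <= a%:E)%E].
Proof. by rewrite -[X in measurable X]setTI; exact: emeasurable_fun_infty_c measurable_tau0 _. Qed.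

(** The first [q] is the probability of an empty origin at time 0. The factor 2 comes from allowing
    an expansion error [q] on top of the rate [q]. Dyadic grids are nested, so the bound passes to
    the limit along their increasing union. *)
Lemma prob_tau0_lt_le a : 0 < a ->
  (P [set w | (tau0 X w < a%:E)%E] <= (q + 2 * a * q)%:E)%E.
Proof.
move=> a0; have [S [hS gS hPX]] := kcm_markov hX.
have [q0 q1] : 0 < q /\ q < 1 by exact/andP.
pose b (xi : config) : R := (xi origin)%:R.
have sb : depends_on [:: origin] b by move=> eta xi e'; rewrite /b e'// mem_head.
have hb : \forall h \near 0^'+, forall eta : config, eta origin -> 1 - h * (q + q) <= S h b eta.
  near=> h => eta eo.
  have h0 : 0 < h by near: h; exact: nbhs_right_gt.
  have : `|S h b eta - (b eta + h * generator omega q b eta)| <= h * q.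
    by move: eta eo; near: h; apply: filterS (generated_by_expand gS (local_depends_on sb) q0) => h hh eta _.
  rewrite (generatorE _ _ _ _ sb)// big_seq1 /site_mean /b /update eqxx mulr0 add0r mulr1 eo.
  rewrite ler_distl => /andP[+ _]; apply: le_trans.
  have : h * ((constraint omega origin eta)%:R * q) <= h * q.
    apply: ler_wpM2l; first exact: ltW.
    case: (constraint _ _ _); [by rewrite mul1r|by rewrite mul0r ltW].
  have -> : (true%:R : R) = 1 by [].
  move: ((constraint omega origin eta)%:R : R) => c; lra.
pose U m : set T := ~` occupied_grid X (a / (2 ^ m)%:R) (2 ^ m).
have pow0 m : 0 < (2 ^ m)%:R :> R by rewrite ltr0n expn_gt0.
have h0 m : 0 < a / (2 ^ m)%:R by rewrite divr_gt0.
have mG m : measurable (occupied_grid X (a / (2 ^ m)%:R) (2 ^ m)).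
  by apply: (measurable_occupied_grid hX); exact: ltW.
have mU m : measurable (U m) by exact: measurableC.
have UU : {homo U : n m / (n <= m)%N >-> (n <= m)%O}.
  apply/nondecreasing_seqP => m.
  apply/subsetPset; apply: subsetC => w wG i im.
  rewrite (_ : i%:R * _ = (2 * i)%:R * (a / (2 ^ m.+1)%:R)).
    by apply: wG; rewrite expnS ltn_pmul2l.
  by rewrite expnS !natrM; field; rewrite gt_eqF.
rewrite tau0_lt_grid// -[X in P X]/(\bigcup_m U m).
have cU := @nondecreasing_cvg_mu _ _ _ P _ mU (bigcupT_measurable _ mU) UU.
rewrite -(cvg_lim _ cU)//; apply: lime_le; first by apply/cvg_ex; exists (P (\bigcup_m U m)).
have {}hb : \forall m \near \oo, forall eta : config, eta origin ->
    1 - a / (2 ^ m)%:R * (q + q) <= S (a / (2 ^ m)%:R) b eta.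
  move: hb; rewrite near_withinE => /nbhs_ballP[e /= e0 he].
  exists (Num.truncn (a / e)).+1 => // m /= hm; apply: he; last exact: h0.
  rewrite /ball /= sub0r normrN gtr0_norm// ltr_pdivrMr// mulrC -ltr_pdivrMr//.
  have /andP[_ h] := truncn_itv (divr_ge0 (ltW a0) (ltW e0)).
  apply: lt_le_trans h _; rewrite ler_nat; apply: leq_trans hm _.
  exact: ltnW (ltn_expl _ _).
near=> m.
have : 1 - q - (2 ^ m).-1%:R * (a / (2 ^ m)%:R * (q + q)) <=
    fine (P (occupied_grid X (a / (2 ^ m)%:R) (2 ^ m).-1.+1)).
  apply: (prob_grid_ge hX hmu q01 hS hPX) => //; [exact: ltW|exact: ltW|].
  near: m; exact: hb.
rewrite prednK ?expn_gt0// /= /U probability_setC// => H.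
rewrite -[P _]fineK ?fin_num_measure// -EFinB lee_fin.
have : (2 ^ m).-1%:R * (a / (2 ^ m)%:R * (q + q)) <= (2 ^ m)%:R * (a / (2 ^ m)%:R * (q + q)).
  by rewrite ler_wpM2r ?ler_nat ?leq_pred// mulr_ge0 ?addr_ge0// ltW.
rewrite [leRHS](_ : _ = a * (q + q)); last by field; rewrite gt_eqF.
move: H; lra.
Unshelve. all: by end_near. Qed.

End HittingTime.

(** * Boxes around the origin *)

Section Box.

Definition dist0 (x : site) : nat := maxn `|x.1|%N `|x.2|%N.

Definition box (n : nat) : seq site :=
  [seq (i%:Z - n%:Z, j%:Z - n%:Z) | i <- iota 0 n.*2.+1, j <- iota 0 n.*2.+1].

Lemma mem_box n x : (x \in box n) = (dist0 x <= n)%N.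
Proof.
apply/allpairsP/idP => [[[i j] []]|].
  by rewrite !mem_iota /dist0 => hi hj -> /=; move: hi hj; rewrite geq_max /=; lia.
rewrite /dist0 geq_max => /andP[h1 h2].
exists (`|(x.1 + n%:Z)%R|%N, `|(x.2 + n%:Z)%R|%N); rewrite !mem_iota.
by case: x h1 h2 => a b /= h1 h2; split; [lia|lia|congr (_, _); lia].
Qed.

Lemma size_box n : size (box n) = (n.*2.+1 * n.*2.+1)%N.
Proof. by rewrite size_allpairs size_iota. Qed.

Lemma box_uniq n : uniq (box n).
Proof.
apply: allpairs_uniq; [exact: iota_uniq|exact: iota_uniq|].
move=> [i j] [i' j'] _ _ /= [] h1 h2; congr (_, _); lia.
Qed.

Lemma dist0_neighbor x y : x \in neighbors y -> (dist0 y <= (dist0 x).+1)%N.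
Proof.
have h1 : (`|x.1| <= dist0 x)%N by exact: leq_maxl.
have h2 : (`|x.2| <= dist0 x)%N by exact: leq_maxr.
move: (dist0 x) h1 h2 => D; case: x y => [x1 x2] [y1 y2] /= h1 h2.
by rewrite !inE /= => /or4P[] /eqP[e1 e2]; move: h1 h2; rewrite e1 e2 /dist0 /= geq_max;
   lia.
Qed.

Lemma neighborsC x y : (x \in neighbors y) = (y \in neighbors x).
Proof.
case: x y => [x1 x2] [y1 y2]; rewrite !inE /= !xpair_eqE.
apply/idP/idP => /or4P[] /andP[/eqP -> /eqP ->];
  rewrite ?addrK ?subrK ?eqxx ?orbT //.
Qed.

Lemma neighbors_irrefl x : x \notin neighbors x.
Proof. case: x => [x1 x2]; rewrite !inE /= !xpair_eqE; lia. Qed.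

Lemma depends_on_constraint omega x : depends_on (neighbors x) (constraint omega x).
Proof.
move=> eta xi e; congr (_ <= _)%N.
by apply: eq_big_seq => y /e ->.
Qed.

Lemma constraint_update omega x y eta b : x \notin neighbors y ->
  constraint omega x (update eta y b) = constraint omega x eta.
Proof.
move=> xy; apply: (depends_on_update b eta (depends_on_constraint omega (x := x))).
by rewrite neighborsC.
Qed.

End Box.

(** * Short-time expansion, uniform over functions on a finite set *)

Section UniformExpansion.
Context {R : realType}.
Variables (omega : config) (q : R) (S : R -> (config -> R) -> (config -> R)).
Hypothesis hS : feller_semigroup S.
Hypothesis gS : generated_by omega q S.
Implicit Types (f g : config -> R) (s : seq site).

Lemma generator_linear s (a : R) f g eta : depends_on s f -> depends_on s g ->
  generator omega q (fun xi => a * f xi + g xi) eta =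
  a * generator omega q f eta + generator omega q g eta.
Proof.
move=> sf sg; have us := undup_uniq s.
have sub h : depends_on s h -> depends_on (undup s) h.
  by apply: depends_on_sub => x; rewrite mem_undup.
rewrite !(generatorE _ _ _ us) //; last 3 first.
- exact: sub.
- exact: sub.
- by apply: sub => xi xi' e; rewrite (sf _ _ e) (sg _ _ e).
rewrite mulr_sumr -big_split; apply: eq_bigr => x _.
rewrite /= /site_mean; ring.
Qed.

Lemma semigroup_cst0 t : 0 <= t -> S t (fun=> 0) = fun=> 0.
Proof.
move=> t0; have c0 : continuous_config (fun=> 0 : R) by move=> xi; exact: cvg_cst.
have := feller_linear hS (-1) t0 c0 c0; rewrite mulr0 addr0 => ->.
by apply/funext => eta; rewrite mulN1r addNr.
Qed.

Let err h f eta := S h f eta - (f eta + h * generator omega q f eta).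

Let err_linear s h a f g eta : 0 <= h -> depends_on s f -> depends_on s g ->
  err h (fun xi => a * f xi + g xi) eta = a * err h f eta + err h g eta.
Proof.
move=> h0 sf sg; rewrite /err (generator_linear _ _ sf sg).
rewrite (feller_linear hS) //; [|exact: continuous_depends_on sf|exact: continuous_depends_on sg].
ring.
Qed.

(** The step h is chosen before [f], as required for survival functions that themselves depend on
    the time step. Uniformity holds because functions on a finite set of sites combine finitely many
    cylinder indicators with bounded coefficients, and the error is linear in [f]. *)
Lemma generated_by_expand_uniform s e : 0 < e ->
  \forall h \near 0^'+, forall f, depends_on s f -> (forall eta, `|f eta| <= 1) ->
    forall eta, `|S h f eta - (f eta + h * generator omega q f eta)| <= h * e.
Proof.
move=> e0.
(* The sites of [s] are split off one at a time, and [phi] collects the indicators of the values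
   already fixed. Once [s] is exhausted [f] is a constant factor, and the expansion of the single
   function [phi] suffices. *)
suff H t (phi : config -> R) : depends_on t phi -> forall e, 0 < e ->
    \forall h \near 0^'+, forall f, depends_on s f -> (forall eta, `|f eta| <= 1) ->
    forall eta, `|err h (fun xi => phi xi * f xi) eta| <= h * e.
  have s1 : depends_on [::] (fun=> 1 : R) by [].
  apply: filterS (H _ _ s1 _ e0) => h hh f sf f1 eta.
  have := hh f sf f1 eta; rewrite (_ : (fun xi => _) = f)//.
  by apply/funext => xi; rewrite mul1r.
elim: s t phi => [|x s IH] t phi tphi {e0}e e0.
  near=> h => f sf f1 eta.
  have h0 : 0 <= h by near: h; exact: nbhs_right_ge.
  rewrite (_ : (fun xi => _) = (fun xi => f eta * phi xi + (fun=> 0) xi)); last first.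
    by apply/funext => xi; rewrite addr0 mulrC (sf xi eta).
  rewrite (@err_linear t)// {2}/err semigroup_cst0//.
  have -> : generator omega q (fun=> 0) eta = 0.
    by rewrite (@generatorE _ _ _ [::]) ?big_nil.
  rewrite mulr0 !addr0 subr0 addr0 normrM; apply: le_trans (_ : 1 * _ <= _).
    by apply: ler_wpM2r.
  rewrite mul1r; move: (eta); near: h.
  exact: generated_by_expand gS (local_depends_on tphi) e0.
have stphi b : depends_on (x :: t) (fun xi => phi xi * (xi x == b)%:R).
  move=> eta xi e'; rewrite (e' x) ?mem_head//; congr (_ * _); apply: tphi => y yt.
  by apply: e'; rewrite inE yt orbT.
have e20 : 0 < e / 2 by rewrite divr_gt0.
have hpos : \forall h \near (0 : R)^'+, 0 <= h by exact: nbhs_right_ge.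
apply: filterS3 hpos (IH _ _ (stphi true) _ e20) (IH _ _ (stphi false) _ e20).
move=> h h0 H1 H2 f sf f1 eta.
have fb b xi : `|f (update xi x b)| <= 1 by [].
rewrite (_ : (fun xi => _) = (fun xi =>
   1 * (phi xi * (xi x == true)%:R * f (update xi x true)) +
   (phi xi * (xi x == false)%:R) * f (update xi x false))); last first.
  apply/funext => xi; rewrite -{2}(update_id xi x).
  by case: (xi x); rewrite /= ?mulr1 ?mulr0 ?mul0r ?mul1r ?addr0 ?add0r.
have sfb b : depends_on (x :: t ++ s) (fun xi => phi xi * (xi x == b)%:R * f (update xi x b)).
  move=> xi xi' e'; congr (_ * _).
    by apply: stphi => y yt; apply: e'; rewrite inE mem_cat; move: yt; rewrite inE => /orP[->|->]; rewrite ?orbT.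
  by apply: (depends_on_slice b sf) => y ys; apply: e'; rewrite inE mem_cat ys !orbT.
rewrite (@err_linear (x :: t ++ s))// mul1r.
apply: le_trans (ler_normD _ _) _.
rewrite (_ : h * e = h * (e / 2) + h * (e / 2)); last by field.
apply: lerD.
  by apply: H1 => //; exact: depends_on_slice.
by apply: H2 => //; exact: depends_on_slice.
Unshelve. all: by end_near. Qed.

End UniformExpansion.

(** * Polynomial upper bound on the hitting time *)

Section UpperBound.
Context {R : realType}.

Let w (x : site) : R := 2^-1 ^+ dist0 x.

Let w_neighbor x y : x \in neighbors y -> w x <= 2 * w y.
Proof.
move=> xy; have h := dist0_neighbor xy.
rewrite /w -(ler_pM2l (x := 2^-1)) ?invr_gt0// mulKf ?pnatr_eq0// -exprS.
by rewrite ler_wiXn2l ?invr_ge0// invf_le1// ler1n.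
Qed.

(** With n+1 = 4k the box has (8k+1)^2 <= 81 k^2 sites, while 2^(4k) >= k^4; so it is enough that 81
    |A| <= e k. *)
Lemma small_boundary (A e : R) n0 : 0 < e -> exists2 n, (n0 <= n)%N &
  ((n.+1.*2.+1 * n.+1.*2.+1)%N)%:R * (A * 2^-1 ^+ n.+1) <= e.
Proof.
move=> e0; pose m := maxn n0 (Num.truncn (81 * `|A| / e)).
have hm : 81 * `|A| <= e * m.+1%:R.
  have /andP[_ h] := truncn_itv (divr_ge0 (mulr_ge0 (ler0n R 81) (normr_ge0 A)) (ltW e0)).
  rewrite [leRHS]mulrC -ler_pdivrMr//; apply: le_trans (ltW h) _.
  by rewrite ler_nat ltnS leq_maxr.
exists (4 * m.+1).-1%N.
  have : (n0 <= m)%N by exact: leq_maxl.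
  lia.
rewrite prednK//; set k := m.+1 in hm *; set N := (_ * _)%N.
have k0 : (0 < k)%N by [].
have NE : (N <= 81 * (k * k))%N by rewrite /N; nia.
have pk : (k * (k * (k * k)) <= 2 ^ (4 * k))%N.
  have h := ltnW (ltn_expl k (isT : 1 < 2)%N).
  rewrite (_ : 2 ^ (4 * k) = 2 ^ k * (2 ^ k * (2 ^ k * 2 ^ k)))%N.
    by rewrite !leq_mul.
  by rewrite -!expnD; congr expn; lia.
have P0 : 0 < (2 ^ (4 * k))%:R :> R by rewrite ltr0n expn_gt0.
rewrite exprVn -natrX mulrA ler_pdivrMr//.
have h1 : N%:R * A <= 81 * `|A| * (k * k)%:R.
  apply: le_trans (_ : N%:R * `|A| <= _); first by rewrite ler_wpM2l// ler_norm.
  by rewrite mulrAC -natrM ler_wpM2r// ler_nat.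
apply: le_trans h1 _; apply: le_trans (_ : e * k%:R * (k * k)%:R <= _).
  by rewrite ler_wpM2r.
rewrite -mulrA -natrM; apply: ler_wpM2l; first exact: ltW.
rewrite ler_nat; apply: leq_trans pk.
by rewrite leq_pmull.
Qed.

(** A division-free form of (1-u)^n <= 1/(1+nu): decay of order 1/(nu) is all that its applications
    use. *)
Lemma pow_one_sub_le (u : R) n : 0 <= u <= 1 -> (1 - u) ^+ n * (1 + n%:R * u) <= 1.
Proof.
move=> /andP[u0 u1]; elim: n => [|n IH]; first by rewrite mul0r addr0 mul1r.
rewrite exprS; apply: (le_trans _ IH); rewrite [leLHS]mulrAC [leLHS]mulrC.
apply: ler_wpM2l; first by rewrite exprn_ge0// subr_ge0.
have n0 : 0 <= n%:R * u * u by rewrite !mulr_ge0.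
have := mulr_ge0 u0 u0; rewrite -natr1; nra.
Qed.

Lemma exp_balance (x : R) b : x != 0 ->
  x^-1 ^+ b.+1 * x^-1 ^+ b.+1 * x^-1 ^+ (2 * b) * x ^+ (4 * b + 3) = x.
Proof.
move=> x0; have -> : (4 * b + 3 = (b.+1 + b.+1 + 2 * b).+1)%N by lia.
by rewrite -2!exprD exprSr mulrA -exprMn mulVf// expr1n mul1r.
Qed.

Context d (T : measurableType d) (P : probability T R) (X : R -> T -> config).
Variables (omega : config) (q : R) (mu : probability config R).
Hypothesis hX : kcm_process P X omega q mu.
Hypothesis hmu : bernoulli_product (1 - q) mu.
Hypothesis q02 : 0 < q <= 2^-1.

Variables (B : nat -> seq site) (b : nat).
Hypothesis oB : origin \in B 0.
Hypothesis Bb : forall k, (size (B k) <= b)%N.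
Hypothesis uB : forall n, uniq (flatten [seq B k | k <- iota 0 n]).
Hypothesis linkB : forall k, links omega (B k) (B k.+1).
Hypothesis linkB' : forall k, links omega (B k.+1) (B k).

Let q01 : 0 < q < 1. Proof. by case/andP: q02 => -> h; apply: le_lt_trans h _; rewrite invf_lt1// ltr1n. Qed.
Let q0 : 0 < q. Proof. by case/andP: q01. Qed.
Let q01' : 0 <= q <= 1. Proof. by case/andP: q01 => *; rewrite !ltW. Qed.

(** Total time [t] forces an energy at most 1/t = q^(8b+7) at some step j <= N, and survival
    decreases in time, so it suffices to bound its mean at step [j] by [expect_block_chain]. *)
Lemma expect_survival_le n I d' N (t := q^-1 ^+ (8 * b + 7)) :
  {subset I <= box n.+1} -> 0 <= d' -> d' * (size I)%:R <= 1 -> d' * N.+1%:R = t ->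
  (forall k, (k <= Num.truncn (q^-1 ^+ b.+1))%N -> {subset B k <= I}) ->
  expect q (box n.+1) (survival q I (constraint omega) d' N) <= (1 + 24 * b%:R) * q.
Proof.
move=> IL d0 dI dN BI; set Lam := box n.+1.
have cself x eta y : constraint omega x (update eta x y) = constraint omega x eta.
  by rewrite constraint_update// neighbors_irrefl.
have [j jN hj] := survival_low_energy q01' IL cself d0 dI N.
set f := survival _ _ _ _ j in hj; set D := finite_dirichlet _ _ _ _ _ in hj.
apply: (@le_trans _ _ (expect q Lam f)).
  by apply: expect_le => // eta; exact: survival_le.
have qn k : 0 < q ^+ k by exact: exprn_gt0.
have t0 : 0 < t by rewrite exprn_gt0// invr_gt0.
have D1 : D <= q ^+ (8 * b + 7).
  rewrite dN in hj; rewrite -(ler_pM2l t0) (le_trans hj)// /t -exprMn mulVf ?gt_eqF//.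
  by rewrite expr1n.
(* This choice balances [expect_grad_le]: the energy is at most lam^2 q, so dividing it by q (1-q)
   lam leaves at most 2 lam, as 1-q >= 1/2. *)
pose lam := q ^+ (4 * b + 3); have lam0 : 0 < lam by exact: qn.
have M1 x : x \in I ->
    expect q Lam (fun eta => (constraint omega x eta)%:R * `|grad x f eta|) <= 3 * lam.
  move=> xI; apply: (le_trans (expect_grad_le Lam (constraint omega) f q01 lam0 xI)).
  rewrite (_ : 3 * lam = lam + 2 * lam); last by ring.
  rewrite lerD2l -/D -invfM mulrC ler_pdivrMr; last first.
    by rewrite !mulr_gt0// subr_gt0; case/andP: q01.
  apply: le_trans D1 _; rewrite (_ : q ^+ (8 * b + 7) = lam * lam * q); last first.
    by rewrite /lam -exprD -exprSr; congr (_ ^+ _); lia.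
  have h : 2^-1 <= 1 - q by case/andP: q02; lra.
  have h' : 0 <= lam * lam * q by rewrite ltW// !mulr_gt0.
  have := ler_wpM2l h' h; lra.
set K := Num.truncn _ in BI; pose nb := K.+1.
have /andP[K1 K2] : K%:R <= q^-1 ^+ b.+1 < nb%:R.
  by apply: truncn_itv; rewrite exprn_ge0// invr_ge0 ltW.
have qle : 0 < q <= 1 by case/andP: q01 => -> /ltW.
have lam3 : 0 <= 3 * lam by rewrite mulr_ge0// ltW.
have f01 eta : 0 <= f eta <= 1 by rewrite survival_ge0// survival_le1.
have f0 (eta : config) : eta origin = false -> f eta = 0 by exact: survival0E.
have BL k : (k < nb)%N -> {subset B k <= Lam} by move=> kn x /(BI k kn) /IL.
have hM k x : (k < nb)%N -> x \in B k ->
    expect q Lam (fun eta => (constraint omega x eta)%:R * `|grad x f eta|) <= 3 * lam.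
  by move=> kn /(BI k kn); exact: M1.
apply: le_trans (expect_block_chain qle f01 f0 oB BL Bb (uB nb) linkB linkB' lam3 hM) _.
set Q := q^-1 ^+ b.+1 in K1 K2.
have Q1 : 1 <= Q by rewrite exprn_ege1// invf_ge1//; case/andP: qle.
have nbQ : nb%:R <= 2 * Q by rewrite /nb -natr1; move: K1 Q1; lra.
rewrite [leRHS](_ : _ = q + 24 * b%:R * q); last by ring.
apply: lerD.
  (* No empty block: the number of blocks exceeds q^(-b-1), so it is at least 1/q after
     multiplication by q^b, and [pow_one_sub_le] gives [q]. *)
  have u01 : 0 <= q ^+ b <= 1 by rewrite exprn_ge0 ?exprn_ile1//; case/andP: q01'.
  have h := pow_one_sub_le nb u01.
  have p0 : 0 <= (1 - q ^+ b) ^+ nb by rewrite exprn_ge0// subr_ge0; case/andP: u01.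
  have hq : 1 <= q * (1 + nb%:R * q ^+ b).
    apply: (@le_trans _ _ (q * (Q * q ^+ b))).
      by rewrite /Q exprS -mulrA -exprMn mulVf ?gt_eqF// expr1n mulr1 mulfV ?gt_eqF.
    apply: ler_wpM2l; first exact: ltW.
    have := ltW (qn b); move: K2 => /ltW K2' hb; have := ler_wpM2r hb K2'.
    by move/le_trans; apply; rewrite lerDr.
  apply: (@le_trans _ _ ((1 - q ^+ b) ^+ nb * (q * (1 + nb%:R * q ^+ b)))).
    by rewrite ler_peMr.
  by rewrite mulrCA ler_piMr// ltW.
(* Cost of the walks: at most (2Q)^2 times 2b times 3 q^(-2b) lam, that is 24 b q. *)
have QE : Q * Q * q^-1 ^+ (2 * b) * lam = q by apply: exp_balance; rewrite gt_eqF.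
apply: (@le_trans _ _ (2 * Q * (2 * Q * ((2 * b)%:R * (q^-1 ^+ (2 * b) * (3 * lam)))))).
  have Z0 : 0 <= (2 * b)%:R * (q^-1 ^+ (2 * b) * (3 * lam)).
    by rewrite !mulr_ge0// ?exprn_ge0 ?invr_ge0// ltW.
  by apply: ler_pM => //; [exact: mulr_ge0|exact: ler_wpM2r].
rewrite natrM -[in leRHS]QE le_eqVlt; apply/orP; left; apply/eqP; ring.
Qed.
Lemma prob_tau0_ge_le :
  (P [set w | ((q^-1 ^+ (8 * b + 7))%:E <= tau0 X w)%E] <= ((1 + 24 * b%:R) * q)%:E)%E.
Proof.
set t := q^-1 ^+ _; have t0 : 0 < t by rewrite exprn_gt0// invr_gt0.
apply/lee_addgt0Pr => eps eps0; have [S [hS gS hPX]] := kcm_markov hX.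
(* One [e] pays for the short-time expansion and one for the boundary of the box; over the total
   time [t] the two add up to [eps]. *)
pose e := eps / (2 * t); have e0 : 0 < e by rewrite divr_gt0// mulr_gt0.
set K := Num.truncn (q^-1 ^+ b.+1).
pose n0 := \max_(x <- flatten [seq B k | k <- iota 0 K.+1]) dist0 x.
(* exp(8t) bounds (1 + 8 dl)^j as long as j dl <= t, whatever the step [dl]; so the box can be
   chosen before the step. Taking n >= n0 keeps the first blocks inside it. *)
have [n nn0 hn] := small_boundary (expR (8 * t)) n0 e0.
pose I := box n; pose Lam := box n.+1.
have IL : {subset I <= Lam} by move=> x; rewrite !mem_box => /leq_trans; apply.
have oL : origin \in Lam by rewrite mem_box.
have BI k : (k <= K)%N -> {subset B k <= I}.
  move=> kK x xB; rewrite mem_box; apply: leq_trans nn0.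
  apply: (@leq_bigmax_seq _ _ predT dist0) => //; apply/flattenP; exists (B k) => //.
  by apply/mapP; exists k => //; rewrite mem_iota.
have cL x : x \in I -> depends_on Lam (constraint omega x).
  move=> xI; apply: (depends_on_sub _ (depends_on_constraint omega (x := x))) => y xy.
  move: xI; rewrite !mem_box => /leq_trans - h.
  rewrite neighborsC in xy.
  by apply: leq_trans (dist0_neighbor xy) _; rewrite ltnS; exact: h.
have cself x eta y : constraint omega x (update eta x y) = constraint omega x eta.
  by rewrite constraint_update// neighbors_irrefl.
have [N [hN1 hN2]] : exists N : nat, t / N.+1%:R * (size I)%:R <= 1 /\
    forall f, depends_on Lam f -> (forall eta, `|f eta| <= 1) -> forall eta,
    `|S (t / N.+1%:R) f eta - (f eta + t / N.+1%:R * generator omega q f eta)|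
      <= t / N.+1%:R * e.
  have := generated_by_expand_uniform hS gS Lam e0.
  rewrite near_withinE => /nbhs_ballP[r /= r0 hr].
  pose r' := Num.min r (size I).+1%:R^-1.
  have r'0 : 0 < r' by rewrite lt_min r0 invr_gt0 ltr0n.
  have /andP[_ hN] := truncn_itv (divr_ge0 (ltW t0) (ltW r'0)).
  exists (Num.truncn (t / r')); set N1 := _.+1 in hN *.
  have hd : t / N1%:R < r' by rewrite ltr_pdivrMr// mulrC -ltr_pdivrMr.
  have d0 : 0 < t / N1%:R by rewrite divr_gt0.
  split.
    apply: (@le_trans _ _ ((size I).+1%:R^-1 * (size I).+1%:R)); last by rewrite mulVf.
    apply: ler_pM => //; rewrite ?ler_nat ?ltW//.
    by apply: lt_le_trans hd _; rewrite ge_min lexx orbT.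
  apply: hr => //; rewrite /ball /= sub0r normrN gtr0_norm//.
  by apply: lt_le_trans hd _; rewrite ge_min lexx.
set dl := t / N.+1%:R in hN1 hN2.
have dl0 : 0 < dl by rewrite divr_gt0.
have dlN : N.+1%:R * dl = t by rewrite mulrC divfK.
pose g := survival q I (constraint omega) dl.
have gL j : depends_on Lam (g j) by exact: depends_on_survival.
have g01 j eta : 0 <= g j eta <= 1.
  by rewrite (survival_ge0 _ q01' (ltW dl0) hN1) (survival_le1 _ q01' (ltW dl0) hN1).
have gradg j x eta : (j <= N)%N -> `|grad x (g j) eta| <= expR (8 * t) * w x.
  move=> jN; have w0 y : 0 <= w y by rewrite exprn_ge0// invr_ge0.
  have cr x' y' (eta' : config) b' : y' != x' -> x' \notin neighbors y' ->
    constraint omega x' (update eta' y' b') = constraint omega x' eta'.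
    by move=> _; exact: constraint_update.
  apply: le_trans (grad_survival q01' cself (ltW dl0) hN1 (box_uniq n) (lexx 1) w0 w_neighbor cr j x eta) _.
  rewrite ler_wpM2r//; apply: (@le_trans _ _ (expR (8 * dl) ^+ j)).
    by rewrite lerXn2r ?nnegrE ?expR_ge0 ?expR_ge1Dx// addr_ge0// mulr_ge0// ltW.
  rewrite -expRM_natl ler_expR -[leRHS]mulr1 -dlN.
  have : j%:R <= N.+1%:R :> R by rewrite ler_nat ltnW.
  by have := ltW dl0; nra.
have step j : (j < N)%N -> forall eta : config, eta origin ->
    S dl (g j) eta <= g j.+1 eta + dl * (2 * e).
  move=> jN eta eo.
  have := hN2 (g j) (gL j); have gn xi : `|g j xi| <= 1.
    by case/andP: (g01 j xi) => h0 h1; rewrite ger0_norm.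
  move=> /(_ gn eta); rewrite ler_distl => /andP[_ h].
  apply: le_trans h _; rewrite {2}/g /= /killed_step eo -!addrA lerD2l.
  rewrite -[survival _ _ _ _ j]/(g j).
  rewrite -!mulrDr; apply: ler_wpM2l; first exact: ltW.
  (* The process also updates the sites of [Lam] outside [I]. They lie at distance exactly n+1,
     where the gradient of [g j] is at most exp(8t) 2^(-n-1), and [hn] bounds their total by [e]. *)
  suff : generator omega q (g j) eta <= finite_generator q I (constraint omega) (g j) eta + e.
    by lra.
  rewrite (generatorE _ _ _ (box_uniq n.+1) (gL j)) /finite_generator.
  pose term x := (constraint omega x eta)%:R * (site_mean q x (g j) eta - g j eta).
  rewrite [leLHS](_ : _ = \sum_(x <- Lam) term x)//.
  rewrite [X in _ <= X + _](_ : _ = \sum_(x <- Lam | x \in I) term x); last first.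
    rewrite -[RHS]big_filter; apply: perm_big.
    apply: uniq_perm; [exact: box_uniq|by rewrite filter_uniq// box_uniq|].
    by move=> x; rewrite mem_filter andb_idr//; exact: IL.
  rewrite (bigID (mem I)) /= lerD2l.
  apply: le_trans hn; rewrite -size_box -/Lam.
  apply: le_trans (_ : \sum_(x <- Lam | x \notin I) expR (8 * t) * 2^-1 ^+ n.+1 <= _); last first.
    rewrite big_const_seq iter_addr_0 -(mulr_natl (expR (8 * t) * _)).
    rewrite ler_wpM2r ?mulr_ge0 ?expR_ge0 ?exprn_ge0 ?invr_ge0//.
    by rewrite ler_nat count_size.
  rewrite big_seq_cond [leRHS]big_seq_cond; apply: ler_sum => x /andP[xL xI].
  apply: le_trans (ler_norm _) _; rewrite /term normrM.
  apply: (@le_trans _ _ (1 * `|grad x (g j) eta|)).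
    apply: ler_pM => //; first by case: (constraint _ _ _); rewrite ?normr1 ?normr0.
    rewrite site_meanE normrM -[leRHS]mul1r; apply: ler_wpM2r => //.
    case/andP: q01' => h0 h1; case: ifP => _; first by rewrite normrN ger0_norm.
    by rewrite ger0_norm ?subr_ge0// gerBl.
  rewrite mul1r; apply: le_trans (gradg j x eta (ltnW jN)) _.
  rewrite /w (_ : dist0 x = n.+1)//; apply/eqP; move: xL xI.
  by rewrite !mem_box -ltnNge eqn_leq => -> ->.
have tg : [set w | (t%:E <= tau0 X w)%E] `<=` occupied_grid X dl N.+1.
  by rewrite -{1}dlN; exact: tau0_ge_sub_grid.
apply: (@le_trans _ _ (P (occupied_grid X dl N.+1))).
  rewrite le_measure ?inE//; first exact: (measurable_tau0_ge hX).
  by apply: (measurable_occupied_grid hX); exact: ltW.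
apply: (le_trans (prob_grid_le hX hmu hS hPX (ltW dl0) _ (box_uniq n.+1) gL g01 _ step)).
- by rewrite mulr_ge0// ltW.
- by move=> eta eo; rewrite /g /= eo.
rewrite -EFinD lee_fin lerD//.
  by apply: expect_survival_le => //; [exact: ltW|rewrite mulrC].
apply: (@le_trans _ _ (N.+1%:R * (dl * (2 * e)))).
  apply: ler_wpM2r; last by rewrite ler_nat.
  by rewrite mulr_ge0 ?(ltW dl0)// mulr_ge0// ltW.
rewrite mulrA dlN /e le_eqVlt; apply/orP; left; apply/eqP; field.
by rewrite gt_eqF.
Qed.

End UpperBound.

(** * Percolation of good bricks *)

Section Fillable.
Variables (omega : config) (B C : seq site).

(** Closure of [B] inside [C] under legal emptying: one reached neighbour suffices at a site of
    threshold 1, two at any site. *)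
Inductive reach : site -> Prop :=
| reach_base x : x \in B -> reach x
| reach_easy x y : x \in C -> omega x -> y \in neighbors x -> reach y -> reach x
| reach_two x y z : x \in C -> y \in neighbors x -> z \in neighbors x -> y != z ->
    reach y -> reach z -> reach x.

Lemma fills_rcons D s x : fills omega D (rcons s x) =
  fills omega D s && (threshold omega x <= count (mem (s ++ D)) (neighbors x))%N.
Proof.
elim: s D => [|y s IH] D /=; first by rewrite andbT.
have e : s ++ y :: D =i y :: s ++ D by move=> u; rewrite !(inE, mem_cat) orbCA.
rewrite IH andbA; congr (_ && (_ <= _)%N); apply: eq_count => z.
exact: e.
Qed.

(** Follow the derivation of a missing reached site down to a site whose premises all lie in
    [s ++ B]: that site can be emptied next. *)
Lemma reach_extend s : {subset s <= C} -> (exists2 x, reach x & x \notin s ++ B) ->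
  exists x, [/\ x \in C, x \notin s ++ B &
    (threshold omega x <= count (mem (s ++ B)) (neighbors x))%N].
Proof.
move=> sC [x rx]; elim: rx => [y yB|y z yC oy zy _ IH|y z1 z2 yC h1 h2 z12 _ IH1 _ IH2] yn.
- by rewrite mem_cat yB orbT in yn.
- have [zs|/IH//] := boolP (z \in s ++ B).
  exists y; split => //; rewrite /threshold oy -has_count.
  by apply/hasP; exists z.
- have [z1s|/IH1//] := boolP (z1 \in s ++ B).
  have [z2s|/IH2//] := boolP (z2 \in s ++ B).
  exists y; split => //; apply: (@leq_trans 2); first by rewrite /threshold; case: ifP.
  rewrite -size_filter; apply: (@uniq_leq_size _ [:: z1; z2]).
    by rewrite /= inE z12.
  by move=> z; rewrite !inE => /orP[] /eqP ->; rewrite mem_filter /= ?z1s ?z2s.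
Qed.

(** Greedy filling: as long as a site of [C] is missing the list can be extended by a new site of
    [C], so a failure would produce duplicate-free lists in [C] longer than [C]. *)
Lemma links_reach : (forall x, x \in C -> reach x) -> links omega B C.
Proof.
move=> hC; apply: contrapT => nl.
have H n : exists s, [/\ uniq s, {subset s <= C}, fills omega B s & size s = n].
  elim: n => [|n [s [us sC fs sn]]]; first by exists [::].
  have [x [xC xs tx]] : exists x, [/\ x \in C, x \notin s ++ B &
    (threshold omega x <= count (mem (s ++ B)) (neighbors x))%N].
    apply: reach_extend => //; apply: contrapT => h; apply: nl; exists s; split => //.
      exact: uniq_leq_size.
    by move=> x xC; apply: contrapT => /negP xs; apply: h; exists x => //; exact: hC.
  exists (rcons s x); split.
  - by rewrite rcons_uniq us andbT; apply: contra xs; rewrite mem_cat => ->.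
  - by move=> y; rewrite mem_rcons inE => /predU1P[->//|/sC].
  - by rewrite fills_rcons fs.
  - by rewrite size_rcons sn.
have [s [us sC _ sn]] := H (size C).+1.
by have := uniq_leq_size us sC; rewrite sn ltnn.
Qed.

(** Along a line [f] next to a reached line [g], one easy site is emptied from [g] alone. The
    emptying then spreads both ways, each next site having one neighbour on [f] and one on [g]. *)
Lemma reach_line (f g : nat -> site) l j0 : (j0 < l)%N -> omega (f j0) ->
  (forall j, (j < l)%N -> f j \in C /\ reach (g j)) ->
  (forall j, g j \in neighbors (f j)) ->
  (forall j, f j \in neighbors (f j.+1) /\ f j.+1 \in neighbors (f j)) ->
  (forall i j, f i != g j) -> forall j, (j < l)%N -> reach (f j).
Proof.
move=> j0l oj fC gf ff fg.
have r0 : reach (f j0) by apply: (reach_easy _ oj (gf j0)); have [] := fC _ j0l.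
have up k : (j0 + k < l)%N -> reach (f (j0 + k)%N).
  elim: k => [|k IH]; first by rewrite !addn0.
  rewrite !addnS => h.
  have [h1 h2] := fC _ h.
  by apply: (reach_two h1 (ff (j0 + k)%N).1 (gf _) (fg _ _) (IH (ltnW h)) h2).
have down k : (k <= j0)%N -> reach (f (j0 - k)%N).
  elim: k => [|k IH] h; first by rewrite subn0.
  have e : (j0 - k = (j0 - k.+1).+1)%N by lia.
  have [h1 h2] := fC (j0 - k.+1)%N ltac:(lia).
  apply: (reach_two h1 (ff _).2 (gf _) (fg _ _) _ h2).
  by rewrite -e; apply: IH; exact: ltnW.
move=> j jl; have [h|h] := leqP j0 j.
  by rewrite -(subnKC h); apply: up; rewrite subnKC.
by rewrite -(subKn (ltnW h)); apply: down; exact: leq_subr.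
Qed.

Lemma reach_strip (f : nat -> nat -> site) m l :
  (forall j, (j < l)%N -> reach (f 0%N j)) ->
  (forall i, (i < m)%N -> exists2 j, (j < l)%N & omega (f i.+1 j)) ->
  (forall i j, (i < m)%N -> (j < l)%N -> f i.+1 j \in C) ->
  (forall i j, f i j \in neighbors (f i.+1 j)) ->
  (forall i j, f i j \in neighbors (f i j.+1) /\ f i j.+1 \in neighbors (f i j)) ->
  (forall i j j', f i.+1 j != f i j') ->
  forall i j, (i <= m)%N -> (j < l)%N -> reach (f i j).
Proof.
move=> f0 easy fC v h ne; elim=> [|i IH] j im jl; first exact: f0.
have [j0 j0l oj] := easy i im.
by apply: (reach_line (g := f i) j0l oj) => // k kl; split; [exact: fC|apply: IH => //; exact: ltnW].
Qed.

End Fillable.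

(** * Good bricks and how they transmit emptiness *)

Section Bricks.
Variable l : nat.
Implicit Types (x k : int) (omega : config).

Definition brick_site x k (i j : nat) : site :=
  (x * l%:Z + i%:Z, (2 * k + x) * l%:Z + j%:Z).

(* Bricks are [l] wide and [2 l] high, and column [x + 1] is shifted up by half a brick, so
   that adjacent bricks share a half-side. *)
Definition brick x k : seq site :=
  [seq brick_site x k i j | i <- iota 0 l, j <- iota 0 (2 * l)%N].

(** Columns are cut in halves because an adjacent brick touches only half of a side. All lines thus
    have [l] sites. *)
Definition brick_lines x k : seq (seq site) :=
  [seq [seq brick_site x k i j | i <- iota 0 l] | j <- iota 0 (2 * l)%N] ++
  [seq [seq brick_site x k i (h * l + j)%N | j <- iota 0 l] | i <- iota 0 l, h <- iota 0 2].

Definition good_brick omega x k : bool := all (has omega) (brick_lines x k).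

Lemma mem_brick x k i j : (i < l)%N -> (j < 2 * l)%N -> brick_site x k i j \in brick x k.
Proof. by move=> il jl; apply/allpairsP; exists (i, j); rewrite !mem_iota. Qed.

Lemma good_row omega x k j : good_brick omega x k -> (j < 2 * l)%N ->
  exists2 i, (i < l)%N & omega (brick_site x k i j).
Proof.
move=> /allP g jl; have /g/hasP[y /mapP[i]] :
   [seq brick_site x k i j | i <- iota 0 l] \in brick_lines x k.
  by rewrite mem_cat; apply/orP; left; apply/mapP; exists j; rewrite ?mem_iota.
by rewrite mem_iota => /andP[_ il] -> o; exists i.
Qed.

Lemma good_half_column omega x k i h : good_brick omega x k -> (i < l)%N -> (h < 2)%N ->
  exists2 j, (j < l)%N & omega (brick_site x k i (h * l + j)%N).
Proof.
move=> /allP g il h2; have /g/hasP[y /mapP[j]] :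
   [seq brick_site x k i (h * l + j)%N | j <- iota 0 l] \in brick_lines x k.
  rewrite mem_cat; apply/orP; right; apply/allpairsP; exists (i, h).
  by rewrite !mem_iota.
by rewrite mem_iota => /andP[_ jl] -> o; exists j.
Qed.

Lemma mem_neighbors (a b : site) :
  (a \in neighbors b) = (`|a.1 - b.1| + `|a.2 - b.2| == 1%N)%N.
Proof.
case: a b => [a1 a2] [b1 b2]; rewrite !inE /= !xpair_eqE; lia.
Qed.

Lemma site_neq (a b : site) : (a != b) = (a.1 != b.1) || (a.2 != b.2).
Proof. by case: a b => [a1 a2] [b1 b2]; rewrite xpair_eqE negb_and. Qed.

Lemma size_brick x k : size (brick x k) = (l * (2 * l))%N.
Proof. by rewrite size_allpairs !size_iota. Qed.

Lemma brick_uniq x k : uniq (brick x k).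
Proof.
apply: allpairs_uniq; [exact: iota_uniq|exact: iota_uniq|].
move=> [i j] [i' j'] _ _ /= [] h1 h2; congr (_, _); lia.
Qed.

Lemma brick_lines_sub x k L : L \in brick_lines x k -> {subset L <= brick x k}.
Proof.
rewrite mem_cat => /orP[/mapP[j]|/allpairsP[[i h] /= [+ + ->]]].
  rewrite mem_iota => /andP[_ jl] -> y /mapP[i]; rewrite mem_iota => /andP[_ il] ->.
  exact: mem_brick.
rewrite !mem_iota !add0n /= => il h2 y /mapP[j].
rewrite mem_iota => /andP[_ jl] ->; apply: mem_brick => //.
by move: h2 jl; case: h => [|[|]]// _; rewrite ?mul0n ?mul1n; lia.
Qed.

Lemma brick_line_uniq x k L : L \in brick_lines x k -> uniq L /\ size L = l.
Proof.
rewrite mem_cat => /orP[/mapP[j _ ->]|/allpairsP[[i h] /= [_ _ ->]]];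
  (split; last by rewrite size_map size_iota); rewrite map_inj_uniq ?iota_uniq// => a b [].
- by move=> /addrI [].
- by move=> h1; lia.
Qed.

Lemma size_brick_lines x k : size (brick_lines x k) = (4 * l)%N.
Proof. by rewrite size_cat size_allpairs size_map !size_iota; lia. Qed.

Hypothesis l0 : (0 < l)%N.

(** From a reached half-side of the adjacent column, half [h] of the brick is filled by sweeping
    half-columns away from that side; rows, swept up or down from this half, then fill the other
    one. *)
Lemma brick_fill omega x k D h (c : int) : good_brick omega x k -> (h < 2)%N ->
  c = x * l%:Z - 1 \/ c = x * l%:Z + l%:Z ->
  (forall j, (j < l)%N -> reach omega D (brick x k) (c, (2 * k + x) * l%:Z + (h * l + j)%N%:Z)) ->
  forall y, y \in brick x k -> reach omega D (brick x k) y.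
Proof.
move=> g h2 hc side; pose r := (2 * k + x) * l%:Z.
have half i j : (i < l)%N -> (j < l)%N ->
    reach omega D (brick x k) (brick_site x k i (h * l + j)%N).
  case: hc => hc il jl.
  - have F := @reach_strip omega D (brick x k) (fun i j => (c + i%:Z, r + (h * l + j)%N%:Z)) l l.
    have -> : brick_site x k i (h * l + j)%N = (c + i.+1%:Z, r + (h * l + j)%N%:Z).
      by rewrite /brick_site -/r hc; congr (_, _); lia.
    apply: F => //.
    + by move=> j' j'l; rewrite addr0; exact: side.
    + move=> i' i'l; have [j' j'l o] := good_half_column g i'l h2; exists j' => //.
      by move: o; rewrite /brick_site -/r hc; congr (is_true (omega (_, _))); lia.
    + move=> i' j' i'l j'l; rewrite (_ : (_, _) = brick_site x k i' (h * l + j')%N).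
        by apply: mem_brick => //; nia.
      by rewrite /brick_site -/r hc; congr (_, _); lia.
    + by move=> i' j'; rewrite mem_neighbors /=; lia.
    + by move=> i' j'; rewrite !mem_neighbors /=; lia.
    + by move=> i' j' j''; rewrite site_neq /=; lia.
  - have F := @reach_strip omega D (brick x k) (fun i j => (c - i%:Z, r + (h * l + j)%N%:Z)) l l.
    have -> : brick_site x k i (h * l + j)%N = (c - (l - i)%N%:Z, r + (h * l + j)%N%:Z).
      by rewrite /brick_site -/r hc; congr (_, _); lia.
    apply: F => //; last exact: leq_subr.
    + by move=> j' j'l; rewrite subr0; exact: side.
    + move=> i' i'l.
      have [j' j'l o] := @good_half_column _ _ _ (l - i'.+1)%N _ g ltac:(lia) h2; exists j' => //.
      by move: o; rewrite /brick_site -/r hc; congr (is_true (omega (_, _))); lia.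
    + move=> i' j' i'l j'l; rewrite (_ : (_, _) = brick_site x k (l - i'.+1)%N (h * l + j')%N).
        by apply: mem_brick => //; nia.
      by rewrite /brick_site -/r hc; congr (_, _); lia.
    + by move=> i' j'; rewrite mem_neighbors /=; lia.
    + by move=> i' j'; rewrite !mem_neighbors /=; lia.
    + by move=> i' j' j''; rewrite site_neq /=; lia.
have all_rows i j : (i < l)%N -> (j < 2 * l)%N -> reach omega D (brick x k) (brick_site x k i j).
  move=> il jl; have [/eqP h0|h1] : h == 0%N \/ h = 1%N by case: (h) h2 => [|[|]]; auto.
  - have [jl'|lj] := ltnP j l; first by have := half i j il jl'; rewrite h0.
    (* Row l-1, the last one of the filled lower half, is the base of the upward sweep. *)
    have F := @reach_strip omega D (brick x k)
      (fun a b => brick_site x k b (l.-1 + a)%N) l l.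
    have -> : j = (l.-1 + (j - l.-1))%N by lia.
    apply: F => //; last by lia.
    + by move=> b bl; have := half b l.-1 bl ltac:(lia); rewrite h0 addn0.
    + by move=> a al; apply: good_row => //; lia.
    + by move=> a b al bl; apply: mem_brick => //; lia.
    + by move=> a b; rewrite mem_neighbors /=; lia.
    + by move=> a b; rewrite !mem_neighbors /=; lia.
    + by move=> a b b'; rewrite site_neq /=; lia.
  - have [jl'|lj] := leqP l j.
      have := half i (j - l)%N il ltac:(lia); rewrite h1 mul1n subnKC//.
    have F := @reach_strip omega D (brick x k)
      (fun a b => (x * l%:Z + b%:Z, r + l%:Z - a%:Z)) l l.
    have -> : brick_site x k i j = (x * l%:Z + i%:Z, r + l%:Z - (l - j)%N%:Z).
      by rewrite /brick_site -/r; congr (_, _); lia.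
    have E a b : (a < l)%N ->
        (x * l%:Z + b%:Z, r + l%:Z - a.+1%:Z) = brick_site x k b (l - a.+1)%N.
      by move=> al; rewrite /brick_site -/r; congr (_, _); lia.
    apply: F => //; last exact: leq_subr.
    + move=> b bl; have := half b 0%N bl l0; rewrite h1 /brick_site -/r mul1n addn0 subr0//.
    + move=> a al; have [b bl o] := @good_row _ _ _ (l - a.+1)%N g ltac:(lia).
      by exists b => //; rewrite E.
    + by move=> a b al bl; rewrite E//; apply: mem_brick => //; lia.
    + by move=> a b; rewrite mem_neighbors /=; lia.
    + by move=> a b; rewrite !mem_neighbors /=; lia.
    + by move=> a b b'; rewrite site_neq /=; lia.
by move=> y /allpairsP[[i j] /= [+ + ->]]; rewrite !mem_iota /= add0n => il jl; exact: all_rows.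
Qed.

(** Column [x + 1] is shifted by half a brick: for k' = k its lower half faces the upper half of
    brick (x, k), for k' = k - 1 its upper half faces the lower half. *)
Lemma links_brick omega x k k' : k' = k \/ k' = k - 1 -> good_brick omega x k ->
  good_brick omega (x + 1) k' ->
  links omega (brick x k) (brick (x + 1) k') /\ links omega (brick (x + 1) k') (brick x k).
Proof.
move=> hk g g'; split; apply: links_reach => y yb.
- case: hk => hk; [apply: (brick_fill (h := 0) g' _ (or_introl erefl) _ yb) => // j jl
                  |apply: (brick_fill (h := 1) g' _ (or_introl erefl) _ yb) => // j jl];
    apply: reach_base.
  + rewrite (_ : (_, _) = brick_site x k l.-1 (l + j)%N); first by apply: mem_brick; lia.
    by rewrite /brick_site hk; congr (_, _); lia.
  + rewrite (_ : (_, _) = brick_site x k l.-1 j); first by apply: mem_brick; lia.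
    by rewrite /brick_site hk; congr (_, _); lia.
- case: hk => hk; [apply: (brick_fill (h := 1) g _ (or_intror erefl) _ yb) => // j jl
                  |apply: (brick_fill (h := 0) g _ (or_intror erefl) _ yb) => // j jl];
    apply: reach_base.
  + rewrite (_ : (_, _) = brick_site (x + 1) k' 0 j); first by apply: mem_brick; lia.
    by rewrite /brick_site hk; congr (_, _); lia.
  + rewrite (_ : (_, _) = brick_site (x + 1) k' 0 (l + j)%N); first by apply: mem_brick; lia.
    by rewrite /brick_site hk; congr (_, _); lia.
Qed.

Lemma brick_disjoint x k x' k' y : y \in brick x k -> y \in brick x' k' -> (x, k) = (x', k').
Proof.
move=> /allpairsP[[i j] /= [+ + ->]] /allpairsP[[i' j'] /= [+ + []]].
rewrite !mem_iota /= !add0n => il jl il' jl' h1 h2.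
have xx : x = x' by nia.
by rewrite xx in h2 *; congr (_, _); nia.
Qed.

End Bricks.

(** * Lipschitz percolation and the probability of bad bricks *)

Section Percolation.
Variable l : nat.
Implicit Types (omega : config) (a b : int * int).

(** Dual paths of Lipschitz percolation: a descent through a bad brick lowers [height] by 2, and the
    two unconditional steps raise it by 1, so reaching negative height takes many bad bricks. *)
Definition backward_step omega a b : bool :=
  [|| ~~ good_brick l omega a.1 a.2 && (b == (a.1, a.2 - 1)),
      b == (a.1 - 1, a.2 + 1) | b == (a.1 + 1, a.2)].

(** Ordinate of the bottom row of the brick, in units of [l]. *)
Definition height a : int := 2 * a.2 + a.1.

Definition hit omega a : Prop :=
  exists2 p, path (backward_step omega) a p & height (last a p) < 0.

Lemma hit_step omega a b : backward_step omega a b -> hit omega b -> hit omega a.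
Proof. by move=> ab [p bp hp]; exists (b :: p) => //=; rewrite ab. Qed.

Lemma hit_ground omega a : height a < 0 -> hit omega a.
Proof. by move=> h; exists [::]. Qed.

(* [- F n] is the least height at which column [n] is not hit: minimality makes that brick
   good, and the two unconditional steps make [F] Lipschitz. *)
Lemma surface omega : ~ hit omega (0, 0) ->
  exists F : nat -> nat, [/\ F 0%N = 0%N,
    forall n, good_brick l omega n%:Z (- (F n)%:Z) &
    forall n, F n.+1 = F n \/ F n.+1 = (F n).+1].
Proof.
move=> nh; have n0 n : ~ hit omega (n%:Z, 0).
  elim: n => [//|n IH] h; apply: IH; apply: hit_step h.
  by rewrite /backward_step /= -addn1 PoszD eqxx !orbT.
pose Q n m := `[< ~ hit omega (n%:Z, - m%:Z) >].
have exQ n : exists m, Q n m by exists 0%N; apply/asboolP; rewrite oppr0; exact: n0.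
(* The point (n, -m) has height n - 2m, which is negative for m > n; hence a greatest unhit depth
   exists, and it is 0 in column 0. *)
have bQ n m : Q n m -> (m <= n)%N.
  move/asboolP => h; rewrite leqNgt; apply/negP => nm; apply: h; apply: hit_ground.
  by rewrite /height /=; lia.
pose F n := ex_maxn (exQ n) (bQ n); exists F.
have FQ n : ~ hit omega (n%:Z, - (F n)%:Z).
  by rewrite /F; case: ex_maxnP => m /asboolP.
have Fmax n m : ~ hit omega (n%:Z, - m%:Z) -> (m <= F n)%N.
  by move=> h; rewrite /F; case: ex_maxnP => k _; apply; apply/asboolP.
split.
- by have := bQ 0%N (F 0%N); rewrite leqn0 => h; apply/eqP/h/asboolP/FQ.
- move=> n; apply: contrapT => /negP bad.
  suff : ((F n).+1 <= F n)%N by rewrite ltnn.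
  apply: Fmax => h; apply: (FQ n); apply: hit_step h.
  rewrite /backward_step /= bad /=; apply/orP; left; apply/eqP; congr (_, _); lia.
- move=> n; have h1 : (F n <= F n.+1)%N.
    apply: Fmax => h; apply: (FQ n); apply: hit_step h.
    by rewrite /backward_step /= -addn1 PoszD eqxx !orbT.
  suff h2 : (F n.+1 <= (F n).+1)%N by lia.
  case e : (F n.+1) => [//|m]; rewrite ltnS; apply: Fmax => h.
  apply: (FQ n.+1); apply: hit_step h.
  rewrite /backward_step /= e; apply/orP; right; apply/orP; left; apply/eqP.
  congr (_, _); lia.
Qed.

Lemma good_blocks omega : (0 < l)%N -> ~ hit omega (0, 0) ->
  exists B : nat -> seq site, [/\ origin \in B 0%N,
    forall k, (size (B k) <= l * (2 * l))%N,
    forall n, uniq (flatten [seq B k | k <- iota 0 n]) &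
    forall k, links omega (B k) (B k.+1) /\ links omega (B k.+1) (B k)].
Proof.
move=> l0 /surface[F [F0 gF FF]]; exists (fun n => brick l n%:Z (- (F n)%:Z)); split.
- rewrite F0 oppr0 (_ : origin = brick_site l 0 0 0 0); first by apply: mem_brick; lia.
  by rewrite /brick_site /origin; congr (_, _); lia.
- by move=> k; rewrite size_brick.
- move=> n; have : forall i m, uniq (flatten [seq brick l k%:Z (- (F k)%:Z) | k <- iota i m]).
    move=> i m; elim: m i => //= m IH i; rewrite cat_uniq brick_uniq// IH andbT /=.
    apply/hasPn => y /flattenP[C /mapP[j]]; rewrite mem_iota => /andP[ij _] -> yj.
    apply/negP => yi; have [] := brick_disjoint l0 yi yj.
    lia.
  exact.
- move=> k; rewrite -addn1 PoszD; apply: (links_brick l0) => //.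
    by rewrite addn1; case: (FF k) => ->; [left|right; lia].
  by have := gF (k + 1)%N; rewrite PoszD.
Qed.

(* [move] ignores the environment: a word determines a path, and the path is admissible as
   soon as the bricks it descends from are bad. *)
Definition move a (i : 'I_3) : int * int :=
  match val i with 0%N => (a.1, a.2 - 1) | 1%N => (a.1 - 1, a.2 + 1) | _ => (a.1 + 1, a.2) end.

Fixpoint descents a (w : seq 'I_3) : seq (int * int) :=
  if w is i :: w' then
    if val i == 0%N then a :: descents (move a i) w' else descents (move a i) w'
  else [::].

Lemma path_word omega a p : path (backward_step omega) a p ->
  exists w, [/\ all (fun a => ~~ good_brick l omega a.1 a.2) (descents a w),
    subseq (descents a w) (a :: p) &
    height (last a p) = height a + (size w)%:Z - 3 * (size (descents a w))%:Z].
Proof.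
elim: p a => [|b p IH] a /=; first by move=> _; exists [::]; split => //=; lia.
move=> /andP[ab /IH[w [w1 w2 w3]]].
have step (i : 'I_3) : b = move a i -> (val i == 0%N -> ~~ good_brick l omega a.1 a.2) ->
    height b = height a + 1 - 3 * (val i == 0%N)%:Z ->
  exists w, [/\ all (fun a => ~~ good_brick l omega a.1 a.2) (descents a w),
    subseq (descents a w) [:: a, b & p] &
    height (last b p) = height a + (size w)%:Z - 3 * (size (descents a w))%:Z].
  move=> bi gi hi; exists (i :: w) => /=; rewrite -bi w3 hi.
  case: ifP gi => i0 gi; split.
  - by rewrite /= w1 gi.
  - by rewrite eqxx.
  - by rewrite /=; lia.
  - exact: w1.
  - exact: subseq_trans w2 (subseq_cons _ _).
  - lia.
case/or3P: ab => [/andP[bad]||] /eqP e.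
- have h : height b = height a + 1 - 3 by rewrite e /height /=; lia.
  by apply: (step ord0).
- have h : height b = height a + 1 by rewrite e /height /=; lia.
  have v : val (inord 1 : 'I_3) = 1%N by rewrite /= inordK.
  by apply: (step (inord 1)); rewrite ?/move v // h mulr0 subr0.
- have h : height b = height a + 1 by rewrite e /height /=; lia.
  have v : val (inord 2 : 'I_3) = 2%N by rewrite /= inordK.
  by apply: (step (inord 2)); rewrite ?/move v // h mulr0 subr0.
Qed.

(** Loops are removed first, so that the bricks descended from are distinct and their states
    independent. Ending at a negative height forces 3 #descents > #steps. *)
Lemma hit_word omega : hit omega origin -> exists w, [/\ (0 < size w)%N,
  uniq (descents origin w), (size w <= 3 * size (descents origin w))%N &
  all (fun a => ~~ good_brick l omega a.1 a.2) (descents origin w)].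
Proof.
move=> [p pp]; case/shortenP: pp => p' pp' up' _ hp.
have [w [w1 w2 w3]] := path_word pp'.
move: hp; rewrite w3 => hp; exists w; split => //.
- by case: (w) hp => //=; rewrite /height /origin /=.
- exact: subseq_uniq w2 up'.
- by move: hp; rewrite /height /origin /=; lia.
Qed.

Context {R : realType}.
Variables (p : R) (nu : probability config R).
Hypothesis hnu : bernoulli_product p nu.

Lemma measure_bigsetU_le (I : eqType) (s : seq I) (A : I -> set config) (C : R) :
  (forall i, measurable (A i)) -> (forall i, i \in s -> (nu (A i) <= C%:E)%E) ->
  (nu (\big[setU/set0]_(i <- s) A i) <= ((size s)%:R * C)%:E)%E.
Proof.
move=> mA; elim: s => [|i s IH] hA; first by rewrite big_nil measure0 mul0r.
rewrite big_cons /= -natr1 mulrDl mul1r addrC EFinD.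
apply: le_trans (measureU2 _ _ _) _ => //; first exact: bigsetU_measurable.
apply: leeD; first by apply: hA; rewrite mem_head.
by apply: IH => j js; apply: hA; rewrite inE js orbT.
Qed.

Lemma depends_on_good_brick x k : depends_on (brick l x k) (fun omega => good_brick l omega x k).
Proof.
move=> eta xi e; apply: eq_in_all => L hL; apply: eq_in_has => y yL.
by apply: e; exact: (brick_lines_sub hL yL).
Qed.

(** A bad brick has one of its 4l lines entirely hard. Union bound over this line, brick by brick:
    the list [t] accumulates the sites already required to be hard, and disjointness of bricks keeps
    it free of repetitions. *)
Lemma prob_all_bad (u : seq (int * int)) (t : seq site) : (0 < l)%N ->
  uniq u -> uniq t -> (forall a, a \in u -> forall y, y \in brick l a.1 a.2 -> y \notin t) ->
  (nu [set omega | all (fun a => ~~ good_brick l omega a.1 a.2) u /\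
                   forall x, x \in t -> omega x = false] <=
   ((4 * l)%:R ^+ size u * (1 - p) ^+ (l * size u + size t))%:E)%E.
Proof.
move=> l0; elim: u t => [|a u IH] t /=.
  move=> _ ut _; rewrite (_ : [set _ | _] = [set eta | forall x, x \in t -> eta x = false]).
    rewrite (hnu (fun=> false) ut) muln0 expr0 mul1r lee_fin big_const_seq count_predT.
    by rewrite -Monoid.iteropE.
  by apply/seteqP; split => omega /=; [case|].
move=> /andP[au uu] ut dis.
pose A L : set config := [set omega | all (fun a => ~~ good_brick l omega a.1 a.2) u /\
    forall x, x \in L ++ t -> omega x = false].
have mA L : measurable (A L).
  apply: (@measurable_depends_on (flatten [seq brick l b.1 b.2 | b <- u] ++ (L ++ t))) => eta xi e.
  rewrite /A /=; congr (_ /\ _).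
    congr is_true; apply: eq_in_all => b bu; congr (~~ _).
    apply: depends_on_good_brick => y yb; apply: e; rewrite mem_cat; apply/orP; left.
    by apply/flattenP; exists (brick l b.1 b.2) => //; apply/mapP; exists b.
  by apply/propext; split=> h x xL; [rewrite -e|rewrite e]; rewrite ?h// mem_cat xL orbT.
have mS : measurable ([set omega | (~~ good_brick l omega a.1 a.2) &&
    all (fun a => ~~ good_brick l omega a.1 a.2) u /\
    forall x, x \in t -> omega x = false] : set config).
  apply: (@measurable_depends_on (brick l a.1 a.2 ++
     (flatten [seq brick l b.1 b.2 | b <- u] ++ t))) => eta xi e /=; congr (_ /\ _).
    congr is_true; congr (~~ _ && _).
      by apply: depends_on_good_brick => y yb; apply: e; rewrite mem_cat yb.
    apply: eq_in_all => b bu; congr (~~ _).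
    apply: depends_on_good_brick => y yb; apply: e; rewrite !mem_cat; apply/orP; right.
    apply/orP; left.
    by apply/flattenP; exists (brick l b.1 b.2) => //; apply/mapP; exists b.
  by apply/propext; split=> h x xL; [rewrite -e|rewrite e]; rewrite ?h// !mem_cat xL !orbT.
apply: (@le_trans _ _ (nu (\big[setU/set0]_(L <- brick_lines l a.1 a.2) A L))).
  apply: le_measure; rewrite ?inE//; first exact: bigsetU_measurable.
  move=> omega /= [/andP[/allPn[L hL /hasPn nL] hu] ht].
  rewrite -bigcup_seq; exists L => //; split => // x; rewrite mem_cat => /orP[/nL/negbTE//|].
  exact: ht.
have -> : (4 * l)%:R ^+ (size u).+1 * (1 - p) ^+ (l * (size u).+1 + size t) =
   (size (brick_lines l a.1 a.2))%:R *
   ((4 * l)%:R ^+ size u * (1 - p) ^+ (l * size u + (l + size t))) :> R.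
  by rewrite size_brick_lines exprS -mulrA; congr (_ * (_ * _ ^+ _)); lia.
apply: measure_bigsetU_le => // L hL; have [uL sL] := brick_line_uniq hL.
rewrite -{3}sL -size_cat; apply: IH => //.
  rewrite cat_uniq uL ut andbT /=; apply/hasPn => y yt; apply/negP => yL.
  have := dis a (mem_head _ _) y (brick_lines_sub hL yL); by rewrite yt.
move=> b bu y yb; rewrite mem_cat negb_or (dis b _ y yb) ?inE ?bu ?orbT// andbT.
apply/negP => yL; have := brick_disjoint l0 (brick_lines_sub hL yL) yb.
by move: au bu; case: a {dis A mA mS hL uL sL yL} => [a1 a2]; case: b {yb} => [b1 b2] /= au bu e; move: au; rewrite e bu.
Qed.

End Percolation.

(** * Almost sure existence of an infinite path of good bricks *)

Section AlmostSure.
Context {R : realType}.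

Lemma negligible_small d (T : measurableType d) (m : {measure set T -> \bar R}) (A : set T) :
  (forall e : R, 0 < e -> exists M, [/\ measurable M, A `<=` M & (m M <= e%:E)%E]) ->
  m.-negligible A.
Proof.
move=> h; have hn (n : nat) : {M : set T | [/\ measurable M, A `<=` M & (m M <= (n.+1%:R^-1)%:E)%E]}.
  by apply/cid/h; rewrite invr_gt0 ltr0n.
pose M n := sval (hn n); exists (\bigcap_n M n); split.
- by apply: bigcap_measurableType => n _; have [] := svalP (hn n).
- apply/eqP; rewrite eq_le measure_ge0 andbT; apply/lee_addgt0Pr => e e0.
  rewrite add0e; have /andP[_ he] := truncn_itv (ltW (divr_gt0 (@ltr01 R) e0)).
  set n := Num.truncn _ in he.
  apply: (@le_trans _ _ (m (M n))).
    apply: le_measure; rewrite ?inE.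
    - by apply: bigcap_measurableType => k _; have [] := svalP (hn k).
    - by have [] := svalP (hn n).
    - by apply: bigcap_inf.
  have [_ _ h'] := svalP (hn n); apply: le_trans h' _.
  rewrite lee_fin -[leRHS]invrK lef_pV2 ?posrE ?invr_gt0 ?ltr0n//.
  by rewrite -div1r ltW.
- by move=> x Ax n _; have [_ AM _] := svalP (hn n); exact: AM.
Qed.

Variables (p : R) (nu : probability config R).
Hypothesis p01 : 0 < p < 1.
Hypothesis hnu : bernoulli_product p nu.

Let p0 : 0 < p. Proof. by case/andP: p01. Qed.
Let p1 : 0 < 1 - p. Proof. by move: p01; rewrite subr_gt0 => /andP[]. Qed.

(** Take l = 2m. Since (1-p)^m <= 1/(mp), used twice, the left side is at most 8/(m p^2). *)
Lemma line_length (r : R) : 0 < r -> exists2 l, (0 < l)%N & (4 * l)%:R * (1 - p) ^+ l <= r.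
Proof.
move=> r0; pose m := (Num.truncn (8 / (p ^+ 2 * r))).+1.
have pr : 0 < p ^+ 2 * r by rewrite mulr_gt0// exprn_gt0.
have hm : 8 <= m%:R * (p ^+ 2 * r).
  have /andP[_ h] := truncn_itv (ltW (divr_gt0 (ltr0n R 8 : 0 < 8%:R) pr)).
  by rewrite -ler_pdivrMr// ltW.
have m0 : 0 < m%:R :> R by rewrite ltr0n.
exists (m + m)%N; first by rewrite addn_gt0.
have h := @pow_one_sub_le R p m; set s := (1 - p) ^+ m in h.
have s0 : 0 <= s by rewrite exprn_ge0// ltW.
have hs : s * (m%:R * p) <= 1.
  apply: le_trans (h _); last by case/andP: p01 => ? ?; rewrite !ltW.
  by rewrite ler_wpM2l// lerDr.
rewrite exprD -/s natrM natrD.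
have sm : (s * (m%:R * p)) * (s * (m%:R * p)) <= 1.
  rewrite -[leRHS]mulr1; apply: ler_pM => //; rewrite !mulr_ge0// ltW//.
rewrite -(ler_pM2r (_ : 0 < m%:R * p ^+ 2)); last by rewrite mulr_gt0// exprn_gt0.
have -> : 4 * (m%:R + m%:R) * (s * s) * (m%:R * p ^+ 2) =
  8 * (s * (m%:R * p) * (s * (m%:R * p))) by ring.
apply: (@le_trans _ _ 8); first by rewrite -[leRHS]mulr1 ler_wpM2l.
by apply: le_trans hm _; rewrite le_eqVlt; apply/orP; left; apply/eqP; ring.
Qed.

Lemma geometric_sum_le (x : R) n : 0 <= x <= 2^-1 -> \sum_(k < n) x ^+ k.+1 <= 2 * x.
Proof.
move=> /andP[x0 x2]; suff : \sum_(k < n) x ^+ k.+1 <= 2 * x - 2 * x ^+ n.+1.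
  by move/le_trans; apply; rewrite gerBl mulr_ge0// exprn_ge0.
elim: n => [|n IH]; first by rewrite big_ord0 expr1 subrr.
rewrite big_ord_recr /= (exprS _ n.+1).
have y0 : 0 <= x ^+ n.+1 by rewrite exprn_ge0.
move: (x ^+ n.+1) y0 IH => y y0 IH; nra.
Qed.

(** Peierls argument: there are 3^n words of length [n], and each is admissible with probability at
    most r^n. *)
Lemma prob_hit_small (e : R) : 0 < e -> exists2 l, (0 < l)%N &
  exists M : set config, [/\ measurable M,
    [set omega | hit l omega origin] `<=` M & (nu M <= e%:E)%E].
Proof.
(* The ratio 3r is at most 1/2, so the geometric sum is at most 6r, hence at most [e]. *)
move=> e0; pose r := Num.min 6^-1 (e / 6); have r0 : 0 < r.
  by rewrite lt_min invr_gt0 ltr0n divr_gt0.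
have r6 : r <= 6^-1 by rewrite ge_min lexx.
have re : r <= e / 6 by rewrite ge_min lexx orbT.
have r1 : r <= 1 by lra.
(* The cube is there because only a third of the steps are guaranteed to be descents: r^3 per bad
   brick amounts to [r] per step. *)
have [l l0 hl] := line_length (exprn_gt0 3 r0); exists l => //.
pose ok (w : seq 'I_3) := uniq (descents origin w) && (size w <= 3 * size (descents origin w))%N.
pose W w : set config := if ok w then
  [set omega | all (fun a => ~~ good_brick l omega a.1 a.2) (descents origin w)] else set0.
have mW w : measurable (W w).
  rewrite /W; case: ifP => // _.
  apply: (@measurable_depends_on (flatten [seq brick l b.1 b.2 | b <- descents origin w])).
  move=> eta xi e' /=; congr is_true; apply: eq_in_all => b bu; congr (~~ _).
  apply: depends_on_good_brick => y yb; apply: e'.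
  by apply/flattenP; exists (brick l b.1 b.2) => //; apply/mapP; exists b.
have pW w : (nu (W w) <= (r ^+ size w)%:E)%E.
  rewrite /W; case: ifP => [/andP[uw sw]|_]; last by rewrite measure0 lee_fin exprn_ge0// ltW.
  have := @prob_all_bad l R p nu hnu _ [::] l0 uw isT (fun _ _ _ _ => isT).
  set S := [set _ | _ /\ _]; rewrite (_ : S = [set omega |
      all (fun a => ~~ good_brick l omega a.1 a.2) (descents origin w)]); last first.
    by apply/seteqP; split => omega /=; [case|move=> h; split].
  move=> h; apply: le_trans h _.
  rewrite addn0 exprM -exprMn lee_fin.
  apply: (@le_trans _ _ ((r ^+ 3) ^+ size (descents origin w))).
    by rewrite lerXn2r// nnegrE ?mulr_ge0 ?exprn_ge0// ltW.
  by rewrite -exprM ler_wiXn2l// ltW.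
pose words n := [seq tval w | w <- enum {: n.-tuple 'I_3}].
pose V n := \big[setU/set0]_(w <- words n) W w.
have mV n : measurable (V n) by exact: bigsetU_measurable.
have pV n : (nu (V n) <= ((3 * r) ^+ n)%:E)%E.
  rewrite exprMn -natrX (_ : (3 ^ n)%N = size (words n)); last first.
    by rewrite size_map -cardE card_tuple card_ord.
  apply: measure_bigsetU_le => // w /mapP[t _ ->].
  by apply: le_trans (pW _) _; rewrite size_tuple.
pose U N := \big[setU/set0]_(n < N) V n.+1.
have mU N : measurable (U N) by exact: bigsetU_measurable.
have pU N : (nu (U N) <= e%:E)%E.
  apply: (@le_trans _ _ (\sum_(n < N) (3 * r) ^+ n.+1)%:E); last first.
    rewrite lee_fin; apply: le_trans (geometric_sum_le _ _) _; last by lra.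
    by apply/andP; split; lra.
  elim: N => [|N IH]; first by rewrite /U !big_ord0 measure0.
  rewrite /U !big_ord_recr EFinD; apply: le_trans (measureU2 _ _ _) _ => //=.
    exact: mU.
  by apply: leeD.
exists (\bigcup_N U N); split; first exact: bigcupT_measurable.
- move=> omega /= /hit_word[w [w0 uw sw bw]]; exists (size w) => //.
  rewrite /U -(prednK w0) big_ord_recr /= prednK//; right.
  rewrite /V -bigcup_seq; exists w.
    by apply/mapP; exists (in_tuple w) => //; rewrite mem_enum.
  by rewrite /W /ok uw sw.
- have UU : {homo U : n m / (n <= m)%N >-> (n <= m)%O}.
    by apply/nondecreasing_seqP => n; apply/subsetPset; rewrite /U big_ord_recr; left.
  have cU := @nondecreasing_cvg_mu _ _ _ nu _ mU (bigcupT_measurable _ mU) UU.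
  rewrite -(cvg_lim _ cU)//; apply: lime_le; first by apply/cvg_ex; exists (nu (\bigcup_N U N)).
  by apply: nearW => N; exact: pU.
Qed.

(** For a fixed brick size the path exists only with probability close to 1. Environments without a
    path for any size lie in the hitting event of every size, hence are negligible; the size bound
    [b] is therefore random. *)
Lemma ae_good_blocks : \forall omega \ae nu, exists (b : nat) (B : nat -> seq site),
  [/\ origin \in B 0%N, forall k, (size (B k) <= b)%N,
    forall n, uniq (flatten [seq B k | k <- iota 0 n]) &
    forall k, links omega (B k) (B k.+1) /\ links omega (B k.+1) (B k)].
Proof.
apply: negligible_small => e /prob_hit_small[l l0 [M [mM hM nM]]].
exists M; split => // omega; apply: contra_notP => nMo.
have [|B hB] := @good_blocks l omega l0; first by move=> h; apply: nMo; exact: hM.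
by exists (l * (2 * l))%N, B.
Qed.

End AlmostSure.

(** * Blocked sets in boxes of hard sites *)

Section BlockedSets.
Variables (z : site) (k : nat).
Implicit Types (x y u : site) (eta : config) (c : bool * bool).

Definition zbox : seq site := [seq (z.1 + y.1, z.2 + y.2) | y <- box k].

Lemma mem_zbox y : (y \in zbox) = (`|y.1 - z.1| <= k)%N && (`|y.2 - z.2| <= k)%N.
Proof.
apply/mapP/idP => [[[a b]]|].
  by rewrite mem_box /dist0 /= geq_max => /andP[h1 h2] -> /=; lia.
move=> h; exists (y.1 - z.1, y.2 - z.2).
  by rewrite mem_box /dist0 /= geq_max.
by case: y {h} => a b /=; congr (_, _); lia.
Qed.

Lemma zbox_uniq : uniq zbox.
Proof.
rewrite map_inj_uniq ?box_uniq// => -[a b] [a' b'] /= [] h1 h2; congr (_, _); lia.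
Qed.

Lemma size_zbox : size zbox = (k.*2.+1 * k.*2.+1)%N.
Proof. by rewrite size_map size_box. Qed.

(** Only neighbours inside the box are counted, nothing being known of the outside. Interior hard
    sites of [S] are then frozen, and [S] can be attacked through the boundary of the box alone. *)
Definition blocked (S : site -> bool) eta : Prop :=
  [/\ S z, forall y, S y -> y \in zbox, forall y, S y -> eta y = true &
      forall y, S y -> (count (fun u => (u \in zbox) && ~~ S u) (neighbors y) <= 1)%N].

Definition frozen eta : bool := `[< exists S, blocked S eta >].

Lemma depends_on_frozen : depends_on zbox frozen.
Proof.
move=> eta xi e; apply/asboolP/asboolP => -[S [h1 h2 h3 h4]]; exists S; split => // y Sy.
  by rewrite -e ?h3// h2.
by rewrite e ?h3// h2.
Qed.

Lemma blocked_update S eta x (b : bool) : blocked S eta -> (S x -> b) -> blocked S (update eta x b).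
Proof.
move=> [h1 h2 h3 h4] hb; split => // y Sy; rewrite /update; case: eqP => [yx|_]; last exact: h3.
by apply: hb; rewrite -yx.
Qed.

Lemma frozen_true eta x : frozen (update eta x false) -> frozen (update eta x true).
Proof.
move=> /asboolP[S hS]; apply/asboolP; exists S.
by rewrite -(update_update eta x false); apply: blocked_update.
Qed.

(** A hard site allowed to flip has two empty neighbours, both in the box and outside [S]; so it
    cannot belong to [S], and its value is irrelevant to [S]. *)
Lemma frozen_interior omega eta x b : (forall u, u \in neighbors x -> u \in zbox) ->
  omega x = false -> constraint omega x eta -> frozen eta -> frozen (update eta x b).
Proof.
move=> xi ox cx /asboolP[S hS]; apply/asboolP; exists S.
apply: blocked_update => // Sx; exfalso; case: hS => h1 h2 h3 h4.
have := h4 x Sx; apply/negP; rewrite -ltnNge.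
move: cx; rewrite /constraint /threshold ox => /leq_trans; apply.
rewrite -sum1_count [leqRHS]big_mkcond big_seq [leqRHS]big_seq; apply: leq_sum => u ux.
rewrite xi//=; case Su: (S u); first by rewrite h3.
by rewrite /= leq_subr.
Qed.

(* Signed coordinate c of y relative to z, and the transverse coordinate. *)
Definition phi c y : int :=
  (if c.2 then 1 else -1) * (if c.1 then y.1 - z.1 else y.2 - z.2).

Definition tra c y : int := if c.1 then y.2 - z.2 else y.1 - z.1.

Definition of_phi c (a b : int) : site :=
  let a' := (if c.2 then 1 else -1) * a in
  if c.1 then (z.1 + a', z.2 + b) else (z.1 + b, z.2 + a').

Lemma of_phiK c y : of_phi c (phi c y) (tra c y) = y.
Proof. by case: c y => [[] []] [a b]; rewrite /of_phi /phi /tra /=; congr (_, _); lia. Qed.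

Lemma phi_of c a b : phi c (of_phi c a b) = a.
Proof. by case: c => [[] []]; rewrite /of_phi /phi /=; lia. Qed.

Lemma tra_of c a b : tra c (of_phi c a b) = b.
Proof. by case: c => [[] []]; rewrite /of_phi /tra /=; lia. Qed.

Lemma mem_zbox_phi c y : (y \in zbox) = (`|phi c y| <= k)%N && (`|tra c y| <= k)%N.
Proof. by rewrite mem_zbox; case: c => [[] []]; rewrite /phi /tra /=; lia. Qed.

Lemma phi_neighbor c y u : u \in neighbors y -> (`|phi c u - phi c y| <= 1)%N.
Proof.
case: u y c => [u1 u2] [y1 y2] [[] []]; rewrite !inE /= /phi /= => /or4P[] /eqP[e1 e2]; lia.
Qed.

Lemma count_phi_neighbor c y (a : int) : a != phi c y ->
  (count (fun u => phi c u == a) (neighbors y) <= 1)%N.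
Proof.
by case: y c => [y1 y2] [[] []]; rewrite /phi /= => h; lia.
Qed.

Lemma boundary_phi x : x \in zbox -> ~ (forall u, u \in neighbors x -> u \in zbox) ->
  exists c, phi c x = k%:Z.
Proof.
move=> xb h; apply: contrapT => nc; apply: h => u ux.
have h c : phi c x != k%:Z by apply/eqP => e; apply: nc; exists c.
move: (h (true, true)) (h (true, false)) (h (false, true)) (h (false, false)) ux xb.
rewrite !mem_zbox /phi /=; case: u x {h nc} => [u1 u2] [x1 x2] /=.
rewrite !inE => h1 h2 h3 h4 /or4P[] /eqP[/= e1 e2]; move: h1 h2 h3 h4 => /=; lia.
Qed.

(** Two adjacent full rows of the box: a site of either row has all its box neighbours in the strip
    except at most one, so an occupied strip blocks itself. *)
Definition strip c (j : nat) : seq site :=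
  [seq of_phi c (2 * j + 1 + i)%N%:Z (t%:Z - k%:Z) | i <- iota 0 2, t <- iota 0 k.*2.+1].

Lemma mem_strip c j y : (y \in strip c j) =
  ((phi c y == (2 * j + 1)%N%:Z) || (phi c y == (2 * j + 2)%N%:Z)) && (`|tra c y| <= k)%N.
Proof.
apply/allpairsP/idP => [[[i t] []]|].
  rewrite !mem_iota !add0n /= => hi ht ->; rewrite phi_of tra_of; lia.
move=> /andP[h1 h2]; exists (`|(phi c y - (2 * j + 1)%N%:Z)%R|%N, `|(tra c y + k%:Z)%R|%N).
rewrite !mem_iota !add0n /=; split; [lia|lia|].
by rewrite -{1}(of_phiK c y); congr of_phi; lia.
Qed.

Lemma strip_uniq c n : uniq (flatten [seq strip c j | j <- iota 0 n]).
Proof.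
suff : forall i, uniq (flatten [seq strip c j | j <- iota i n]) by apply.
have u j : uniq (strip c j).
  apply: allpairs_uniq; [exact: iota_uniq|exact: iota_uniq|].
  move=> [a b] [a' b'] _ _ /= e.
  have := congr1 (phi c) e; have := congr1 (tra c) e; rewrite !phi_of !tra_of => h1 h2.
  congr (_, _); lia.
elim: n => // n IH i.
rewrite (_ : flatten _ = strip c i ++ flatten [seq strip c j | j <- iota i.+1 n])//.
rewrite cat_uniq IH andbT u.
apply/hasPn => y /flattenP[C /mapP[j]]; rewrite mem_iota => hj ->.
by rewrite !mem_strip; lia.
Qed.

Lemma size_strip c j : size (strip c j) = (2 * k.*2.+1)%N.
Proof. by rewrite size_allpairs !size_iota. Qed.

(** The [m] strips of a direction fill the levels 1 to 2m, strictly between [z] at level 0 and the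
    side of the box at level 2m+1. *)
Variable m : nat.
Hypothesis km : k = (2 * m).+1.

Lemma strip_sub c j : (j < m)%N -> {subset strip c j <= zbox}.
Proof. move=> jm y; rewrite mem_strip (mem_zbox_phi c); lia. Qed.

(* An occupied strip separates x from z: cut the blocked set there and add the strip. *)
Lemma frozen_strip c j x eta : phi c x = k%:Z -> (j < m)%N ->
  all (fun y => eta y == true) (strip c j) ->
  frozen (update eta x true) -> frozen (update eta x false).
Proof.
move=> xk jm /allP hs /asboolP[S [h1 h2 h3 h4]]; apply/asboolP.
pose S' y := S y && (phi c y <= (2 * j)%N%:Z) || (y \in strip c j).
have phiz : phi c z = 0 by case: (c) => [[] []]; rewrite /phi /= subrr.
exists S'; split.
- by rewrite /S' h1 phiz.
- by move=> y /orP[/andP[/h2]|/(strip_sub jm)].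
- move=> y hy; rewrite /update; case: eqP => [yx|/eqP yx].
    by exfalso; move: hy; rewrite yx /S' mem_strip xk; lia.
  case/orP: hy => [/andP[/h3]|/hs/eqP//].
  by rewrite /update (negbTE yx).
(* Off the strip, cutting [S] creates no new outside neighbour: a neighbour lost by the cut would
   have level 2j+1, which belongs to the strip. *)
- move=> y hy; have [ys|ys] := boolP (y \in strip c j); last first.
    move: hy; rewrite /S' (negbTE ys) orbF => /andP[Sy yj].
    apply: leq_trans (h4 y Sy).
    have : {in neighbors y, forall u, (u \in zbox) && ~~ S' u -> (u \in zbox) && ~~ S u}.
      move=> u uy /andP[ub]; rewrite ub /S' negb_or negb_and => /andP[+ us].
      case: (S u) => //=; move: us ub (phi_neighbor c uy).
      by rewrite mem_strip (mem_zbox_phi c); lia.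
    move=> hsub; rewrite -!size_filter; apply: uniq_leq_size.
      by apply: filter_uniq; case: (y) => a b /=; rewrite !inE !xpair_eqE; lia.
    by move=> u; rewrite !mem_filter => /andP[hu uy]; rewrite uy hsub.
  move: (ys); rewrite mem_strip => /andP[hy' _].
  (* On the strip, all outside neighbours lie on one level [a], namely 2j for the inner row and 2j+3
     for the outer one, and [y] has at most one neighbour on a level other than its own. *)
  have [a ay ha] : exists2 a : int, a != phi c y & {in neighbors y, forall u,
      (u \in zbox) && ~~ S' u -> phi c u == a}.
    have key u : u \in neighbors y -> (u \in zbox) && ~~ S' u ->
        [/\ (`|phi c u - phi c y| <= 1)%N, phi c u != (2 * j + 1)%N%:Z & phi c u != (2 * j + 2)%N%:Z].
      move=> uy /andP[ub]; rewrite /S' negb_or mem_strip => /andP[_ us].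
      move: ub us; rewrite (mem_zbox_phi c) => /andP[_ ->]; rewrite andbT negb_or => /andP[? ?].
      by split => //; exact: phi_neighbor.
    case/orP: hy' => /eqP hy'.
      exists (2 * j)%N%:Z; first by rewrite hy'; lia.
      by move=> u uy /(key u uy)[]; rewrite hy'; lia.
    exists (2 * j + 3)%N%:Z; first by rewrite hy'; lia.
    by move=> u uy /(key u uy)[]; rewrite hy'; lia.
  apply: leq_trans (count_phi_neighbor ay).
  rewrite -!size_filter; apply: uniq_leq_size.
    by apply: filter_uniq; case: (y) => a' b' /=; rewrite !inE !xpair_eqE; lia.
  by move=> u; rewrite !mem_filter => /andP[hu uy]; rewrite uy ha.
Qed.

End BlockedSets.

(** * Upper bound on the spectral gap from one box of hard sites *)

Section GapUpperBound.
Context {R : realType}.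
Variables (omega : config) (q : R) (mu : probability config R).
Hypothesis q01 : 0 < q < 1.
Hypothesis hmu : bernoulli_product (1 - q) mu.

Let q0 : 0 < q. Proof. by case/andP: q01. Qed.
Let q1 : 0 < 1 - q. Proof. by move: q01; rewrite subr_gt0 => /andP[]. Qed.
Let q01' : 0 <= q <= 1. Proof. by case/andP: q01 => *; rewrite !ltW. Qed.

Lemma Lfun_depends_on s (f : config -> R) : depends_on s f -> f \in Lfun mu 2%:E.
Proof.
move=> sf; rewrite inE; apply/andP; split; rewrite inE /=.
  exact: measurable_fun_depends_on sf.
rewrite /finite_norm unlock poweR_lty//; apply: integrable_lty => //.
have sg : depends_on s (fun eta => `|f eta| `^ 2) by move=> eta xi e; rewrite (sf _ _ e).
have := integrable_depends_on mu measurableT sg; apply: eq_integrable => //.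
Qed.

Lemma depends_on_generator s (f : config -> R) : depends_on s f ->
  exists t, depends_on t (generator omega q f).
Proof.
move=> sf; pose s' := undup s; pose t := flatten [seq x :: neighbors x | x <- s'].
have sf' : depends_on s' f by apply: depends_on_sub sf => x; rewrite mem_undup.
exists t => eta xi e; rewrite !(generatorE _ _ _ (undup_uniq s) sf').
have et x y : x \in s' -> y \in x :: neighbors x -> eta y = xi y.
  by move=> xs yx; apply: e; apply/flattenP; exists (x :: neighbors x) => //; exact: map_f.
have e' x : x \in s' -> eta x = xi x by move=> xs; apply: (et x) => //; rewrite mem_head.
apply: eq_big_seq => x xs.
rewrite (@depends_on_constraint omega x eta xi); last first.
  by move=> y yx; apply: (et x) => //; rewrite inE yx orbT.
congr (_ * (_ - _)); last exact: sf'.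
apply: (@depends_on_site_mean _ q x _ _ sf') => y.
by rewrite mem_filter => /andP[_ /e'].
Qed.

Lemma generator_domain_depends_on s (f : config -> R) : depends_on s f ->
  generator_domain omega q mu f.
Proof.
move=> sf; split; first exact: Lfun_depends_on sf.
have [t tg] := depends_on_generator sf.
exists (generator omega q f), (fun=> f); split.
- exact: Lfun_depends_on tg.
- by move=> _; exact: local_depends_on sf.
- rewrite (_ : EFin \o _ = cst 0%E); first by rewrite Lnorm0//; exact: cvg_cst.
  by apply/funext => eta /=; rewrite subrr.
- rewrite (_ : EFin \o _ = cst 0%E); first by rewrite Lnorm0//; exact: cvg_cst.
  by apply/funext => eta /=; rewrite subrr.
Qed.

Lemma dirichlet_ge0 f : (0 <= dirichlet omega q mu f)%E.
Proof.
apply: integral_ge0 => eta _; apply: esum_ge0 => x _.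
by rewrite lee_fin mulr_ge0// site_varE mulr_ge0 ?sqr_ge0// mulr_ge0// ltW.
Qed.

Lemma dirichlet_le s t (f g : config -> R) : uniq s -> uniq t -> depends_on s f ->
  depends_on t g ->
  (forall eta, \sum_(x <- s) (constraint omega x eta)%:R * site_var q x f eta <= g eta) ->
  (dirichlet omega q mu f <= (expect q t g)%:E)%E.
Proof.
move=> us ut sf tg fg.
have esE eta : (\esum_(x in [set: site]) ((constraint omega x eta)%:R * site_var q x f eta)%:E)%E =
    (\sum_(x <- s) (constraint omega x eta)%:R * site_var q x f eta)%:E.
  transitivity (\esum_(x in [set` s]) ((constraint omega x eta)%:R * site_var q x f eta)%:E)%E.
    rewrite [RHS]esum_mkcond; apply: eq_esum => x _; case: ifPn => // xs.
    rewrite site_varE (_ : f (update eta x true) = f (update eta x false)).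
      by rewrite subrr expr0n /= !mulr0.
    have xs' : x \notin s by apply: contra xs => xs; rewrite inE.
    by rewrite !(depends_on_update _ _ sf xs').
  rewrite esum_fset; [|exact: finite_seq|].
    by rewrite -fsbig_seq// sumEFin.
  by move=> x _; rewrite lee_fin mulr_ge0// site_varE mulr_ge0 ?sqr_ge0// mulr_ge0// ltW.
rewrite /dirichlet -(integral_depends_on (fun=> true) hmu tg ut).
under eq_integral do rewrite esE.
pose t' := flatten [seq x :: neighbors x | x <- s] ++ s.
have th : depends_on t' (fun eta => \sum_(x <- s) (constraint omega x eta)%:R * site_var q x f eta).
  move=> eta xi e; apply: eq_big_seq => x xs.
  have es y : y \in s -> eta y = xi y by move=> ys; apply: e; rewrite mem_cat ys orbT.
  rewrite (@depends_on_constraint omega x eta xi); last first.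
    move=> y yx; apply: e; rewrite mem_cat; apply/orP; left.
    by apply/flattenP; exists (x :: neighbors x); [exact: map_f|rewrite inE yx orbT].
  rewrite !site_varE; congr (_ * (_ * (_ - _) ^+ 2)); apply: sf => y ys;
    by rewrite /update; case: eqP => // _; exact: es.
apply: ge0_le_integral => //.
- move=> eta _; rewrite lee_fin; apply: sumr_ge0 => x _.
  by rewrite mulr_ge0// site_varE mulr_ge0 ?sqr_ge0// mulr_ge0// ltW.
- by apply/measurable_EFinP; exact: measurable_fun_depends_on th.
- by apply/measurable_EFinP; exact: measurable_fun_depends_on tg.
- by move=> eta _; rewrite lee_fin.
Qed.

Lemma variance_indicator s (A : config -> bool) : uniq s -> depends_on s A ->
  let a := expect q s (fun eta => (A eta)%:R) in
  'V_mu[(fun eta => (A eta)%:R : R)]%E = (a * (1 - a))%:E.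
Proof.
move=> us sA a; have sf : depends_on s (fun eta => (A eta)%:R : R).
  by move=> eta xi e; rewrite (sA _ _ e).
rewrite varianceE ?(Lfun_depends_on sf)// unlock.
rewrite (_ : (fun eta => (A eta)%:R) ^+ 2 = (fun eta => (A eta)%:R : R)); last first.
  by apply/funext => eta; rewrite exprfctE /=; case: (A eta); rewrite /= ?expr1n ?expr0n.
rewrite (integral_depends_on (fun=> true) hmu sf us) -/a -/(expect _ _ _) -/a.
by rewrite -EFin_expe -EFinB mulrBr mulr1 expr2.
Qed.

Lemma spectral_gap_le s (A : config -> bool) (D V : R) : uniq s -> depends_on s A ->
  let f := (fun eta => (A eta)%:R) : config -> R in
  0 < V -> V <= expect q s f * (1 - expect q s f) ->
  (dirichlet omega q mu f <= D%:E)%E ->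
  (spectral_gap omega q mu <= (D / V)%:E)%E.
Proof.
move=> us sA f V0 hV hD; have sf : depends_on s f.
  by move=> eta xi e; rewrite /f (sA _ _ e).
have VE := variance_indicator us sA; rewrite -/f in VE.
set v := _ * _ in hV VE.
have v0 : 0 < v by exact: lt_le_trans hV.
apply: (@le_trans _ _ (dirichlet omega q mu f / 'V_mu[f])%E); last first.
  rewrite VE inver gt_eqF//.
  have dD : (dirichlet omega q mu f) \is a fin_num.
    by rewrite ge0_fin_numE ?dirichlet_ge0// (le_lt_trans hD)// ltry.
  rewrite -(fineK dD) -EFinM lee_fin; move: hD; rewrite -{1}(fineK dD) lee_fin => hD.
  have d0 : 0 <= fine (dirichlet omega q mu f) by rewrite fine_ge0// dirichlet_ge0.
  by apply: ler_pM => //; [rewrite invr_ge0 ltW|rewrite lef_pV2].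
apply: ereal_inf_lbound; exists f => //; split; first exact: generator_domain_depends_on sf.
(* If [f] were almost surely equal to c, its mean would be c and c (1 - c) = v > 0, whereas [f] only
   takes the values 0 and 1. *)
move=> [c fc].
have Ef : (\int[mu]_eta (f eta)%:E = c%:E)%E.
  rewrite (ae_eq_integral (cst c%:E)) => //.
  - by rewrite integral_cst// -[RHS]mule1; congr (_ * _)%E; exact: probability_setT.
  - by apply/measurable_EFinP; exact: measurable_fun_depends_on sf.
  - by apply: filterS fc => eta h /h ->.
rewrite (integral_depends_on (fun=> true) hmu sf us) in Ef; case: Ef => Ef.
have cv : v = c * (1 - c) by rewrite /v /expect Ef.
have : mu.-negligible setT.
  case: fc => N [mN N0 hN]; exists N; split => // eta _; apply: hN => /(_ I) /=.
  rewrite /f => e; move: v0; rewrite cv -e.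
  by case: (A eta); rewrite ?subrr ?mulr0 ?mul0r ltxx.
move=> /(negligibleP mu measurableT) h0; have := @probability_setT _ _ _ mu.
by rewrite [X in X = _]h0 => /eqP; rewrite eq_sym onee_eq0.
Qed.

Lemma spectral_gap_ge0 : (0 <= spectral_gap omega q mu)%E.
Proof.
apply: le_ereal_inf_tmp => _ [f _ <-]; apply: mule_ge0; first exact: dirichlet_ge0.
by rewrite inve_ge0 variance_ge0.
Qed.

Lemma relaxation_time_ge (r : R) : 0 < r -> (spectral_gap omega q mu <= (r^-1)%:E)%E ->
  (r%:E <= relaxation_time omega q mu)%E.
Proof.
move=> r0; rewrite /relaxation_time; have := spectral_gap_ge0.
case: (spectral_gap _ _ _) => [g| |] //=; rewrite !lee_fin => g0 gr.
rewrite inver; case: eqP => [_|/eqP gn]; first exact: leey.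
by rewrite lee_fin -[leLHS]invrK lef_pV2// posrE ?invr_gt0// lt_neqAle eq_sym gn.
Qed.

Variables (z : site) (m : nat).
Let k := (2 * m).+1.
Hypothesis hard : forall x, x \in zbox z k -> omega x = false.

Let f : config -> R := fun eta => (frozen z k eta)%:R.

Let no c (eta : config) : R :=
  \prod_(C <- [seq strip z k c j | j <- iota 0 m]) (1 - (all (fun x => eta x == true) C)%:R).

Let cs : seq (bool * bool) := [:: (true, true); (true, false); (false, true); (false, false)].

(** A legal flip at an interior site leaves [f] unchanged. On the side of direction [c], a flip that
    changes [f] requires an empty site in every strip of that direction, that is [no c eta] = 1; a
    corner is assigned to any of its sides. *)
Lemma site_var_frozen_le x eta : x \in zbox z k ->
  (constraint omega x eta)%:R * site_var q x f eta <= \sum_(c <- cs) no c eta.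
Proof.
move=> xb; have no0 c : 0 <= no c eta.
  by apply: prodr_ge0 => C _; rewrite subr_ge0; case: (all _ _).
have S0 : 0 <= \sum_(c <- cs) no c eta by exact: sumr_ge0.
have [cx|] := boolP (constraint omega x eta); last by rewrite mul0r.
rewrite mul1r site_varE.
have zero : f (update eta x true) = f (update eta x false) ->
    q * (1 - q) * (f (update eta x true) - f (update eta x false)) ^+ 2 <=
    \sum_(c <- cs) no c eta by move=> ->; rewrite subrr expr0n /= mulr0.
have cxb b : constraint omega x (update eta x b).
  by rewrite constraint_update// neighbors_irrefl.
have [xi|/(boundary_phi xb)[c xc]] := pselect (forall u, u \in neighbors x -> u \in zbox z k).
  apply: zero; rewrite /f; congr ((_ : bool)%:R); apply/idP/idP => h.
    by rewrite -(update_update eta x true); exact: (frozen_interior false xi (hard xb) (cxb true) h).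
  by rewrite -(update_update eta x false); exact: (frozen_interior true xi (hard xb) (cxb false) h).
have [ht|ht] := boolP (frozen z k (update eta x true)); last first.
  apply: zero; rewrite /f (negbTE ht); case: (boolP (frozen z k (update eta x false))) => // hf.
  by rewrite (frozen_true hf) in ht.
have no1 : f (update eta x true) <> f (update eta x false) -> no c eta = 1.
  move=> ne; rewrite /no big1_seq// => C /andP[_ /mapP[j]]; rewrite mem_iota add0n => /andP[_ jm] ->.
  case: (boolP (all _ _)) => [occ|]; last by rewrite subr0.
  by exfalso; apply: ne; rewrite /f ht (frozen_strip erefl xc jm occ ht).
have [e|ne] := eqVneq (f (update eta x true)) (f (update eta x false)); first exact: zero.
apply: (@le_trans _ _ 1).
  rewrite /f ht; case: (frozen z k (update eta x false)) => /=.
    by rewrite subrr expr0n /= mulr0.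
  rewrite subr0 expr1n mulr1; have := ltW q0; have := ltW q1; nra.
have cc : c \in cs by case: (c) => [[] []].
by rewrite (big_rem c)//= (no1 (elimN eqP ne)) lerDl sumr_ge0.
Qed.

Lemma expect_no_le c : ((4 * k + 2)%:R * q) <= 1 ->
  expect q (zbox z k) (no c) <= ((4 * k + 2)%:R * q) ^+ m.
Proof.
move=> hk; have dn : depends_on (flatten [seq strip z k c j | j <- iota 0 m]) (no c).
  move=> eta xi e; apply: eq_big_seq => C hC; congr (1 - (_ : bool)%:R); apply: eq_in_all => y yC.
  by rewrite e//; apply/flattenP; exists C.
rewrite /expect (mean_super q dn); last first.
  by move=> y /flattenP[C /mapP[j]]; rewrite mem_iota add0n => /andP[_ jm] -> /(strip_sub erefl jm).
rewrite -/(expect _ _ _) /no expect_no_block ?strip_uniq// big_map.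
have u0 := ltW q1; have u1 : 1 - q <= 1 by rewrite gerBl ltW.
have B n : 1 - (1 - q) ^+ n <= n%:R * q.
  elim: n => [|n IH]; first by rewrite expr0 subrr mul0r.
  rewrite exprS -natr1.
  have p0 : 0 <= (1 - q) ^+ n by rewrite exprn_ge0// ltW.
  have p1 : (1 - q) ^+ n <= 1 by rewrite exprn_ile1.
  have := ltW q0; nra.
rewrite (_ : _ ^+ m = \prod_(j <- iota 0 m) ((4 * k + 2)%:R * q)); last first.
  by rewrite big_const_seq count_predT size_iota -Monoid.iteropE.
apply: ler_prod => j _; rewrite size_strip subr_ge0.
apply/andP; split; first by rewrite exprn_ile1.
apply: le_trans (B _) _; apply: ler_wpM2r; first exact: ltW.
by rewrite ler_nat /k; lia.
Qed.

Lemma frozen_full eta : all (fun x => eta x == true) (zbox z k) -> frozen z k eta.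
Proof.
move=> /allP h; apply/asboolP; exists (fun y => y \in zbox z k); split => //.
- by rewrite mem_zbox !subrr.
- by move=> y /h /eqP.
- move=> y _; rewrite (_ : count _ _ = 0%N)//; apply/eqP; rewrite -leqn0 leqNgt -has_count.
  by apply/hasPn => u _; rewrite andbN.
Qed.

(** For the variance, the mean of [f] is at least the probability of a full box, and its complement
    at least [q], as [z] has to be occupied. For the energy, each box site contributes at most four
    times the strip estimate, a strip having 2(2k+1) = 4k+2 sites. *)
Lemma spectral_gap_box : ((4 * k + 2)%:R * q) <= 1 ->
  (spectral_gap omega q mu <=
   ((4 * (k.*2.+1 * k.*2.+1)%N%:R * ((4 * k + 2)%:R * q) ^+ m) /
    (q * (1 - q) ^+ (k.*2.+1 * k.*2.+1)%N))%:E)%E.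
Proof.
move=> hk; have us := zbox_uniq z k; have sA := depends_on_frozen (z := z) (k := k).
have sf : depends_on (zbox z k) f by move=> eta xi e; rewrite /f (sA _ _ e).
apply: (spectral_gap_le us sA).
- by rewrite mulr_gt0// exprn_gt0.
- have a1 : (1 - q) ^+ (k.*2.+1 * k.*2.+1)%N <= expect q (zbox z k) f.
    rewrite -(size_zbox z k) -(expect_all_eq q true us).
    apply: expect_le => // eta; rewrite /f.
    by case: (boolP (all _ _)) => [/frozen_full ->|_].
  have zz : z \in zbox z k by rewrite mem_zbox !subrr.
  have a2 : expect q (zbox z k) f <= 1 - q.
    have := expect_all_eq q true (isT : uniq [:: z]); rewrite /= expr1 => <-.
    have dz : depends_on [:: z] (fun eta => (all (fun x => eta x == true) [:: z])%:R : R).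
      by move=> eta xi e /=; rewrite e// mem_head.
    rewrite -[leRHS]/(mean _ _ _ _) -(mean_super q dz (t := zbox z k)); last first.
      by move=> y; rewrite inE => /eqP ->.
    apply: mean_le => // eta; rewrite /f /= andbT.
    by case: (boolP (frozen z k eta)) => // /asboolP[S [h1 _ h3 _]]; rewrite (h3 z h1).
  rewrite mulrC; apply: ler_pM => //; first by rewrite exprn_ge0// ltW.
    exact: ltW.
  by rewrite lerBrDr -lerBrDl.
- apply: (@le_trans _ _ (expect q (zbox z k)
    (fun eta => \sum_(x <- zbox z k) \sum_(c <- cs) no c eta))%:E).
    apply: (dirichlet_le us us sf).
      move=> eta xi e; apply: eq_bigr => x _; apply: eq_bigr => c _.
      apply: eq_big_seq => C /mapP[j]; rewrite mem_iota add0n => /andP[_ jm] ->.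
      congr (1 - (_ : bool)%:R); apply: eq_in_all => y yC.
      by rewrite e//; exact: (strip_sub erefl jm yC).
    by move=> eta; rewrite big_seq [leRHS]big_seq; apply: ler_sum => x xb; exact: site_var_frozen_le.
  rewrite lee_fin expect_sum big_const_seq count_predT iter_addr_0 size_zbox expect_sum.
  rewrite -(mulr_natl (\sum_(c <- cs) _)) mulrC -mulrA [leLHS]mulrC.
  rewrite mulrCA; apply: ler_wpM2l => //.
  rewrite !big_cons big_nil addr0.
  have := expect_no_le (true, true) hk; have := expect_no_le (true, false) hk.
  have := expect_no_le (false, true) hk; have := expect_no_le (false, false) hk.
  lra.
Qed.

End GapUpperBound.

(** * Boxes of hard sites of every size *)

Section HardBoxes.
Context {R : realType}.
Variables (p : R) (nu : probability config R).
Hypothesis p01 : 0 < p < 1.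
Hypothesis hnu : bernoulli_product p nu.

(** Among [N] disjoint translates along the horizontal axis, none is hard with probability (1-u)^N
    <= 1/(1+Nu), at most [e] once N exceeds 1/(u e). *)
Lemma ae_hard_box k : \forall omega \ae nu, exists z, forall x, x \in zbox z k -> omega x = false.
Proof.
have [p0 p1] : 0 < p /\ 0 < 1 - p by move: p01; rewrite subr_gt0 => /andP[].
have hnu' : bernoulli_product (1 - (1 - p)) nu by rewrite opprB addrC subrK.
apply: negligible_small => e e0.
pose n := (k.*2.+1 * k.*2.+1)%N; pose u := (1 - p) ^+ n.
have u0 : 0 < u by exact: exprn_gt0.
have u1 : u <= 1 by apply: exprn_ile1; [exact: ltW|rewrite gerBl ltW].
pose N := (Num.truncn (u * e)^-1).+1.
pose B (j : nat) := zbox ((j * k.*2.+1)%N%:Z, 0) k.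
pose bs := [seq B j | j <- iota 0 N].
have ub : uniq (flatten bs).
  suff : forall N' i, uniq (flatten [seq B j | j <- iota i N']) by apply.
  elim=> // N' IH i.
  rewrite (_ : flatten _ = B i ++ flatten [seq B j | j <- iota i.+1 N'])//.
  rewrite cat_uniq zbox_uniq IH andbT.
  apply/hasPn => y /flattenP[C /mapP[j]]; rewrite mem_iota => hj ->.
  by rewrite /B !mem_zbox /=; nia.
pose A (omega : config) := all (fun C => ~~ all (fun x => omega x == false) C) bs.
have sA : depends_on (flatten bs) A.
  move=> eta xi h; apply: eq_in_all => C hC; congr (~~ _); apply: eq_in_all => x xC.
  by rewrite h//; apply/flattenP; exists C.
exists [set omega | A omega]; split.
- apply: (@measurable_depends_on (flatten bs)) => eta xi h.
  by rewrite /= (sA _ _ h).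
- move=> omega /= nz; apply/allP => C /mapP[j _ ->]; apply/negP => /allP hB; apply: nz.
  by exists ((j * k.*2.+1)%N%:Z, 0) => x /hB/eqP.
- have PA := prob_depends_on (fun=> true) hnu' sA ub.
  rewrite [leLHS]PA lee_fin.
  rewrite (_ : (fun xi => _) = (fun xi => \prod_(C <- bs) (1 - (all (fun x => xi x == false) C)%:R))).
    rewrite -/(expect _ _ _) expect_no_block// big_map.
    rewrite (eq_bigr (fun=> 1 - u)); last by move=> j _; rewrite size_zbox.
    rewrite big_const_seq count_predT size_iota -Monoid.iteropE -/(_ ^+ _).
    have := @pow_one_sub_le R u N; rewrite ltW//= u1 => /(_ isT) h.
    have ue : 0 < (u * e)^-1 by rewrite invr_gt0 mulr_gt0.
    have /andP[_ hN'] := truncn_itv (ltW ue).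
    have hN : 1 <= e * (1 + N%:R * u).
      have : (u * e)^-1 * (u * e) <= N%:R * (u * e).
        by apply: ler_wpM2r; [rewrite mulr_ge0// ltW|exact: ltW].
      by rewrite mulVf ?gt_eqF ?mulr_gt0//; lra.
    have s0 : 0 <= (1 - u) ^+ N by rewrite exprn_ge0// subr_ge0.
    apply: (@le_trans _ _ ((1 - u) ^+ N * (e * (1 + N%:R * u)))); first by rewrite ler_peMr.
    by rewrite mulrCA ler_piMr// ltW.
  apply/funext => xi; rewrite /A; elim: (bs) => [|C Cs IH]; first by rewrite big_nil.
  rewrite big_cons -IH /=; case: (all _ C); rewrite ?subrr ?mul0r// subr0 mul1r //.
Qed.

End HardBoxes.

(** * The exponential rate *)

Section Numerics.
Context {R : realType}.

(* The exponential rates: [(1/16)^m <= exp (- m)] with [m ~ 1/(256 q)] against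
   [(1 - q)^(- 16 m^2) <= exp (1/(512 q))]. *)
Lemma gap_bound (K q : R) (m : nat) : K = 4096 -> 0 < q -> K ^+ 4 <= q^-1 ->
  m%:R <= q^-1 / 256 < m.+1%:R -> let k := (2 * m).+1 in
  (4 * k + 2)%:R * q <= 1 /\
  (4 * (k.*2.+1 * k.*2.+1)%N%:R * ((4 * k + 2)%:R * q) ^+ m) /
    (q * (1 - q) ^+ (k.*2.+1 * k.*2.+1)%N) <= (expR (1024^-1 / q))^-1.
Proof.
have ek : (4 * (2 * m).+1 + 2 = 8 * m + 6)%N by lia.
have en : ((2 * m).+1.*2.+1 = 4 * m + 3)%N by lia.
move=> KE q0 ys /andP[m1 m2] k; have K1 : 1 <= K by lra.
have K0 : 0 < K by lra.
set y := q^-1 in ys m1 m2; have y0 : 0 < y by rewrite invr_gt0.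
have qy : q * y = 1 by rewrite mulfV ?gt_eqF.
have y4096 : 4096 <= y by rewrite -KE; apply: le_trans ys; apply: ler_eXnr.
have hk : (4 * k + 2)%:R = 8 * m%:R + 6 :> R.
  by rewrite ek natrD natrM.
have q16 : (4 * k + 2)%:R * q <= 16^-1.
  rewrite hk; apply: (@le_trans _ _ (y / 16 * q)); last by rewrite mulrC mulrA qy mul1r.
  by rewrite ler_pM2r//; lra.
split; first by apply: le_trans q16 _; rewrite invf_le1// ler1n.
set n := (k.*2.+1 * k.*2.+1)%N.
have nE : n%:R = (4 * m%:R + 3) * (4 * m%:R + 3) :> R.
  by rewrite /n en natrM natrD natrM.
have mR0 : 0 <= m%:R :> R by [].
have n1 : n%:R <= y * y / 1024.
  have h : 4 * m%:R + 3 <= y / 32 :> R by lra.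
  rewrite nE; have := ler_pM (_ : 0 <= 4 * m%:R + 3 :> R) (_ : 0 <= 4 * m%:R + 3 :> R) h h.
  by move=> /(_ _ _)/le_trans; apply; lra.
have E1 : ((4 * k + 2)%:R * q) ^+ m <= expR (1 - y / 256).
  apply: (@le_trans _ _ (expR (-1) ^+ m)).
    rewrite lerXn2r ?nnegrE ?expR_ge0 ?mulr_ge0 ?(ltW q0)//; apply: le_trans q16 _.
    have := expR_ge1Dx (- 2^-1 : R); have e2 : expR (-1) = expR (- 2^-1) * expR (- 2^-1) :> R.
      by rewrite -expRD; congr expR; lra.
    rewrite e2; nra.
  by rewrite -expRM_natl ler_expR; move: m2; rewrite -natr1; lra.
have q2 : q <= 2^-1 by have := ler_wpM2l (ltW q0) y4096; rewrite qy; lra.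
have E2 : ((1 - q) ^+ n)^-1 <= expR (y / 512).
  have h1 : (1 - q)^-1 <= expR (2 * q).
    apply: le_trans (expR_ge1Dx _); rewrite -[leLHS]div1r ler_pdivrMr; nra.
  rewrite -exprVn; apply: (@le_trans _ _ (expR (2 * q) ^+ n)).
    by rewrite lerXn2r ?nnegrE ?expR_ge0 ?invr_ge0//; lra.
  rewrite -expRM_natl ler_expR; apply: (@le_trans _ _ (y * y / 1024 * (2 * q))).
    by rewrite ler_wpM2r//; lra.
  have -> : y * y / 1024 * (2 * q) = (q * y) * (y / 512) by field.
  by rewrite qy mul1r.
(* The polynomial prefactor is absorbed by exp(y/1024) = exp(y/4096)^4 >= (y/4096)^4, which
   dominates y^3 as soon as y >= 4096^4. *)
have E3 : 4 * y * y * y / 1024 * expR 1 <= expR (y / 1024).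
  have e4 : expR 1 <= 4 :> R.
    have := expR_ge1Dx (- 2^-1 : R); have := expRxMexpNx_1 (2^-1 : R).
    have e2 : expR 1 = expR 2^-1 * expR 2^-1 :> R by rewrite -expRD; congr expR; lra.
    rewrite e2; have := expR_ge0 (2^-1 : R); nra.
  have y3 : 0 <= y ^+ 3 by rewrite exprn_ge0// ltW.
  apply: (@le_trans _ _ (y ^+ 3)).
    have := ler_wpM2l y3 e4; have -> : 4 * y * y * y / 1024 * expR 1 = y ^+ 3 * expR 1 / 256.
      by field.
    lra.
  apply: (@le_trans _ _ ((y / K) ^+ 4)).
    rewrite expr_div_n ler_pdivlMr ?exprn_gt0// [leRHS]exprSr.
    exact: ler_wpM2l.
  have -> : expR (y / 1024) = expR (y / K) ^+ 4.
    by rewrite -expRM_natl; congr expR; rewrite KE; field.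
  have yK : 0 <= y / K by rewrite divr_ge0// ltW.
  rewrite lerXn2r ?nnegrE ?expR_ge0//.
  by have := expR_ge1Dx (y / K); lra.
have I0 : 0 <= (1 - q) ^+ n by apply: exprn_ge0; lra.
rewrite -expRN invfM.
apply: (@le_trans _ _ ((4 * (y * y / 1024) * expR (1 - y / 256)) * (y * expR (y / 512)))).
  have p0 : 0 <= ((4 * k + 2)%:R * q) ^+ m by rewrite exprn_ge0// mulr_ge0// ltW.
  apply: ler_pM => //.
  - by rewrite !mulr_ge0.
  - by apply: mulr_ge0; [exact: ltW|rewrite invr_ge0].
  - by apply: ler_pM => //; lra.
  - by apply: ler_wpM2l => //; exact: ltW.
rewrite expRD.
have -> : 4 * (y * y / 1024) * (expR 1 * expR (- (y / 256))) * (y * expR (y / 512)) =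
  (4 * y * y * y / 1024 * expR 1) * (expR (- (y / 256)) * expR (y / 512)) by field.
apply: (@le_trans _ _ (expR (y / 1024) * (expR (- (y / 256)) * expR (y / 512)))).
  by apply: ler_wpM2r; [apply: mulr_ge0; exact: expR_ge0|exact: E3].
(* Rates: -1/256 + 1/512 + 1/1024 = -1/1024, the origin of the constant 1/1024 in the theorem. *)
by rewrite -!expRD ler_expR -/y; lra.
Qed.

End Numerics.

(** * Lower bounds on the hitting time at scale q^(-1/2) *)

Section LowerBound.
Context {R : realType} d (T : measurableType d) (P : probability T R) (X : R -> T -> config).
Variables (omega : config) (q : R) (mu : probability config R).
Hypothesis hX : kcm_process P X omega q mu.
Hypothesis hmu : bernoulli_product (1 - q) mu.
Hypothesis q01 : 0 < q < 1.

Let s := Num.sqrt q.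
Let s0 : 0 < s. Proof. by rewrite sqrtr_gt0; case/andP: q01. Qed.
Let ss : s * s = q. Proof. by rewrite -expr2 sqr_sqrtr// ltW//; case/andP: q01. Qed.
Let s1 : s <= 1. Proof. by rewrite -sqrtr1 ler_wsqrtr// ltW//; case/andP: q01. Qed.

Lemma powR_neg_half : q `^ (- 2^-1) = s^-1.
Proof. by rewrite powRN powR12_sqrt// ltW//; case/andP: q01. Qed.

Lemma prob_tau0_lt_sqrt : (P [set w | (tau0 X w < (2 * s^-1)%:E)%E] <= (5 * s)%:E)%E.
Proof.
apply: le_trans (prob_tau0_lt_le hX hmu q01 _) _; first by rewrite mulr_gt0// invr_gt0.
rewrite lee_fin -[in leLHS]ss (_ : 2 * (2 * s^-1) * (s * s) = 4 * s); last by field; rewrite gt_eqF.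
by have := ler_wpM2l (ltW s0) s1; lra.
Qed.

Lemma prob_tau0_le_sqrt : (P [set w | (tau0 X w <= (q `^ (- 2^-1))%:E)%E] <= (5 * s)%:E)%E.
Proof.
apply: le_trans prob_tau0_lt_sqrt; apply: le_measure; rewrite ?inE.
- exact: (measurable_tau0_le hX).
- exact: (measurable_tau0_lt hX).
- move=> w /= h; apply: le_lt_trans h _; rewrite powR_neg_half lte_fin.
  by rewrite ltr_pMl ?invr_gt0// ltr1n.
Qed.

(** Markov inequality at level 2/s, twice the target: the hitting time exceeds it with probability
    at least 1 - 5s >= 1/2. *)
Lemma expectation_tau0_ge : s <= 10^-1 -> ((q `^ (- 2^-1))%:E <= \int[P]_w tau0 X w)%E.
Proof.
move=> s10; rewrite powR_neg_half; set a := 2 * s^-1.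
have a0 : 0 <= a by rewrite mulr_ge0// invr_ge0 ltW.
pose E := [set w | (a%:E <= tau0 X w)%E]; have mE : measurable E := measurable_tau0_ge hX a.
have mt := measurable_tau0 hX.
apply: (@le_trans _ _ (\int[P]_(w in E) tau0 X w)%E); last first.
  have := @ge0_subset_integral _ _ _ P E setT mE measurableT (tau0 X) mt.
  by apply=> // w _; exact: tau0_ge0.
apply: (@le_trans _ _ (\int[P]_(w in E) a%:E)%E); last first.
  by apply: ge0_le_integral => //; exact: measurable_funTS.
have pE : P E \is a fin_num by exact: fin_num_measure.
have aE : (\int[P]_(w in E) a%:E = (a * fine (P E))%:E)%E.
  rewrite (_ : (a * fine (P E))%:E = (a%:E * (fine (P E))%:E)%E)// fineK//.
  exact: integral_cst.
rewrite aE lee_fin.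
have : (1 - (5 * s)%:E <= (fine (P E))%:E)%E.
  rewrite fineK//; have -> : E = ~` [set w | (tau0 X w < a%:E)%E].
    by apply/seteqP; split => w; rewrite /E /= leNgt => /negP.
  rewrite probability_setC; last exact: (measurable_tau0_lt hX).
  by apply: leeB => //; exact: prob_tau0_lt_sqrt.
rewrite lee_fin; move: (fine (P E)) => u hu; rewrite /a.
have si : 0 < s^-1 by rewrite invr_gt0.
have := ler_wpM2l (ltW si) hu; have := ler_wpM2l (ltW si) s10; lra.
Qed.

End LowerBound.

(** * Limits as q tends to 0, and assembly of the estimates *)

Lemma cvg_right_scale (R : realType) (c : R) : (c * q)%:E @[q --> (0 : R)^'+] --> 0%E.
Proof.
apply: cvg_EFin; first exact: nearW.
rewrite -[X in _ --> X](mulr0 c); apply: cvg_at_right_filter.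
by apply: cvgM; [exact: cvg_cst|exact: cvg_id].
Qed.

Lemma cvg_right_sqrt (R : realType) (c : R) : (c * Num.sqrt q)%:E @[q --> (0 : R)^'+] --> 0%E.
Proof.
apply: cvg_EFin; first exact: nearW.
rewrite -[X in _ --> X](mulr0 c) -[X in c * X](sqrtr0 R); apply: cvg_at_right_filter.
by apply: cvgM; [exact: cvg_cst|exact: sqrt_continuous].
Qed.

Theorem theorem2p2 (R : realType) :
  exists c : R, 0 < c /\
  forall (p : R) (nu : probability config R) (mu : R -> probability config R),
    0 < p < 1 ->
    bernoulli_product p nu ->
    (forall q : R, 0 < q < 1 -> bernoulli_product (1 - q) (mu q)) ->
    (\forall omega \ae nu, \forall q \near (0 : R)^'+,
       ((expR (c / q))%:E <= relaxation_time omega q (mu q))%E) /\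
    (\forall omega \ae nu,
       exists alpha_low alpha_up : R,
       forall (d : R -> measure_display)
              (T : forall q : R, measurableType (d q))
              (P : forall q : R, probability (T q) R)
              (X : forall q : R, R -> T q -> config),
         (forall q : R, 0 < q < 1 ->
            kcm_process (P q) (X q) omega q (mu q)) ->
         [/\ P q [set w | ((q `^ (- alpha_up))%:E <= tau0 (X q) w)%E]
               @[q --> (0 : R)^'+] --> 0%E,
             P q [set w | (tau0 (X q) w <= (q `^ (- alpha_low))%:E)%E]
               @[q --> (0 : R)^'+] --> 0%E &
             \forall q \near (0 : R)^'+,
               ((q `^ (- alpha_low))%:E <= \int[P q]_w tau0 (X q) w)%E]).
Proof.
exists 1024^-1; split; first by rewrite invr_gt0 ltr0n.
move=> p nu mu p01 hnu hmu; split.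
  (* Almost surely hard boxes exist for all sizes at once; this lets the size depend on q while the
     environment stays fixed. *)
  apply: filterS (ae_foralln (ae_hard_box p01 hnu)) => omega hb.
  have [K KE] : exists K : R, K = 4096 by exists 4096.
  have K0 : 0 < K ^+ 4 by rewrite exprn_gt0// KE ltr0n.
  near=> q.
  have q0 : 0 < q by near: q; exact: nbhs_right_gt.
  have q01 : 0 < q < 1 by rewrite q0 /=; near: q; exact: nbhs_right_lt.
  have hq : K ^+ 4 <= q^-1.
    rewrite -[leLHS]invrK lef_pV2 ?posrE ?invr_gt0//.
    by near: q; apply: nbhs_right_le; rewrite invr_gt0.
  pose m := Num.truncn (q^-1 / 256).
  have hm : m%:R <= q^-1 / 256 < m.+1%:R.
    apply: truncn_itv; apply: divr_ge0; last exact: ler0n.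
    by rewrite invr_ge0 ltW.
  have [hk1 hk2] := gap_bound KE q0 hq hm.
  have [z hz] := hb (2 * m).+1.
  apply: (relaxation_time_ge q01); first exact: expR_gt0.
  by apply: le_trans (spectral_gap_box q01 (hmu q q01) hz hk1) _; rewrite lee_fin.
apply: filterS (ae_good_blocks p01 hnu) => omega [b [B [oB Bb uB lB]]].
(* With the lower exponent 1/2, the hitting probability before time 2 q^(-1/2) is of order sqrt(q).
   The upper exponent depends on the environment through [b]. *)
exists 2^-1, (8 * b + 7)%N%:R => d T P X hX.
have near01 : \forall q \near (0 : R)^'+, 0 < q <= 2^-1.
  near=> q; apply/andP; split; near: q; [exact: nbhs_right_gt|].
  by apply: nbhs_right_le; rewrite invr_gt0.
have sub (q : R) : 0 < q <= 2^-1 -> 0 < q < 1 by lra.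
split.
- apply: (@squeeze_cvge _ _ _ _ (fun=> 0%E) _ (fun q => ((1 + 24 * b%:R) * q)%:E)).
  + apply: filterS near01 => q q02; rewrite measure_ge0 /=.
    have q01 := sub q q02; have q0 : 0 <= q by case/andP: q01 => /ltW.
    rewrite powRN powR_mulrn// -exprVn.
    exact: (prob_tau0_ge_le (hX q q01) (hmu q q01) q02 oB Bb uB (fun k => (lB k).1) (fun k => (lB k).2)).
  + exact: cvg_cst.
  + exact: cvg_right_scale.
- apply: (@squeeze_cvge _ _ _ _ (fun=> 0%E) _ (fun q => (5 * Num.sqrt q)%:E)).
  + apply: filterS near01 => q q02; rewrite measure_ge0 /=.
    have q01 := sub q q02.
    exact: (prob_tau0_le_sqrt (hX q q01) (hmu q q01) q01).
  + exact: cvg_cst.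
  + exact: cvg_right_sqrt.
- near=> q.
  have q02 : 0 < q <= 2^-1 by near: q.
  have q01 := sub q q02; apply: (expectation_tau0_ge (hX q q01) (hmu q q01) q01).
  have -> : 10^-1 = Num.sqrt (10^-1 ^+ 2) :> R by rewrite sqrtr_sqr ger0_norm// invr_ge0.
  apply: ler_wsqrtr; near: q; apply: nbhs_right_le.
  by rewrite exprn_gt0// invr_gt0.
Unshelve. all: by end_near. Qed.
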